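(* For each $d\in(1,2)$ the mappings $\nu\times\mathfrak s$, $\tau\times\mathfrak t$, $\varrho\times\mathfrak u$ have the following asymptotics as $n\to\pm\infty$: $$\begin{pmatrix}\nu_n(v)-\pi n\\ \mathfrak s_n(v)\end{pmatrix}=J_1(\Phi v)_n+\ell^d(n),$$ $$\begin{pmatrix}\tau_n(v)-\tau_n^o\\ \mathfrak t_n(v)\end{pmatrix}=-J_1(\Phi\mathfrak F^*v)_n+\ell^d(n),$$ $$\begin{pmatrix}\varrho_n(v)-\varrho_n^o\\ \mathfrak u_n(v)\end{pmatrix}=J_1(\Phi\mathfrak F^*v)_n+\ell^d(n),$$ uniformly for $v\in\mathcal B_{\mathbb C}(u,\varepsilon_u)$, for any $u\in\mathscr H$, where $\varepsilon_u=4^{-4}e^{-3\|u\|}$.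
   Context: $\mathscr H=L^2((0,1),\mathbb R)\oplus L^2((0,1),\mathbb R)$ is the real Hilbert space of $v=(v_1,v_2)^\top$ with $\|v\|^2=\int_0^1(v_1^2+v_2^2)\,dx$, $\mathscr H_{\mathbb C}$ its complexification, and $\mathcal B_{\mathbb C}(u,\varepsilon)$ the ball in $\mathscr H_{\mathbb C}$ with centre $u$ and radius $\varepsilon$. Put $J=\begin{pmatrix}0&1\\ -1&0\end{pmatrix}$, $J_1=\begin{pmatrix}1&0\\ 0&-1\end{pmatrix}$, $V=\begin{pmatrix}v_1&v_2\\ v_2&-v_1\end{pmatrix}$ and consider $Jf'+Vf=\lambda f$, $f=(f_1,f_2)^\top$, on $[0,1]$. Let $\vartheta,\varphi$ be the (vector) solutions with $\vartheta(0,\lambda)=(1,0)^\top$, $\varphi(0,\lambda)=(0,1)^\top$. For $v\in\mathscr H$ and $n\in\mathbb Z$: $\nu_n$ are the Neumann eigenvalues ($f_2(0)=f_2(1)=0$), $\tau_n$ the mixed eigenvalues of first type ($f_1(0)=f_2(1)=0$), $\varrho_n$ those of second type ($f_2(0)=f_1(1)=0$); they are the zeros of $\vartheta_2(1,\cdot),\varphi_2(1,\cdot),\vartheta_1(1,\cdot)$; all are real and simple, each family labelled in strictly increasing order so that $\nu_n=\pi n+o(1)$, $\tau_n,\varrho_n=\pi(n-\frac12)+o(1)$. The unperturbed values are $\tau_n^o=\varrho_n^o=\pi(n-\frac12)$. Norming constants: $\mathfrak s_n=-\log|\vartheta_1(1,\nu_n)|$, $\mathfrak t_n=-\log|\varphi_1(1,\tau_n)|$,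 $\mathfrak u_n=-\log|\vartheta_2(1,\varrho_n)|$. For real $v$ one has $(-1)^n\vartheta_1(1,\nu_n)>0$, $(-1)^n\varphi_1(1,\tau_n)>0$, $(-1)^{n+1}\vartheta_2(1,\varrho_n)>0$; for complex $v$ in the ball and $|n|$ large the eigenvalue with index $n$ is the unique (simple) zero of the corresponding function in the disc of radius 1 about the unperturbed value, and the norming constants are the analytic continuations (e.g. $\mathfrak s_n=-\log[(-1)^n\vartheta_1(1,\nu_n)]$). Fourier transformation: $(\Phi f)_n=\int_0^1e^{2\pi nxJ}f(x)\,dx\in\mathbb C^2$, $n\in\mathbb Z$. $(\mathfrak Fv)(x)=e^{\pi xJ}v(x)$, so $(\mathfrak F^*v)(x)=e^{-\pi xJ}v(x)$. The notation $a_n=b_n+\ell^d(n)$ means $(a_n-b_n)_n\in\ell^d$ (componentwise); uniformity on a set means that the $\ell^d$-norms of the remainders (over $|n|$ large) are bounded uniformly on the set. *)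

(* Defs.v *)
From HB Require Import structures.
From mathcomp Require Import all_boot all_order all_algebra.
From mathcomp Require Import all_classical all_reals all_analysis.
From mathcomp Require Import complex.

Set Implicit Arguments.
Unset Strict Implicit.
Unset Printing Implicit Defensive.

Import Order.TTheory GRing.Theory Num.Theory.
Import numFieldNormedType.Exports.
Local Open Scope classical_set_scope.
Local Open Scope ring_scope.
Local Open Scope complex_scope.

Section Matrices.
Context {T : nzRingType}.
Implicit Types a b c d : T.

Definition col2 a b : 'cV[T]_2 := \col_i [:: a; b]`_i.
Definition mx22 a b c d : 'M[T]_2 :=
  \matrix_(i, j) (nth [::] [:: [:: a; b]; [:: c; d]] i)`_j.

Definition J : 'M[T]_2 := mx22 0 1 (-1) 0.
Definition J1 : 'M[T]_2 := mx22 1 0 0 (-1).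

Definition potential_mx (w : 'cV[T]_2) : 'M[T]_2 :=
  mx22 (w 0 0) (w 1 0) (w 1 0) (- w 0 0).

End Matrices.

Section Hilbert.
Context {R : realType}.
Notation C := R[i].
Notation Re := (@complex.Re R).
Notation Im := (@complex.Im R).
Notation normc := (@Normc.normc R).
Notation leb := (@lebesgue_measure R).

Definition L2 (f : R -> R) : Prop := f \_ `]0, 1[ \in Lfun leb 2%:E.

(* Elements of the Hilbert spaces are given by representatives. *)
Definition inH (u : R -> 'cV[R]_2) : Prop := forall i, L2 (fun x => u x i 0).

Definition normH (u : R -> 'cV[R]_2) : R :=
  Num.sqrt (\int[leb]_(x in `]0, 1[) (u x 0 0 ^+ 2 + u x 1 0 ^+ 2)).

Definition inHC (v : R -> 'cV[C]_2) : Prop :=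
  forall i, L2 (fun x => Re (v x i 0)) /\ L2 (fun x => Im (v x i 0)).

Definition normHC (v : R -> 'cV[C]_2) : R :=
  Num.sqrt
    (\int[leb]_(x in `]0, 1[) (normc (v x 0 0) ^+ 2 + normc (v x 1 0) ^+ 2)).

Definition complexify (u : R -> 'cV[R]_2) : R -> 'cV[C]_2 :=
  fun x => map_mx (real_complex R) (u x).

Definition ballHC (u : R -> 'cV[R]_2) (e : R) : set (R -> 'cV[C]_2) :=
  [set v | inHC v /\ normHC (fun x => v x - complexify u x) < e].

Definition real_potential (v : R -> 'cV[C]_2) : Prop :=
  {ae leb, forall x, x \in `]0, 1[ -> forall i, Im (v x i 0) = 0}.

Definition integrable2 (D : set R) (g : R -> 'cV[C]_2) : Prop :=
  forall i, leb.-integrable D (EFin \o (fun x => Re (g x i 0))) /\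
            leb.-integrable D (EFin \o (fun x => Im (g x i 0))).

Definition integral2 (D : set R) (g : R -> 'cV[C]_2) : 'cV[C]_2 :=
  \col_i ((\int[leb]_(x in D) Re (g x i 0)) +i*
          (\int[leb]_(x in D) Im (g x i 0))).

(* Caratheodory solutions: [f] is absolutely continuous on [0, 1], with a.e.
   derivative [f'], and satisfies the equation a.e. *)
Definition dirac_solution (v : R -> 'cV[C]_2) (lam : C) (f : R -> 'cV[C]_2) :
    Prop :=
  exists f' : R -> 'cV[C]_2,
    [/\ integrable2 `[0, 1] f',
        (forall x, x \in `[0, 1] -> f x = f 0 + integral2 `[0, x] f') &
        {ae leb, forall x, x \in `[0, 1] ->
           J *m f' x + potential_mx (v x) *m f x = lam *: f x}].

Definition fundamental_solutions (v : R -> 'cV[C]_2)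
    (theta phi : C -> R -> 'cV[C]_2) : Prop :=
  forall lam, [/\ dirac_solution v lam (theta lam), theta lam 0 = col2 1 0,
                  dirac_solution v lam (phi lam) & phi lam 0 = col2 0 1].

Definition expmx (A : 'M[R]_2) : 'M[R]_2 :=
  lim (series (fun k => (k`!%:R)^-1 *: A ^+ k) @ \oo).

Lemma J_sqr : J * J = - 1 :> 'M[R]_2.
Proof.
apply/matrixP => i j; rewrite !mxE !big_ord_recl big_ord0 !mxE /=.
by case: i => [[|[|i]] hi] //=; case: j => [[|[|j]] hj] //=;
  rewrite ?mulr0 ?mul0r ?mulr1 ?mul1r ?addr0 ?add0r ?mulN1r ?oppr0.
Qed.

Lemma J_expr k :
  (J : 'M[R]_2) ^+ k = (-1) ^+ k./2 *: (if odd k then J else 1).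
Proof.
elim/ltn_ind: k => -[|[|k]] ih; rewrite ?expr0 ?scale1r ?expr1//.
have -> : (J : 'M[R]_2) ^+ k.+2 = - J ^+ k.
  by rewrite exprS exprS mulrA J_sqr mulN1r.
by rewrite ih//= negbK (exprS _ k./2) mulN1r scaleNr.
Qed.

Lemma expmxJ (t : R) :
  expmx (t *: J) = cos t *: 1 + sin t *: J :> 'M[R]_2.
Proof.
apply: cvg_lim => //.
rewrite (_ : series _ = (fun n => series (cos_coeff t) n *: 1 +
    series (sin_coeff t) n *: (J : 'M[R]_2))); last first.
  apply/funext => n; rewrite /series /= !scaler_suml -big_split /=.
  apply: eq_bigr => k _; rewrite exprZn J_expr !scalerA /cos_coeff /sin_coeff /=.
  case: (boolP (odd k)) => ok; rewrite ?mul0r ?scale0r ?add0r ?addr0 ?mul1r.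
    rewrite (_ : k.-1./2 = k./2) 1?[_^-1 * _]mulrC 1?mulrAC 1?[t ^+ k * _]mulrC//.
    by case: k ok => //= k; rewrite uphalf_half => /negbTE ->.
  rewrite -exprnP.
  by rewrite [_^-1 * _]mulrC mulrAC [t ^+ k * _]mulrC.
apply: cvgD; apply: cvgZr_tmp.
  by rewrite cos.unlock; exact: is_cvg_series_cos_coeff.
by rewrite sin.unlock; exact: is_cvg_series_sin_coeff.
Qed.

Definition expJ (t : R) : 'M[C]_2 := map_mx (real_complex R) (expmx (t *: J)).

Definition Fourier (f : R -> 'cV[C]_2) (n : int) : 'cV[C]_2 :=
  integral2 `]0, 1[ (fun x => expJ (2 * pi * n%:~R * x) *m f x).

Definition Fstar (v : R -> 'cV[C]_2) : R -> 'cV[C]_2 :=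
  fun x => expJ (- (pi * x)) *m v x.

(* Principal branch, with argument in ]-pi, pi]. *)
Definition Carg (z : C) : R :=
  if 0 <= Im z then acos (Re z / normc z) else - acos (Re z / normc z).
Definition Clog (z : C) : C := ln (normc z) +i* Carg z.

Definition simple_zero (F : C -> C) (z : C) : Prop :=
  F z = 0 /\
  exists2 w : C, w != 0 &
    is_derive (z : C^o) (1 : C^o) (F : C^o -> C^o) (w : C^o).

(* Below, [F] is the function whose zeros are the eigenvalues, [G] the one
   whose values at the eigenvalues define the norming constants, [o n] is the
   unperturbed eigenvalue and [sgn n] the sign of [G] at the n-th eigenvalue
   when the potential is real. *)

Definition real_labelling (F : C -> C) (o : int -> R) (mu : int -> R) : Prop :=
  [/\ forall z, F z = 0 <-> exists n, z = (mu n)%:C,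
      forall m n : int, m < n -> mu m < mu n &
      forall e : R, 0 < e ->
        exists K : nat, forall n : int, (K <= `|n|)%N -> `|mu n - o n| < e].

Definition real_data (F G : C -> C) (o : int -> R) (ev nc : int -> C) : Prop :=
  exists2 mu : int -> R, real_labelling F o mu &
    forall n, ev n = (mu n)%:C /\ nc n = (- ln (normc (G (mu n)%:C)))%:C.

Definition disc_data (F G : C -> C) (o : int -> R) (sgn : int -> C) (N : nat)
    (ev nc : int -> C) : Prop :=
  forall n : int, (N <= `|n|)%N ->
    [/\ `|ev n - (o n)%:C| < 1, F (ev n) = 0 &
        nc n = - Clog (sgn n * G (ev n))].

(* For a real potential the eigenvalues are labelled globally; for a complex
   one, only for [|n|] large, through the discs around [o n]. *)
Definition spectral_data (v : R -> 'cV[C]_2) (F G : C -> C) (o : int -> R)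
    (sgn : int -> C) (N : nat) (ev nc : int -> C) : Prop :=
  (real_potential v /\ real_data F G o ev nc) \/ disc_data F G o sgn N ev nc.

(* The last clause says that [sgn n * G z] avoids the cut ]-oo, 0] of [Clog], so
   that the principal branch is the analytic continuation in the potential. *)
Definition disc_data_defined (F G : C -> C) (o : int -> R) (sgn : int -> C)
    (N : nat) : Prop :=
  forall n : int, (N <= `|n|)%N ->
    exists z : C,
      [/\ `|z - (o n)%:C| < 1, simple_zero F z,
          (forall z', `|z' - (o n)%:C| < 1 -> F z' = 0 -> z' = z) &
          ~~ (sgn n * G z <= 0)].

Definition ell_bounded (d : R) (N : nat) (M : R) (r : int -> 'cV[C]_2) : Prop :=
  (\esum_(n in [set n : int | (N <= `|n|)%N])
     (\sum_i normc (r n i 0) `^ d)%:E <= M%:E)%E.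

Definition asymptotics (d : R) (N : nat) (M : R) (v : R -> 'cV[C]_2)
    (F G : C -> C) (o : int -> R) (sgn : int -> C) (main : int -> 'cV[C]_2) :
    Prop :=
  disc_data_defined F G o sgn N /\
  forall ev nc, spectral_data v F G o sgn N ev nc ->
    ell_bounded d N M (fun n => col2 (ev n - (o n)%:C) (nc n) - main n).

Definition neumann0 (n : int) : R := pi * n%:~R.
Definition mixed0 (n : int) : R := pi * (n%:~R - 2^-1).

End Hilbert.

(* Main.v *)
Require Import Defs.
From mathcomp Require Import all_boot all_order all_algebra finmap.
From mathcomp Require Import all_classical all_reals all_analysis measurable_realfun.
From mathcomp Require Import complex zify ring lra.
Import Order.TTheory GRing.Theory Num.Theory.
Import numFieldNormedType.Exports.
Local Open Scope classical_set_scope.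
Local Open Scope ring_scope.
Local Open Scope complex_scope.

Set Implicit Arguments.
Unset Strict Implicit.
Unset Printing Implicit Defensive.

(* With f+ = f1 + i f2 and f- = f1 - i f2, and after removing the factors
   e^{+-i lambda x}, the Dirac system at lambda = o_n + z becomes
     p' = a e^{-2izx} q,  q' = b e^{2izx} p,  p(0) = q(0) = 1,
   where a = -+i e^{-2i o_n x} (v1 + i v2) and b = +-i e^{2i o_n x} (v1 - i v2).
   In all three problems the eigenvalue condition reads e^{iz} p(1) = e^{-iz} q(1),
   and the norming constant is the logarithm of (e^{iz} p(1) + e^{-iz} q(1)) / 2.
   To first order p(1) = 1 + A e^{-2iz} and q(1) = 1 + B e^{2iz}, with A and B the
   integrals of a and b, which are the Fourier coefficients of the statement.  The
   error is bounded by |A|^2 + |B|^2, by squares of means of the primitives of a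
   and b, and by double integrals of a against a primitive of b.  Bessel's
   inequality puts the squares in l^1.  A double integral over a triangle is the
   sum of those over two half-size triangles and of a product of two Fourier
   coefficients; as the halving gains the factor 2^{-(1-1/d)} in l^d, for d > 1,
   iteration bounds the double integrals in l^d without the Hilbert transform.
   For |n| large p and q stay close to 1 uniformly on the ball (Riemann-Lebesgue for
   the centre u, smallness in L^1 for v - u), so that z - F/G is a contraction,
   thanks to the Lagrange identity, and there is exactly one zero near o_n.  For
   real potentials the n-th eigenvalue is matched with the zero near o_n by
   descending induction from large |n|. *)

(** * Integrals over subintervals of [0, 1] *)

(** The shift [z] of an eigenvalue is unknown and varies with [n] and with the potential, whereas
    Bessel's inequality and the halving argument need one fixed function per [n]. Hence the factors
    e^{-+2izx} are pulled out of the primitives of [a] and [b]. Each removal costs |z| times such a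
    primitive; as |z| is itself of first order, this is a product of two l^2 quantities, up to terms
    already controlled. The couplings are bounded in L^2 on the ball but not small, so closeness of
    [p] and [q] to 1 cannot come from a norm estimate alone. A Gronwall bound whose constant depends
    on the centre only comes first, and then starts a bootstrap that asks for smallness of means
    only. The numbers fit together as follows. One has |e^{2izx}| <= 9 for |Im z| <= 1, and 9
    sqrt(2)/256 <= 1/20 is where the radius of the ball enters; the contribution 1/20 confines [p]
    and [q] to within 1/18 of 1; this makes z - F/G contract by 12/25 on the disc of radius 1/8. *)

Section RealIntegrals.
Context {R : realType}.
Notation leb := (@lebesgue_measure R).
Implicit Types (f g h : R -> R) (s t x : R).

Definition rL1 f : Prop := leb.-integrable `[0, 1] (EFin \o f).
Definition rmeas f : Prop := measurable_fun (`[0, 1] : set R) f.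
Definition rint s t f : R := \int[leb]_(x in `[s, t]) f x.

Lemma rL1_sub f s t : rL1 f -> 0 <= s -> t <= 1 ->
  leb.-integrable `[s, t] (EFin \o f).
Proof.
move=> fi s0 t1; apply: integrableS fi => //.
by apply: subset_itv; rewrite bnd_simp.
Qed.

Lemma rL1_meas f : rL1 f -> rmeas f.
Proof. by move=> /measurable_int /measurable_EFinP. Qed.

Lemma rL1_eq f g : (forall x, 0 <= x <= 1 -> f x = g x) -> rL1 f -> rL1 g.
Proof.
move=> fg; apply: eq_integrable => // x.
by rewrite inE/= in_itv/= => /fg ->.
Qed.

Lemma rL1D f g : rL1 f -> rL1 g -> rL1 (fun x => f x + g x).
Proof. by move=> fi gi; apply: integrableD fi gi. Qed.

Lemma rL1Z c f : rL1 f -> rL1 (fun x => c * f x).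
Proof. by move=> fi; apply: integrableZl fi. Qed.

Lemma rL1N f : rL1 f -> rL1 (fun x => - f x).
Proof. by move=> fi; apply: integrableN fi. Qed.

Lemma rL1B f g : rL1 f -> rL1 g -> rL1 (fun x => f x - g x).
Proof. by move=> fi gi; apply: rL1D fi (rL1N gi). Qed.

Lemma rL1_cst c : rL1 (fun=> c).
Proof.
apply: measurable_bounded_integrable => //.
  by rewrite /= lebesgue_measure_itv/= lte01 sube0 ltry.
by exists `|c|; split => // M cM y _; exact: ltW.
Qed.

Lemma rL1_dom f g : rmeas f -> rL1 g ->
  (forall x, 0 <= x <= 1 -> `|f x| <= g x) -> rL1 f.
Proof.
move=> mf gi fg; apply: le_integrable gi => //; first exact/measurable_EFinP.
move=> x /=; rewrite in_itv/= => xI.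
by rewrite lee_fin (le_trans (fg _ xI))// ler_norm.
Qed.

Lemma rL1_norm f : rL1 f -> rL1 (fun x => `|f x|).
Proof. exact: integrable_norm. Qed.

Lemma rL1_bounded f M : rmeas f -> (forall x, 0 <= x <= 1 -> `|f x| <= M) ->
  rL1 f.
Proof. by move=> mf fM; apply: (rL1_dom mf (rL1_cst M)). Qed.

Lemma rL1_mul_bounded f g M : rL1 f -> rmeas g ->
  (forall x, 0 <= x <= 1 -> `|g x| <= M) -> rL1 (fun x => f x * g x).
Proof.
move=> fi mg gM.
apply: (rL1_dom _ (rL1Z M (rL1_norm fi))).
  by apply: measurable_funM => //; exact: rL1_meas.
by move=> x xI; rewrite normrM mulrC ler_wpM2r ?gM.
Qed.

Lemma eq_rint s t f g : (forall x, s <= x <= t -> f x = g x) ->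
  rint s t f = rint s t g.
Proof. by move=> fg; apply: eq_Rintegral => x; rewrite inE/= in_itv/= => /fg. Qed.

Lemma rintD s t f g : rL1 f -> rL1 g -> 0 <= s -> t <= 1 ->
  rint s t (fun x => f x + g x) = rint s t f + rint s t g.
Proof. by move=> fi gi s0 t1; apply: RintegralD => //; exact: rL1_sub. Qed.

Lemma rintZ s t c f : rL1 f -> 0 <= s -> t <= 1 ->
  rint s t (fun x => c * f x) = c * rint s t f.
Proof. by move=> fi s0 t1; apply: RintegralZl => //; exact: rL1_sub. Qed.

Lemma rintB s t f g : rL1 f -> rL1 g -> 0 <= s -> t <= 1 ->
  rint s t (fun x => f x - g x) = rint s t f - rint s t g.
Proof. by move=> fi gi s0 t1; apply: RintegralB => //; exact: rL1_sub. Qed.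

Lemma rint_cst s t c : s <= t -> rint s t (fun=> c) = c * (t - s).
Proof.
move=> st; rewrite /rint Rintegral_cst//= lebesgue_measure_itv/= lte_fin.
by case: ltgtP st => //= -> _; rewrite subrr.
Qed.

Lemma rint_eq s f : rint s s f = 0.
Proof. by rewrite /rint set_itv1 Rintegral_set1. Qed.

Lemma rint_ge0 s t f : (forall x, s <= x <= t -> 0 <= f x) -> 0 <= rint s t f.
Proof. by move=> f0; apply: Rintegral_ge0 => x /=; rewrite in_itv/= => /f0. Qed.

Lemma rint_le s t f g : rL1 f -> rL1 g -> 0 <= s -> t <= 1 ->
  (forall x, s <= x <= t -> f x <= g x) -> rint s t f <= rint s t g.
Proof.
move=> fi gi s0 t1 fg; apply: le_Rintegral; [by []|exact: rL1_sub|exact: rL1_sub|].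
by move=> x /=; rewrite in_itv/= => /fg.
Qed.

Lemma rint_norm s t f : rL1 f -> 0 <= s -> t <= 1 ->
  `|rint s t f| <= rint s t (fun x => `|f x|).
Proof. by move=> fi s0 t1; apply: le_normr_Rintegral => //; exact: rL1_sub. Qed.

Lemma rint_split m s t f : rL1 f -> 0 <= s -> t <= 1 -> s <= m -> m <= t ->
  rint s t f = rint s m f + rint m t f.
Proof.
move=> fi s0 t1 sm mt.
have H := @Rintegral_itvB R f (BLeft s) (BRight t) m (rL1_sub fi s0 t1).
rewrite /rint; apply/eqP; rewrite addrC -subr_eq H ?bnd_simp//.
rewrite Rintegral_itv_obnd_cbnd//.
apply: integrableS fi => //.
by apply: subset_itv; rewrite bnd_simp// (le_trans s0).
Qed.

Lemma rint_subset s t s' t' f : rL1 f -> (forall x, 0 <= x <= 1 -> 0 <= f x) ->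
  0 <= s' -> s' <= s -> s <= t -> t <= t' -> t' <= 1 ->
  rint s t f <= rint s' t' f.
Proof.
move=> fi f0 s0 ss st tt t1.
have st' := le_trans st tt.
rewrite (@rint_split s s' t')// (@rint_split t s t')// ?(le_trans s0)//.
rewrite addrCA lerDl addr_ge0// rint_ge0// => x /andP[xa xb]; apply: f0.
  by rewrite (le_trans s0 xa) (le_trans xb)// (le_trans st').
by rewrite (le_trans s0 (le_trans ss (le_trans st xa))) (le_trans xb).
Qed.

Lemma rint_sum (I : Type) (r : seq I) (F : I -> R -> R) s t :
  (forall i, rL1 (F i)) -> 0 <= s -> t <= 1 ->
  rL1 (fun x => \sum_(i <- r) F i x) /\
  rint s t (fun x => \sum_(i <- r) F i x) = \sum_(i <- r) rint s t (F i).
Proof.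
move=> Fi s0 t1; elim: r => [|i r [IH1 IH2]].
  under eq_fun do rewrite big_nil.
  split; first exact: rL1_cst.
  rewrite big_nil /rint.
  by rewrite Rintegral_cst// mul0r.
split; first by under eq_fun do rewrite big_cons; exact: rL1D.
rewrite big_cons -IH2 -rintD//.
by apply: eq_rint => x _; rewrite big_cons.
Qed.

Lemma rint_ae_eq s t f g : rL1 f -> rmeas g -> 0 <= s -> t <= 1 ->
  {ae leb, forall x, x \in `[0, 1] -> f x = g x} ->
  rint s t f = rint s t g.
Proof.
move=> fi mg s0 t1 fg; rewrite /rint /Rintegral; congr fine.
have sub : `[s, t] `<=` `[0, 1] by apply: subset_itv; rewrite bnd_simp.
apply: ae_eq_integral => //.
- by apply: measurable_funS (measurable_int _ fi).
- by apply/measurable_EFinP; apply: measurable_funS mg.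
- by apply: (@filterS _ _ (ae_filter_ringOfSetsType leb)) fg => x H /sub /= xI; rewrite H// inE.
Qed.

Lemma rL1_ae_eq f g : rL1 f -> rmeas g ->
  {ae leb, forall x, x \in `[0, 1] -> f x = g x} -> rL1 g.
Proof.
move=> /integrableP[mf fi] mg fg; apply/integrableP; split.
  exact/measurable_EFinP.
rewrite (_ : (\int[_]_(x in _) _)%E = (\int[leb]_(x in `[0%R, 1%R]) `|(EFin \o f) x|)%E)//.
apply: ae_eq_integral => //.
- by apply: measurableT_comp => //; exact/measurable_EFinP.
- by apply: measurableT_comp.
- by apply: (@filterS _ _ (ae_filter_ringOfSetsType leb)) fg => x H /= xI; rewrite H// inE.
Qed.

Lemma primitive_continuous f : rL1 f ->
  {within `[0, 1], continuous (fun x => rint 0 x f)}.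
Proof. exact: parameterized_integral_continuous. Qed.

Lemma primitive_meas f : rL1 f -> rmeas (fun x => rint 0 x f).
Proof.
move=> fi; apply: subspace_continuous_measurable_fun => //.
exact: primitive_continuous.
Qed.

Lemma primitive_bounded f : rL1 f ->
  forall x, 0 <= x <= 1 -> `|rint 0 x f| <= rint 0 1 (fun y => `|f y|).
Proof.
move=> fi x /andP[x0 x1]; rewrite (le_trans (rint_norm fi _ _))//.
by apply: rint_subset => //; exact: rL1_norm.
Qed.

End RealIntegrals.

Section OpenInterval.
Context {R : realType}.
Notation leb := (@lebesgue_measure R).
Lemma open_rint (f : R -> R) : rL1 f ->
  \int[leb]_(x in `]0, 1[) f x = rint 0 1 f.
Proof.
move=> fi; rewrite /rint.
rewrite -Rintegral_itv_obnd_cbnd.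
  apply: Rintegral_itv_bndo_bndc; apply: integrableS fi => //.
  by apply: subset_itv; rewrite bnd_simp.
by apply: integrableS fi => //; apply: subset_itv; rewrite bnd_simp.
Qed.

End OpenInterval.

(** * Fubini on a triangle and products of primitives *)

Section ProductRule.
Context {R : realType}.
Notation leb := (@lebesgue_measure R).
Implicit Types (f g h : R -> R) (s t x : R).

Lemma integral_EFin_rint D f : measurable D ->
  leb.-integrable D (EFin \o f) ->
  (\int[leb]_(x in D) (f x)%:E)%E = (\int[leb]_(x in D) f x)%R%:E.
Proof. by move=> mD fi; rewrite /Rintegral fineK//; exact: integrable_fin_num. Qed.

Lemma rL1_restrict f s t : rL1 f -> 0 <= s -> t <= 1 ->
  leb.-integrable setT (EFin \o (f \_ `[s, t])).
Proof.
move=> fi s0 t1; rewrite -restrict_EFin.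
by apply: (integrable_mkcond _ _).1 => //; exact: rL1_sub.
Qed.

(** Both sides are the integral of [f s * g t] over the triangle 0 <= s <= t <= x. With [f] and [g]
    cut off outside [0, x], this is Fubini's theorem in the plane for the kernel [k]. *)
Lemma fubini_triangle f g x : rL1 f -> rL1 g -> 0 <= x <= 1 ->
  rint 0 x (fun s => f s * rint s x g) = rint 0 x (fun t => rint 0 t f * g t).
Proof.
move=> fi gi /andP[x0 x1].
pose f0 := f \_ `[0, x]; pose g0 := g \_ `[0, x].
have f0i : leb.-integrable setT (EFin \o f0).
  exact: rL1_restrict.
have g0i : leb.-integrable setT (EFin \o g0).
  exact: rL1_restrict.
pose k (p : R * R) := if p.1 <= p.2 then f0 p.1 * g0 p.2 else 0.
have mf0 : measurable_fun setT f0 by apply/measurable_EFinP; exact: measurable_int f0i.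
have mg0 : measurable_fun setT g0 by apply/measurable_EFinP; exact: measurable_int g0i.
have mk : measurable_fun setT k.
  apply: measurable_fun_ifT => //.
    by apply: measurable_fun_ler.
  by apply: measurable_funM; apply: measurableT_comp.
have ik : (leb \x leb)%E.-integrable setT (EFin \o k).
  apply/integrable12ltyP; first exact/measurable_EFinP.
  apply: (@le_lt_trans _ _ (\int[leb]_s (`|f0 s|%:E * \int[leb]_t `|g0 t|%:E))%E).
    apply: ge0_le_integral => //.
    - by move=> s _; apply: integral_ge0 => t _; rewrite lee_fin.
    - apply: (@measurable_fun_fubini_tonelli_F _ _ _ _ R leb (abse \o (EFin \o k))) => //=.
      by apply: measurableT_comp => //; apply/measurable_EFinP.
    - apply: emeasurable_funM => //.
      by do 2 apply: measurableT_comp => //.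
    - move=> s _; rewrite -ge0_integralZl//; last first.
        by do 2 apply: measurableT_comp => //.
      apply: ge0_le_integral => //.
      + apply/measurable_EFinP; apply: measurableT_comp => //.
        by apply: (measurableT_comp mk); exact: pair1_measurable.
      + apply: measurable_funeM.
        by do 2 apply: measurableT_comp => //.
      + move=> t _ /=; rewrite -EFinM lee_fin -normrM /k/=.
        by case: ifP => // _; rewrite normr0.
  move/integrableP: f0i => [_ Hf]; move/integrableP: g0i => [_ Hg].
  rewrite ge0_integralZr//.
  - by apply: lte_mul_pinfty => //; [exact: integral_ge0 | rewrite ge0_fin_numE//; exact: integral_ge0].
  - by do 2 apply: measurableT_comp => //.
  - by apply: integral_ge0.
have := Fubini ik.
under eq_integral => s _.
  rewrite (_ : (\int[leb]_t _)%E = ((fun s => f s * rint s x g) \_ `[0, x] s)%:E).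
    over.
  rewrite patchE; case: ifPn => [|sn]; last first.
    under eq_integral => t _.
      rewrite /k/= /f0 patchE (negbTE sn) mul0r if_same; over.
    by rewrite integral0.
  rewrite inE/= in_itv/= => /andP[s0 sx].
  transitivity (\int[leb]_t ((f s)%:E * ((g \_ `[s, x]) t)%:E))%E.
    apply: eq_integral => t _; rewrite /k/= /f0 /g0 !patchE (_ : s \in `[0, x]%classic)//=; last first.
      by rewrite inE/= in_itv/= s0.
    rewrite !mem_setE !in_itv/= -EFinM.
    case: (leP s t) => [st|//]/=; last by rewrite mulr0.
    by rewrite (le_trans s0 st).
  rewrite integralZl//; last first.
    exact: rL1_restrict.
  by rewrite integral_EFin_rint ?EFinM -?Rintegral_mkcond//;
    exact: rL1_restrict.
under [X in _ = X]eq_integral => t _.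
  rewrite (_ : (\int[leb]_s _)%E = ((fun t => rint 0 t f * g t) \_ `[0, x] t)%:E).
    over.
  rewrite patchE; case: ifPn => [|tn]; last first.
    under eq_integral => s _.
      rewrite /k/= /g0 [X in _ * X]patchE (negbTE tn) mulr0 if_same; over.
    by rewrite integral0.
  rewrite inE/= in_itv/= => /andP[t0 tx].
  transitivity (\int[leb]_s (((f \_ `[0%R, t]) s)%:E * (g t)%:E))%E.
    apply: eq_integral => s _; rewrite /k/= /f0 /g0 [X in _ * X]patchE (_ : t \in `[0, x]%classic)//=; last first.
      by rewrite inE/= in_itv/= t0.
    rewrite !patchE !mem_setE !in_itv/= -EFinM.
    case: (leP s t) => [st|ts]/=; last by rewrite andbF mul0r.
    by rewrite (le_trans st tx).
  rewrite integralZr//; last first.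
    by apply: rL1_restrict => //; exact: le_trans tx x1.
  by rewrite integral_EFin_rint ?EFinM -?Rintegral_mkcond//;
    apply: rL1_restrict => //; exact: le_trans tx x1.
by move=> H; rewrite /rint Rintegral_mkcond [RHS]Rintegral_mkcond /Rintegral H.
Qed.

(** The square [0, x]^2 consists of two triangles, and [fubini_triangle] rearranges one of them.
    This is integration by parts for primitives, from which the product rule [AC_M] is derived. *)
Lemma rint_mul f g x : rL1 f -> rL1 g -> 0 <= x <= 1 ->
  rint 0 x f * rint 0 x g =
  rint 0 x (fun t => f t * rint 0 t g + rint 0 t f * g t).
Proof.
move=> fi gi xI; have /andP[x0 x1] := xI.
have i1 : rL1 (fun t => f t * rint 0 t g).
  exact: rL1_mul_bounded fi (primitive_meas gi) (primitive_bounded gi).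
have i2 : rL1 (fun t => rint 0 t f * g t).
  under eq_fun do rewrite mulrC.
  exact: rL1_mul_bounded gi (primitive_meas fi) (primitive_bounded fi).
rewrite rintD// -fubini_triangle// mulrC -rintZ//.
have i3 : rL1 (fun s => rint 0 x g * f s) by exact: rL1Z.
apply/eqP; rewrite addrC -subr_eq -rintB//; apply/eqP/eq_rint => s /andP[s0 sx].
rewrite (@rint_split _ s 0 x)//.
by rewrite mulrC -mulrBr addrC addKr.
Qed.

End ProductRule.

Definition iC {R : realType} : R[i] := Complex 0 1.

(** * Complex-valued absolutely continuous functions *)

Section ComplexNorm.
Context {R : realType}.
Notation C := R[i].
Notation Re := (@complex.Re R).
Notation Im := (@complex.Im R).
Notation nrm := (@Normc.normc R).
Implicit Types (z w : C).

Lemma ReD z w : Re (z + w) = Re z + Re w. Proof. by case: z w => ? ? []. Qed.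
Lemma ImD z w : Im (z + w) = Im z + Im w. Proof. by case: z w => ? ? []. Qed.
Lemma ReN z : Re (- z) = - Re z. Proof. by case: z. Qed.
Lemma ImN z : Im (- z) = - Im z. Proof. by case: z. Qed.
Lemma ReB z w : Re (z - w) = Re z - Re w. Proof. by rewrite ReD ReN. Qed.
Lemma ImB z w : Im (z - w) = Im z - Im w. Proof. by rewrite ImD ImN. Qed.
Lemma ReM z w : Re (z * w) = Re z * Re w - Im z * Im w.
Proof. by case: z w => ? ? []. Qed.
Lemma ImM z w : Im (z * w) = Re z * Im w + Im z * Re w.
Proof. by case: z w => ? ? []. Qed.
Lemma complex_ext z w : Re z = Re w -> Im z = Im w -> z = w.
Proof. by case: z w => ? ? [] ? ? /= -> ->. Qed.

Lemma nrm_sqr z : nrm z ^+ 2 = Re z ^+ 2 + Im z ^+ 2.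
Proof. by case: z => a b /=; rewrite sqr_sqrtr// addr_ge0 ?sqr_ge0. Qed.

Lemma nrm_ge0 z : 0 <= nrm z. Proof. by case: z => a b; rewrite sqrtr_ge0. Qed.
Lemma nrmM z w : nrm (z * w) = nrm z * nrm w. Proof. exact: Normc.normcM. Qed.
Lemma nrmD z w : nrm (z + w) <= nrm z + nrm w.
Proof. exact: le_normcD. Qed.
Lemma nrmN z : nrm (- z) = nrm z. Proof. exact: normcN. Qed.
Lemma nrmB z w : nrm (z - w) <= nrm z + nrm w.
Proof. by rewrite -(nrmN w) nrmD. Qed.
Lemma nrm_distC z w : nrm (z - w) = nrm (w - z).
Proof. by rewrite -nrmN opprB. Qed.
Lemma nrm0 : nrm 0 = 0. Proof. exact: Normc.normc0. Qed.
Lemma nrm1 : nrm 1 = 1. Proof. exact: Normc.normc1. Qed.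
Lemma nrmV z : nrm z^-1 = (nrm z)^-1. Proof. exact: Normc.normcV. Qed.
Lemma nrm_eq0 z : (nrm z == 0) = (z == 0).
Proof.
by apply/eqP/eqP => [/Normc.eq0_normc//|->]; rewrite nrm0.
Qed.
Lemma nrm_gt0 z : (0 < nrm z) = (z != 0).
Proof. by rewrite lt_def nrm_eq0 nrm_ge0 andbT. Qed.
Lemma nrm_real (r : R) : nrm r%:C = `|r|.
Proof. by rewrite /= expr0n/= addr0 sqrtr_sqr. Qed.
Lemma nrm_i : nrm iC = 1.
Proof. by rewrite /= expr0n expr1n/= add0r sqrtr1. Qed.
Lemma nrm_conj z : nrm (conjc z) = nrm z. Proof. by case: z => a b /=; rewrite sqrrN. Qed.
Lemma norm_nrm z : `|z| = (nrm z)%:C. Proof. by []. Qed.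

Lemma ler_Re z : `|Re z| <= nrm z.
Proof.
by rewrite -ler_sqr ?nnegrE ?nrm_ge0// nrm_sqr real_normK ?num_real// lerDl sqr_ge0.
Qed.
Lemma ler_Im z : `|Im z| <= nrm z.
Proof.
by rewrite -ler_sqr ?nnegrE ?nrm_ge0// nrm_sqr real_normK ?num_real// lerDr sqr_ge0.
Qed.
Lemma nrm_le_ReIm z : nrm z <= `|Re z| + `|Im z|.
Proof.
rewrite -ler_sqr ?nnegrE ?nrm_ge0 ?addr_ge0// nrm_sqr sqrrD !real_normK ?num_real//.
by rewrite lerD2r lerDl mulrn_wge0// mulr_ge0.
Qed.
Lemma nrmB_ge z w : nrm z - nrm w <= nrm (z - w).
Proof. by rewrite lerBlDr (le_trans _ (nrmD _ _))// subrK. Qed.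
Lemma conjcM z w : conjc (z * w) = conjc z * conjc w.
Proof. by case: z w => a b [c e]; apply: complex_ext; rewrite /=; ring. Qed.

Lemma conjc_sum (I : Type) (r : seq I) (F : I -> C) :
  conjc (\sum_(i <- r) F i) = \sum_(i <- r) conjc (F i).
Proof.
elim: r => [|i r IH]; first by rewrite !big_nil; apply: complex_ext; rewrite /= ?oppr0.
by rewrite !big_cons -IH; apply: complex_ext; rewrite /= ?ReD ?ImD; case: (F i) (\sum_(_ <- _) _) => a b [c e]/=; ring.
Qed.

Lemma mulJ_nrm z : conjc z * z = (nrm z ^+ 2)%:C.
Proof.
rewrite nrm_sqr; case: z => a b; apply: complex_ext; rewrite /= ?ReM ?ImM/=; ring.
Qed.

End ComplexNorm.

Section ComplexIntegrals.
Context {R : realType}.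
Notation C := R[i].
Notation Re := (@complex.Re R).
Notation Im := (@complex.Im R).
Notation nrm := (@Normc.normc R).
Notation leb := (@lebesgue_measure R).
Implicit Types (f g h F G : R -> C) (s t x : R) (c z w : C).

Definition cmeas f := rmeas (fun x => Re (f x)) /\ rmeas (fun x => Im (f x)).
Definition cL1 f := rL1 (fun x => Re (f x)) /\ rL1 (fun x => Im (f x)).
Definition cint s t f : C :=
  rint s t (fun x => Re (f x)) +i* rint s t (fun x => Im (f x)).

Lemma cL1_meas f : cL1 f -> cmeas f.
Proof. by move=> [? ?]; split; exact: rL1_meas. Qed.

Lemma rmeas_eq (f g : R -> R) : (forall x, 0 <= x <= 1 -> f x = g x) ->
  rmeas f -> rmeas g.
Proof.
move=> fg; apply: eq_measurable_fun => x.
by rewrite inE/= in_itv/= => /fg ->.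
Qed.

Lemma cmeas_eq f g : (forall x, 0 <= x <= 1 -> f x = g x) -> cmeas f -> cmeas g.
Proof.
by move=> fg [f1 f2]; split; [apply: rmeas_eq f1|apply: rmeas_eq f2] => x /fg ->.
Qed.

Lemma cL1_eq f g : (forall x, 0 <= x <= 1 -> f x = g x) -> cL1 f -> cL1 g.
Proof.
by move=> fg [f1 f2]; split; [apply: rL1_eq f1|apply: rL1_eq f2] => x /fg ->.
Qed.

Lemma cmeas_cst c : cmeas (fun=> c).
Proof. by split; exact: measurable_cst. Qed.

Lemma cmeasD f g : cmeas f -> cmeas g -> cmeas (fun x => f x + g x).
Proof.
move=> [f1 f2] [g1 g2]; split.
  by under eq_fun do rewrite ReD; exact: measurable_funD.
by under eq_fun do rewrite ImD; exact: measurable_funD.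
Qed.

Lemma cmeasM f g : cmeas f -> cmeas g -> cmeas (fun x => f x * g x).
Proof.
move=> [f1 f2] [g1 g2]; split.
  under eq_fun do rewrite ReM.
  by apply: measurable_funB; exact: measurable_funM.
under eq_fun do rewrite ImM.
by apply: measurable_funD; exact: measurable_funM.
Qed.

Lemma cmeas_nrm f : cmeas f -> rmeas (fun x => nrm (f x)).
Proof.
move=> [f1 f2].
apply: (@rmeas_eq (fun x => Num.sqrt (Re (f x) ^+ 2 + Im (f x) ^+ 2))).
  by move=> x _; case: (f x).
apply: (measurableT_comp (f := @Num.sqrt R)).
  by apply: continuous_measurable_fun; exact: sqrt_continuous.
by apply: measurable_funD; apply: measurable_funX.
Qed.

Lemma cL1_dom f (g : R -> R) : cmeas f -> rL1 g ->
  (forall x, 0 <= x <= 1 -> nrm (f x) <= g x) -> cL1 f.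
Proof.
move=> [m1 m2] gi fg; split.
  by apply: rL1_dom m1 gi _ => x xI; apply: le_trans (ler_Re _) (fg x xI).
by apply: rL1_dom m2 gi _ => x xI; apply: le_trans (ler_Im _) (fg x xI).
Qed.

Lemma cL1_nrm f : cL1 f -> rL1 (fun x => nrm (f x)).
Proof.
move=> [f1 f2]; apply: (rL1_dom _ (rL1D (rL1_norm f1) (rL1_norm f2))).
  by apply: cmeas_nrm; apply: cL1_meas.
by move=> x _; rewrite ger0_norm ?nrm_ge0// nrm_le_ReIm.
Qed.

Lemma cL1_cst c : cL1 (fun=> c).
Proof. by split; exact: rL1_cst. Qed.

Lemma cL1D f g : cL1 f -> cL1 g -> cL1 (fun x => f x + g x).
Proof.
move=> [f1 f2] [g1 g2]; split.
  by under eq_fun do rewrite ReD; exact: rL1D.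
by under eq_fun do rewrite ImD; exact: rL1D.
Qed.

Lemma cL1_mul_bounded f g M : cL1 f -> cmeas g ->
  (forall x, 0 <= x <= 1 -> nrm (g x) <= M) -> cL1 (fun x => f x * g x).
Proof.
move=> fi mg gM; apply: (cL1_dom _ (rL1Z M (cL1_nrm fi))).
  by apply: cmeasM => //; exact: cL1_meas.
by move=> x xI; rewrite nrmM mulrC ler_wpM2r ?gM ?nrm_ge0.
Qed.

Lemma cL1Z c f : cL1 f -> cL1 (fun x => c * f x).
Proof.
move=> fi; under eq_fun do rewrite mulrC.
exact: (cL1_mul_bounded fi (cmeas_cst c) (fun x _ => lexx _)).
Qed.

Lemma cL1N f : cL1 f -> cL1 (fun x => - f x).
Proof.
by move=> fi; apply: cL1_eq (cL1Z (-1) fi) => x _; rewrite mulN1r.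
Qed.

Lemma cL1B f g : cL1 f -> cL1 g -> cL1 (fun x => f x - g x).
Proof. by move=> fi gi; apply: cL1D fi (cL1N gi). Qed.

Lemma eq_cint s t f g : (forall x, s <= x <= t -> f x = g x) ->
  cint s t f = cint s t g.
Proof.
by move=> fg; congr (_ +i* _); apply: eq_rint => x /fg ->.
Qed.

Lemma cintD s t f g : cL1 f -> cL1 g -> 0 <= s -> t <= 1 ->
  cint s t (fun x => f x + g x) = cint s t f + cint s t g.
Proof.
move=> [f1 f2] [g1 g2] s0 t1; apply: complex_ext => /=; rewrite -rintD//.
  by apply: eq_rint => x _; rewrite ReD.
by apply: eq_rint => x _; rewrite ImD.
Qed.

Lemma cintZ s t c f : cL1 f -> 0 <= s -> t <= 1 ->
  cint s t (fun x => c * f x) = c * cint s t f.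
Proof.
move=> [f1 f2] s0 t1; apply: complex_ext; rewrite ?ReM ?ImM /= -!rintZ//.
  rewrite -rintB ?rL1Z//; [by apply: eq_rint => x _; rewrite ReM|exact: rL1Z..].
rewrite -rintD ?rL1Z//; [by apply: eq_rint => x _; rewrite ImM|exact: rL1Z..].
Qed.

Lemma cintN s t f : cL1 f -> 0 <= s -> t <= 1 ->
  cint s t (fun x => - f x) = - cint s t f.
Proof.
move=> fi s0 t1; rewrite -mulN1r -cintZ//.
by apply: eq_cint => x _; rewrite mulN1r.
Qed.

Lemma cintB s t f g : cL1 f -> cL1 g -> 0 <= s -> t <= 1 ->
  cint s t (fun x => f x - g x) = cint s t f - cint s t g.
Proof. by move=> fi gi s0 t1; rewrite cintD ?cintN//; exact: cL1N. Qed.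

Lemma cint_cst s t c : s <= t -> cint s t (fun=> c) = c * (t - s)%:C.
Proof.
move=> st; apply: complex_ext; rewrite ?ReM ?ImM/= rint_cst//; ring.
Qed.

Lemma cint_eq s f : cint s s f = 0.
Proof. by rewrite /cint !rint_eq. Qed.

Lemma cint_split m s t f : cL1 f -> 0 <= s -> t <= 1 -> s <= m -> m <= t ->
  cint s t f = cint s m f + cint m t f.
Proof.
by move=> [f1 f2] s0 t1 sm mt; apply: complex_ext => /=; exact: rint_split.
Qed.

Lemma cint_sum (I : Type) (r : seq I) (F : I -> R -> C) s t :
  (forall i, cL1 (F i)) -> 0 <= s -> t <= 1 ->
  cL1 (fun x => \sum_(i <- r) F i x) /\
  cint s t (fun x => \sum_(i <- r) F i x) = \sum_(i <- r) cint s t (F i).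
Proof.
move=> Fi s0 t1; elim: r => [|i r [IH1 IH2]].
  under eq_fun do rewrite big_nil.
  split; first exact: cL1_cst.
  by rewrite big_nil; apply: complex_ext; rewrite /= /rint Rintegral_cst// mul0r.
split; first by under eq_fun do rewrite big_cons; exact: cL1D.
rewrite big_cons -IH2 -cintD//.
by apply: eq_cint => x _; rewrite big_cons.
Qed.

Lemma Re_cint s t f : Re (cint s t f) = rint s t (fun x => Re (f x)).
Proof. by []. Qed.

(* Rotate the integral onto the positive real axis. *)
Lemma cint_norm s t f : cL1 f -> 0 <= s -> t <= 1 ->
  nrm (cint s t f) <= rint s t (fun x => nrm (f x)).
Proof.
move=> fi s0 t1; set I := cint s t f.
have [->|I0] := eqVneq I 0; first by rewrite nrm0 rint_ge0// => x _; exact: nrm_ge0.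
have nI : 0 < nrm I by rewrite nrm_gt0.
rewrite -(ler_pM2l nI) -expr2.
have -> : nrm I ^+ 2 = Re (cint s t (fun x => conjc I * f x)).
  by rewrite cintZ// -/I mulJ_nrm.
rewrite Re_cint -rintZ//; last exact: cL1_nrm.
apply: rint_le => //; [exact: (cL1Z _ fi).1|exact/rL1Z/cL1_nrm|].
by move=> x _; rewrite (le_trans (ler_norm _))// (le_trans (ler_Re _))// nrmM nrm_conj.
Qed.

Lemma cint_le s t f (g : R -> R) : cL1 f -> rL1 g -> 0 <= s -> t <= 1 ->
  (forall x, s <= x <= t -> nrm (f x) <= g x) ->
  nrm (cint s t f) <= rint s t g.
Proof.
move=> fi gi s0 t1 fg; apply: le_trans (cint_norm fi s0 t1) _.
by apply: rint_le => //; exact: cL1_nrm.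
Qed.

Lemma cint_ae_eq s t f g : cL1 f -> cmeas g -> 0 <= s -> t <= 1 ->
  {ae leb, forall x, x \in `[0, 1] -> f x = g x} ->
  cint s t f = cint s t g.
Proof.
move=> [f1 f2] [g1 g2] s0 t1 fg; apply: complex_ext; apply: rint_ae_eq => //.
  by apply: (@filterS _ _ (ae_filter_ringOfSetsType leb)) fg => x H /H ->.
by apply: (@filterS _ _ (ae_filter_ringOfSetsType leb)) fg => x H /H ->.
Qed.

Lemma cL1_ae_eq f g : cL1 f -> cmeas g ->
  {ae leb, forall x, x \in `[0, 1] -> f x = g x} -> cL1 g.
Proof.
move=> [f1 f2] [g1 g2] fg; split; [apply: rL1_ae_eq f1 g1 _|apply: rL1_ae_eq f2 g2 _].
  by apply: (@filterS _ _ (ae_filter_ringOfSetsType leb)) fg => x H /H ->.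
by apply: (@filterS _ _ (ae_filter_ringOfSetsType leb)) fg => x H /H ->.
Qed.

(** Absolute continuity with the derivative as explicit data: products can be differentiated, and
    derivatives changed on null sets, without any pointwise differentiability. *)
Definition AC F f := cL1 f /\ forall x, 0 <= x <= 1 -> F x = F 0 + cint 0 x f.

Lemma AC_eq F G f g : (forall x, 0 <= x <= 1 -> F x = G x) ->
  (forall x, 0 <= x <= 1 -> f x = g x) -> AC F f -> AC G g.
Proof.
move=> FG fg [fi Ff]; split; first exact: cL1_eq fi.
move=> x xI; rewrite -FG// -FG ?lexx ?ler01// (Ff x xI); congr (_ + _).
apply: eq_cint => y /andP[y0 yx]; apply: fg.
by rewrite y0 (le_trans yx)//; case/andP: xI.
Qed.

Lemma AC_primitive f : cL1 f -> AC (fun x => cint 0 x f) f.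
Proof. by move=> fi; split => // x xI; rewrite cint_eq add0r. Qed.

Lemma AC_cst c : AC (fun=> c) (fun=> 0).
Proof.
split=> [|x /andP[x0 _]]; first exact: cL1_cst.
by rewrite cint_cst// mul0r addr0.
Qed.

Lemma AC_D F G f g : AC F f -> AC G g ->
  AC (fun x => F x + G x) (fun x => f x + g x).
Proof.
move=> [fi Ff] [gi Gg]; split; first exact: cL1D.
move=> x xI; rewrite (Ff x xI) (Gg x xI) cintD//; first by ring.
by case/andP: xI.
Qed.

Lemma AC_Z c F f : AC F f -> AC (fun x => c * F x) (fun x => c * f x).
Proof.
move=> [fi Ff]; split; first exact: cL1Z.
by move=> x xI; rewrite (Ff x xI) cintZ// ?mulrDr//; case/andP: xI.
Qed.

Lemma AC_N F f : AC F f -> AC (fun x => - F x) (fun x => - f x).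
Proof.
by move=> /(AC_Z (-1)); apply: AC_eq => x _; rewrite mulN1r.
Qed.

Lemma AC_B F G f g : AC F f -> AC G g ->
  AC (fun x => F x - G x) (fun x => f x - g x).
Proof. by move=> Ff Gg; apply: AC_D Ff (AC_N Gg). Qed.

Lemma AC_meas F f : AC F f -> cmeas F.
Proof.
move=> [[f1 f2] Ff]; split.
  apply: (@rmeas_eq (fun x => Re (F 0) + rint 0 x (fun y => Re (f y)))).
    by move=> x xI; rewrite (Ff x xI) ReD.
  by apply: measurable_funD; [exact: measurable_cst|exact: primitive_meas].
apply: (@rmeas_eq (fun x => Im (F 0) + rint 0 x (fun y => Im (f y)))).
  by move=> x xI; rewrite (Ff x xI) ImD.
by apply: measurable_funD; [exact: measurable_cst|exact: primitive_meas].
Qed.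

Lemma AC_bounded F f : AC F f ->
  exists2 M, 0 <= M & forall x, 0 <= x <= 1 -> nrm (F x) <= M.
Proof.
move=> [fi Ff]; exists (nrm (F 0) + rint 0 1 (fun x => nrm (f x))).
  by rewrite addr_ge0 ?nrm_ge0 ?rint_ge0// => x _; exact: nrm_ge0.
move=> x xI; have /andP[x0 x1] := xI.
rewrite (Ff x xI) (le_trans (nrmD _ _))// lerD2l.
apply: le_trans (cint_norm fi _ _) _ => //.
by apply: rint_subset => //; [exact: cL1_nrm|move=> *; exact: nrm_ge0].
Qed.

Lemma cL1_mulAC f G g : cL1 f -> AC G g -> cL1 (fun x => f x * G x).
Proof.
move=> fi Gg; have [M _ GM] := AC_bounded Gg.
exact: cL1_mul_bounded fi (AC_meas Gg) GM.
Qed.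

Lemma cint_mul f g x : cL1 f -> cL1 g -> 0 <= x <= 1 ->
  cint 0 x f * cint 0 x g =
  cint 0 x (fun t => f t * cint 0 t g + cint 0 t f * g t).
Proof.
move=> fi gi xI; have [[f1 f2] [g1 g2]] := (fi, gi).
have /andP[x0 x1] := xI.
have i1 (h k : R -> R) : rL1 h -> rL1 k -> rL1 (fun t => h t * rint 0 t k).
  by move=> hi ki; exact: rL1_mul_bounded hi (primitive_meas ki) (primitive_bounded ki).
have i2 (h k : R -> R) : rL1 h -> rL1 k -> rL1 (fun t => rint 0 t h * k t).
  by move=> hi ki; under eq_fun do rewrite mulrC; exact: i1.
have i3 (h k : R -> R) : rL1 h -> rL1 k -> rL1 (fun t => h t * rint 0 t k + rint 0 t h * k t).
  by move=> hi ki; apply: rL1D; [exact: i1|exact: i2].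
apply: complex_ext; rewrite ?ReM ?ImM/= !rint_mul//.
  rewrite -rintB//; try exact: i3.
  by apply: eq_rint => t _; rewrite ReD !ReM/=; ring.
rewrite -rintD//; try exact: i3.
by apply: eq_rint => t _; rewrite ImD !ImM/=; ring.
Qed.

Lemma AC_M F G f g : AC F f -> AC G g ->
  AC (fun x => F x * G x) (fun x => f x * G x + F x * g x).
Proof.
move=> Ff Gg; have [[fi FE] [gi GE]] := (Ff, Gg).
have hi : cL1 (fun x => f x * G x + F x * g x).
  apply: cL1D; first exact: cL1_mulAC Gg.
  by under eq_fun do rewrite mulrC; exact: cL1_mulAC Ff.
split=> // x xI; have /andP[x0 x1] := xI.
rewrite (FE x xI) (GE x xI) mulrDl !mulrDr cint_mul//.
have j1 : cL1 (fun t => f t * cint 0 t g) by exact: cL1_mulAC (AC_primitive gi).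
have j2 : cL1 (fun t => cint 0 t f * g t).
  by under eq_fun do rewrite mulrC; exact: cL1_mulAC (AC_primitive fi).
have -> : cint 0 x (fun t => f t * G t + F t * g t) = cint 0 x (fun t =>
    F 0 * g t + (G 0 * f t + (f t * cint 0 t g + cint 0 t f * g t))).
  apply: eq_cint => t /andP[t0 tx]; have tI : 0 <= t <= 1 by rewrite t0 (le_trans tx).
  by rewrite (FE t tI) (GE t tI); ring.
have j3 := cL1D j1 j2.
have k1 := cL1Z (F 0) gi; have k2 := cL1Z (G 0) fi; have k3 := cL1D k2 j3.
by rewrite [in RHS]cintD// [in RHS]cintD// !cintZ//; ring.
Qed.

End ComplexIntegrals.

Lemma cintE (R : realType) (s t : R) (f : R -> R[i]) :
  cint s t f = (\int[@lebesgue_measure R]_(x in `[s, t]) complex.Re (f x)) +i*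
               (\int[@lebesgue_measure R]_(x in `[s, t]) complex.Im (f x)).
Proof. by []. Qed.


Lemma Im_cint (R : realType) (s t : R) (f : R -> R[i]) :
  complex.Im (cint s t f) = rint s t (fun x => complex.Im (f x)).
Proof. by []. Qed.

(** * The complex exponential *)

Section ComplexExponential.
Context {R : realType}.
Notation C := R[i].
Notation Re := (@complex.Re R).
Notation Im := (@complex.Im R).
Notation nrm := (@Normc.normc R).
Implicit Types (z w c : C).

Definition cexp z : C := (expR (Re z))%:C * (cos (Im z) +i* sin (Im z)).

Lemma cexpD z w : cexp (z + w) = cexp z * cexp w.
Proof.
apply: complex_ext; rewrite /cexp ?ReM ?ImM/= ReD ImD expRD ?cosD ?sinD;
  rewrite ?ReM ?ImM/=; ring.
Qed.

Lemma cexp0 : cexp 0 = 1.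
Proof. by apply: complex_ext; rewrite /cexp ?ReM ?ImM/= expR0 cos0 sin0; ring. Qed.

Lemma nrm_cexp z : nrm (cexp z) = expR (Re z).
Proof.
rewrite /cexp nrmM nrm_real ger0_norm ?expR_ge0//=.
by rewrite cos2Dsin2 sqrtr1 mulr1.
Qed.

Lemma cexp_neq0 z : cexp z != 0.
Proof. by rewrite -nrm_gt0 nrm_cexp expR_gt0. Qed.

Lemma cexpN z : cexp (- z) = (cexp z)^-1.
Proof.
by apply: (mulfI (cexp_neq0 z)); rewrite -cexpD subrr cexp0 mulfV ?cexp_neq0.
Qed.

Lemma cexp_conj z : conjc (cexp z) = cexp (conjc z).
Proof.
by case: z => a b; apply: complex_ext; rewrite /cexp/= sinN ?cosN; ring.
Qed.

Lemma nrm_cexp_le z : nrm (cexp z) <= expR (nrm z).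
Proof. by rewrite nrm_cexp ler_expR (le_trans (ler_norm _) (ler_Re _)). Qed.

Lemma AC_realfun (F f : R -> R) : continuous f ->
  (forall x : R, is_derive x (1 : R) F (f x)) -> AC (fun x => (F x)%:C) (fun x => (f x)%:C).
Proof.
move=> cf dF.
have cF : continuous F.
  by move=> x; apply/differentiable_continuous/derivable1_diffP; case: (dF x).
have fi : rL1 f.
  apply: continuous_compact_integrable; first exact: segment_compact.
  exact: continuous_subspaceT.
split; first by split => //; exact: rL1_cst.
move=> x /andP[x0 x1]; apply: complex_ext; last first.
  by rewrite /= rint_cst// !mul0r addr0.
rewrite /= /rint; move: x0; rewrite le_eqVlt => /predU1P[<-|x0].
  by rewrite set_itv1 Rintegral_set1 addr0.
rewrite /Rintegral (@continuous_FTC2 R f F 0 x)//=.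
- have H (a b : R) : b = a + (b - a) by ring.
  exact: H.
- exact: continuous_subspaceT.
- split=> [y _||].
  + by case: (dF y).
  + by apply/cvg_at_right_filter; exact: cF.
  + by apply/cvg_at_left_filter; exact: cF.
- by move=> y _; rewrite derive1E; case: (dF y).
Qed.

Lemma AC_cexp c : AC (fun x => cexp (c * x%:C)) (fun x => c * cexp (c * x%:C)).
Proof.
pose a := Re c; pose b := Im c.
have cl (k : R) : continuous (fun x : R => k * x).
  by move=> x; apply: cvgM; [exact: cvg_cst|exact: cvg_id].
have Eexp := @AC_realfun (fun x => expR (a * x)) (fun x => a * expR (a * x)) _ _.
have Ecos := @AC_realfun (fun x => cos (b * x)) (fun x => - b * sin (b * x)) _ _.
have Esin := @AC_realfun (fun x => sin (b * x)) (fun x => b * cos (b * x)) _ _.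
have {}Eexp : AC (fun x => (expR (a * x))%:C) (fun x => (a * expR (a * x))%:C).
  apply: Eexp => [x|x].
    apply: cvgM; first exact: cvg_cst.
    by apply: (continuous_comp (cl a x)); exact: continuous_expR.
  apply: is_derive_eq; rewrite /GRing.scale/=; ring.
have {}Ecos : AC (fun x => (cos (b * x))%:C) (fun x => (- b * sin (b * x))%:C).
  apply: Ecos => [x|x].
    apply: cvgM; first exact: cvg_cst.
    by apply: (continuous_comp (cl b x)); exact: continuous_sin.
  apply: is_derive_eq; rewrite /GRing.scale/=; ring.
have {}Esin : AC (fun x => (sin (b * x))%:C) (fun x => (b * cos (b * x))%:C).
  apply: Esin => [x|x].
    apply: cvgM; first exact: cvg_cst.
    by apply: (continuous_comp (cl b x)); exact: continuous_cos.
  apply: is_derive_eq; rewrite /GRing.scale/=; ring.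
apply: AC_eq (AC_M Eexp (AC_D Ecos (AC_Z iC Esin))) => x _; apply: complex_ext;
  rewrite /cexp /a /b !(ReD, ImD, ReM, ImM)/= ?mulr0 ?subr0 ?add0r ?addr0; ring.
Qed.

Lemma AC_L1 (F f : R -> C) : AC F f -> cL1 F.
Proof.
by move=> H; apply: cL1_eq (cL1_mulAC (cL1_cst 1) H) => x _; rewrite mul1r.
Qed.

(** Not divided by [c], so that [c = 0] is covered. The Taylor bounds below and the orthogonality of
    the waves come from this identity. *)
Lemma cint_cexp c x : 0 <= x <= 1 ->
  c * cint 0 x (fun y => cexp (c * y%:C)) = cexp (c * x%:C) - 1.
Proof.
move=> xI; have [_ H] := AC_cexp c; have /andP[x0 x1] := xI.
rewrite -cintZ//; last exact: AC_L1 (AC_cexp c).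
by rewrite (H x xI) mulr0 cexp0 addrC addKr.
Qed.

Lemma cexp_sub1_le z : nrm (cexp z - 1) <= nrm z * expR (nrm z).
Proof.
have I1 : 0 <= (1 : R) <= 1 by rewrite ler01 lexx.
have := cint_cexp z I1; rewrite mulr1 => <-.
have [_ H] := AC_cexp z.
rewrite nrmM ler_wpM2l ?nrm_ge0//.
have mE := AC_L1 (AC_cexp z).
apply: (@le_trans _ _ (rint 0 1 (fun=> expR (nrm z)))); last first.
  by rewrite rint_cst// subr0 mulr1.
apply: cint_le => //; first exact: rL1_cst.
move=> x /andP[x0 x1].
apply: le_trans (nrm_cexp_le _) _; rewrite ler_expR nrmM nrm_real ger0_norm//.
by rewrite ler_piMr ?nrm_ge0.
Qed.

Lemma cexp_sub1_lin z : nrm (cexp z - 1 - z) <= nrm z ^+ 2 * expR (nrm z).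
Proof.
have I1 : 0 <= (1 : R) <= 1 by rewrite ler01 lexx.
have := cint_cexp z I1; rewrite mulr1 => <-.
have mE := AC_L1 (AC_cexp z).
have -> : z * cint 0 1 (fun y => cexp (z * y%:C)) - z =
    z * cint 0 1 (fun y => cexp (z * y%:C) - 1).
  rewrite cintB//; last exact: cL1_cst.
  by rewrite cint_cst// subr0 mul1r mulrBr; congr (_ - _); rewrite [RHS]mulr1.
rewrite nrmM expr2 -mulrA ler_wpM2l ?nrm_ge0//.
apply: (@le_trans _ _ (rint 0 1 (fun=> nrm z * expR (nrm z)))); last first.
  by rewrite rint_cst// subr0 mulr1.
apply: cint_le => //; [exact: cL1B mE (cL1_cst _)|exact: rL1_cst|].
move=> x /andP[x0 x1]; apply: le_trans (cexp_sub1_le _) _.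
have H : nrm (z * x%:C) <= nrm z.
  by rewrite nrmM nrm_real ger0_norm// ler_piMr ?nrm_ge0.
by rewrite ler_pM ?nrm_ge0 ?expR_ge0// ler_expR.
Qed.

Lemma cos_sin_2pi_int (k : int) :
  cos (2 * pi * k%:~R) = 1 :> R /\ sin (2 * pi * k%:~R) = 0 :> R.
Proof.
have nat_case (n : nat) : cos (2 * pi * n%:R) = 1 :> R /\ sin (2 * pi * n%:R) = 0 :> R.
  elim: n => [|n [IH1 IH2]]; first by rewrite mulr0 cos0 sin0.
  have -> : 2 * pi * n.+1%:R = 2 * pi * n%:R + pi *+ 2 :> R.
    by rewrite -[n.+1]addn1 natrD mulr2n; ring.
  by rewrite cosD2pi sinD2pi.
case: k => n; first exact: nat_case.
by rewrite NegzE mulrNz mulrN cosN sinN; have [-> ->] := nat_case n.+1; rewrite oppr0.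
Qed.

Lemma cexp_2pi_int (k : int) : cexp (iC * (2 * pi * k%:~R)%:C) = 1.
Proof.
have [c s] := cos_sin_2pi_int k; set y := 2 * pi * _ in c s *.
have -> : iC * y%:C = 0 +i* y by apply: complex_ext; rewrite ?ReM ?ImM/=; ring.
by rewrite /cexp/= c s expR0 mul1r.
Qed.

End ComplexExponential.

(** * Square-integrable functions and the Cauchy-Schwarz inequality *)

Section L2.
Context {R : realType}.
Notation C := R[i].
Notation Re := (@complex.Re R).
Notation Im := (@complex.Im R).
Notation nrm := (@Normc.normc R).
Implicit Types (f g h : R -> R) (s t x : R).

(** A nonnegative quadratic polynomial has nonpositive discriminant; this is the common source of
    the Cauchy-Schwarz inequalities for integrals and for sums. *)
Lemma discriminant_le (a b c : R) : 0 <= c ->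
  (forall l, 0 <= a - 2 * l * b + l ^+ 2 * c) -> b ^+ 2 <= a * c.
Proof.
move=> c0 H; have [cE|cN] := eqVneq c 0.
  have [->|bN] := eqVneq b 0; first by rewrite expr0n cE mulr0.
  (* For [c = 0] the polynomial is affine in [l], and at this point it equals -1. *)
  have := H ((a + 1) / (2 * b)); rewrite cE mulr0 addr0.
  have -> : 2 * ((a + 1) / (2 * b)) * b = a + 1 by field.
  by lra.
have c1 : 0 < c by rewrite lt_def cN.
have := H (b / c).
have -> : a - 2 * (b / c) * b + (b / c) ^+ 2 * c = (a * c - b ^+ 2) / c by field.
by rewrite pmulr_lge0 ?invr_gt0// subr_ge0.
Qed.

Definition rL2 f := rmeas f /\ rL1 (fun x => f x ^+ 2).

Lemma rL2_mul f g : rL2 f -> rL2 g -> rL1 (fun x => f x * g x).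
Proof.
move=> [mf f2] [mg g2]; apply: (rL1_dom _ (rL1D f2 g2)).
  exact: measurable_funM.
move=> x _; rewrite normrM -[f x ^+ 2]real_normK ?num_real//.
rewrite -[g x ^+ 2]real_normK ?num_real//.
set a := `|f x|; set b := `|g x|.
have : 0 <= (a - b) ^+ 2 by exact: sqr_ge0.
have : 0 <= a * b by rewrite mulr_ge0 ?normr_ge0.
nra.
Qed.

Lemma rL2_cst c : rL2 (fun=> c).
Proof. by split; [exact: measurable_cst|exact: rL1_cst]. Qed.

Lemma rL2_L1 f : rL2 f -> rL1 f.
Proof.
move=> f2; apply: rL1_eq (rL2_mul f2 (rL2_cst 1)) => x _; rewrite mulr1//.
Qed.

Lemma rL2Z c f : rL2 f -> rL2 (fun x => c * f x).
Proof.
move=> [mf f2]; split.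
  by apply: measurable_funM => //; exact: measurable_cst.
by under eq_fun do rewrite exprMn; exact: rL1Z.
Qed.

Lemma rL2D f g : rL2 f -> rL2 g -> rL2 (fun x => f x + g x).
Proof.
move=> f2 g2; have fg := rL2_mul f2 g2; have [[mf fi] [mg gi]] := (f2, g2).
split; first exact: measurable_funD.
apply: rL1_eq (rL1D (rL1D fi gi) (rL1Z 2 fg)) => x _; ring.
Qed.

Lemma rL2_bounded f M : rmeas f -> (forall x, 0 <= x <= 1 -> `|f x| <= M) -> rL2 f.
Proof.
move=> mf fM; split => //; apply: (@rL1_bounded _ _ (M ^+ 2)).
  exact: measurable_funX.
move=> x xI; have M0 := le_trans (normr_ge0 _) (fM x xI).
by rewrite normrX ler_sqr ?nnegrE ?normr_ge0 ?fM.
Qed.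

Lemma rint_CS f g s t : rL2 f -> rL2 g -> 0 <= s -> t <= 1 ->
  rint s t (fun x => f x * g x) ^+ 2 <=
  rint s t (fun x => f x ^+ 2) * rint s t (fun x => g x ^+ 2).
Proof.
move=> f2 g2 s0 t1; have fg := rL2_mul f2 g2; have [[mf fi] [mg gi]] := (f2, g2).
apply: discriminant_le; first by apply: rint_ge0 => x _; exact: sqr_ge0.
move=> l.
have -> : rint s t (fun x => f x ^+ 2) - 2 * l * rint s t (fun x => f x * g x) +
    l ^+ 2 * rint s t (fun x => g x ^+ 2) = rint s t (fun x => (f x - l * g x) ^+ 2).
  have k1 := rL1Z (2 * l) fg; have k2 := rL1Z (l ^+ 2) gi.
  rewrite -!rintZ// -rintB// -rintD//; last exact: rL1B.
  by apply: eq_rint => x _; ring.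
by apply: rint_ge0 => x _; exact: sqr_ge0.
Qed.

Definition norm2 s t f : R := Num.sqrt (rint s t (fun x => f x ^+ 2)).

Lemma norm2_ge0 s t f : 0 <= norm2 s t f. Proof. exact: sqrtr_ge0. Qed.

Lemma norm2_sqr s t f : norm2 s t f ^+ 2 = rint s t (fun x => f x ^+ 2).
Proof. by rewrite sqr_sqrtr// rint_ge0// => x _; exact: sqr_ge0. Qed.

Lemma rint_norm2 f g s t : rL2 f -> rL2 g -> 0 <= s -> t <= 1 ->
  rint s t (fun x => f x * g x) <= norm2 s t f * norm2 s t g.
Proof.
move=> f2 g2 s0 t1; apply: le_trans (ler_norm _) _.
rewrite -ler_sqr ?nnegrE ?mulr_ge0 ?norm2_ge0// real_normK ?num_real//.
by rewrite exprMn !norm2_sqr; exact: rint_CS.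
Qed.

Lemma rint_L1_norm2 f s t : rL2 f -> 0 <= s -> s <= t -> t <= 1 ->
  rint s t f <= Num.sqrt (t - s) * norm2 s t f.
Proof.
move=> f2 s0 st t1.
rewrite (_ : rint s t f = rint s t (fun x => 1 * f x)); last first.
  by apply: eq_rint => x _; rewrite mul1r.
apply: le_trans (rint_norm2 (rL2_cst 1) f2 s0 t1) _.
by rewrite /norm2 rint_cst// expr1n mul1r.
Qed.

Definition cL2 (f : R -> C) := cmeas f /\ rL1 (fun x => nrm (f x) ^+ 2).

Lemma cL2_nrm (f : R -> C) : cL2 f -> rL2 (fun x => nrm (f x)).
Proof. by move=> [mf f2]; split => //; exact: cmeas_nrm. Qed.

Lemma cL2_mul (f g : R -> C) : cL2 f -> cL2 g -> cL1 (fun x => f x * g x).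
Proof.
move=> f2 g2; apply: (cL1_dom _ (rL2_mul (cL2_nrm f2) (cL2_nrm g2))).
  by apply: cmeasM; [case: f2|case: g2].
by move=> x _; rewrite nrmM.
Qed.

Lemma cL2_cst c : cL2 (fun=> c).
Proof. by split; [exact: cmeas_cst|exact: rL1_cst]. Qed.

Lemma cL2_L1 (f : R -> C) : cL2 f -> cL1 f.
Proof.
by move=> f2; apply: cL1_eq (cL2_mul f2 (cL2_cst 1)) => x _; rewrite mulr1.
Qed.

Lemma cL2_mul_bounded (f g : R -> C) M : cL2 f -> cmeas g ->
  (forall x, 0 <= x <= 1 -> nrm (g x) <= M) -> cL2 (fun x => g x * f x).
Proof.
move=> [mf f2] mg gM; split; first exact: cmeasM.
apply: (rL1_dom _ (rL1Z (M ^+ 2) f2)).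
  by apply: measurable_funX; apply: cmeas_nrm; exact: cmeasM.
move=> x xI; rewrite ger0_norm ?sqr_ge0// nrmM exprMn.
have M0 := le_trans (nrm_ge0 _) (gM x xI).
by rewrite ler_wpM2r ?sqr_ge0// ler_sqr ?nnegrE ?nrm_ge0 ?gM.
Qed.

Lemma cL2_mulAC (f G g : R -> C) : cL2 f -> AC G g -> cL2 (fun x => G x * f x).
Proof.
move=> f2 Gg; have [M _ GM] := AC_bounded Gg.
exact: cL2_mul_bounded f2 (AC_meas Gg) GM.
Qed.

Lemma cL2_eq (f g : R -> C) : (forall x, 0 <= x <= 1 -> f x = g x) -> cL2 f -> cL2 g.
Proof.
move=> fg [mf f2]; split; first exact: cmeas_eq mf.
by apply: rL1_eq f2 => x /fg ->.
Qed.

Lemma cL2D (f g : R -> C) : cL2 f -> cL2 g -> cL2 (fun x => f x + g x).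
Proof.
move=> f2 g2; have [[mf _] [mg _]] := (f2, g2).
have [_ H] := rL2D (cL2_nrm f2) (cL2_nrm g2).
split; first exact: cmeasD.
apply: (rL1_dom _ H).
  by apply: measurable_funX; apply: cmeas_nrm; exact: cmeasD.
move=> x _; rewrite ger0_norm ?sqr_ge0// ler_sqr ?nnegrE ?addr_ge0 ?nrm_ge0//.
exact: nrmD.
Qed.

Lemma cL2Z c (f : R -> C) : cL2 f -> cL2 (fun x => c * f x).
Proof. by move=> f2; exact: cL2_mul_bounded f2 (cmeas_cst c) (fun x _ => lexx _). Qed.

End L2.

Lemma cexp_i (R : realType) (t : R) :
  cexp (0 +i* t) = (cos t)%:C + iC * (sin t)%:C.
Proof. by apply: complex_ext; rewrite /cexp/= expR0; ring. Qed.

(** * Bessel's inequality *)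

Section Bessel.
Context {R : realType}.
Notation C := R[i].
Notation Re := (@complex.Re R).
Notation Im := (@complex.Im R).
Notation nrm := (@Normc.normc R).
Implicit Types (f g h : R -> C) (s t x : R).

Lemma Re_sum (I : Type) (r : seq I) (F : I -> C) :
  Re (\sum_(i <- r) F i) = \sum_(i <- r) Re (F i).
Proof. by elim: r => [|i r IH]; rewrite ?big_nil// !big_cons ReD IH. Qed.

Lemma nrm_sqrB (z w : C) :
  nrm (z - w) ^+ 2 = nrm z ^+ 2 - 2 * Re (conjc w * z) + Re (conjc w * w).
Proof. by rewrite !nrm_sqr ReB ImB !ReM/=; case: z w => a b [c e]/=; ring. Qed.

(** Waves with such frequencies are orthonormal on [0, 1]; the clause on [k = 0] makes [w]
    injective. Both 2 o_n and -2 o_n qualify, as the o_n form an arithmetic progression of step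
    pi. *)
Definition separated (w : int -> R) : Prop :=
  forall n m : int, exists k : int, w n - w m = 2 * pi * k%:~R /\ (k = 0 -> n = m).

Definition wave (w : R) (x : R) : C := cexp (iC * w%:C * x%:C).

Lemma nrm_wave w x : nrm (wave w x) = 1.
Proof.
have -> : wave w x = cexp (0 +i* (w * x)).
  by congr cexp; apply: complex_ext; rewrite /=; ring.
by rewrite nrm_cexp expR0.
Qed.

Lemma AC_wave w : AC (wave w) (fun x => iC * w%:C * wave w x).
Proof. exact: AC_cexp. Qed.

Lemma wave_conj w x : conjc (wave w x) = wave (- w) x.
Proof.
rewrite /wave cexp_conj; congr cexp; apply: complex_ext; rewrite /=; ring.
Qed.

Lemma waveD w w' x : wave (w + w') x = wave w x * wave w' x.
Proof.
rewrite /wave -cexpD; congr cexp; apply: complex_ext; rewrite /=; ring.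
Qed.

Lemma cint_wave_2pi (k : int) : k != 0 -> cint 0 1 (wave (2 * pi * k%:~R)) = 0.
Proof.
move=> k0; have I1 : 0 <= (1 : R) <= 1 by rewrite ler01 lexx.
have := cint_cexp (iC * (2 * pi * k%:~R)%:C) I1.
rewrite mulr1 cexp_2pi_int subrr => /eqP; rewrite mulf_eq0 => /orP[|/eqP//].
rewrite mulf_eq0 => /orP[/eqP/(congr1 Im)/= /eqP|/eqP/(congr1 Re)/= /eqP].
  by rewrite oner_eq0.
rewrite !mulf_eq0 pnatr_eq0 intr_eq0 (negbTE k0) [pi == 0]gt_eqF ?pi_gt0//.
Qed.

Lemma cint_wave_0 : cint 0 1 (wave 0) = 1 :> C.
Proof.
rewrite (@eq_cint _ _ _ _ (fun=> 1)) ?cint_cst//; last first.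
  by move=> x _; rewrite /wave mulr0 mul0r cexp0.
by rewrite subr0 mul1r.
Qed.

Lemma cint_waves (w : int -> R) (n m : int) : separated w ->
  cint 0 1 (fun x => wave (w n) x * conjc (wave (w m) x)) = (n == m)%:R.
Proof.
move=> ws; have [k [kE k0]] := ws n m.
rewrite (@eq_cint _ _ _ _ (wave (w n - w m))); last first.
  by move=> x _; rewrite wave_conj waveD.
have [<-|nm] := eqVneq n m; first by rewrite subrr cint_wave_0.
rewrite kE cint_wave_2pi//; apply/eqP => kz.
by move/eqP: nm; apply; exact: k0.
Qed.

(** [P] is the projection of [f] onto the span of the conjugate waves, because [c n] carries no
    conjugation. In the expansion of the integral of |f - P|^2 the cross term is minus twice the sum
    of the |c n|^2 and the last term is that sum once. *)
Lemma bessel_full (w : int -> R) f (r : seq int) : separated w -> cL2 f -> uniq r ->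
  \sum_(n <- r) nrm (cint 0 1 (fun x => wave (w n) x * f x)) ^+ 2 <=
  rint 0 1 (fun x => nrm (f x) ^+ 2).
Proof.
move=> ws f2 ru; set c := fun n => cint 0 1 (fun x => wave (w n) x * f x).
pose P x := \sum_(n <- r) c n * conjc (wave (w n) x).
have W n : AC (wave (w n)) (fun x => iC * (w n)%:C * wave (w n) x) by exact: AC_wave.
have Wc n : AC (fun x => conjc (wave (w n) x)) (fun x => iC * (- w n)%:C * wave (- w n) x).
  by apply: AC_eq (AC_wave (- w n)) => x _; rewrite ?wave_conj.
have i1 n : cL1 (fun x => conjc (c n) * (wave (w n) x * f x)).
  exact/cL1Z/cL2_L1/(cL2_mulAC f2 (W n)).
have i2 n m : cL1 (fun x => conjc (c n) * c m * (wave (w n) x * conjc (wave (w m) x))).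
  exact/cL1Z/AC_L1/(AC_M (W n) (Wc m)).
have l0 : (0 : R) <= 0 by [].
have l1 : (1 : R) <= 1 by [].
have [j1 E1] := cint_sum r i1 l0 l1.
have i3 n : cL1 (fun x => \sum_(m <- r) conjc (c n) * c m * (wave (w n) x * conjc (wave (w m) x))).
  by have [] := cint_sum r (i2 n) l0 l1.
have [j3 E3] := cint_sum r i3 l0 l1.
have Pc x : conjc (P x) = \sum_(n <- r) conjc (c n) * wave (w n) x.
  rewrite /P conjc_sum; apply: eq_bigr => n _.
  by rewrite conjcM conjcK.
have : 0 <= rint 0 1 (fun x => nrm (f x - P x) ^+ 2).
  by apply: rint_ge0 => x _; exact: sqr_ge0.
have -> : rint 0 1 (fun x => nrm (f x - P x) ^+ 2) = rint 0 1 (fun x =>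
  (nrm (f x) ^+ 2 - 2 * Re (\sum_(n <- r) conjc (c n) * (wave (w n) x * f x))) +
  Re (\sum_(n <- r) \sum_(m <- r) conjc (c n) * c m * (wave (w n) x * conjc (wave (w m) x)))).
  apply: eq_rint => x _; rewrite nrm_sqrB Pc; congr (_ - 2 * Re _ + Re _).
    by rewrite mulr_suml; apply: eq_bigr => n _; rewrite mulrA.
  rewrite mulr_suml; apply: eq_bigr => n _; rewrite /P mulr_sumr.
  by apply: eq_bigr => m _; ring.
have k1 := f2.2; have k2 := rL1Z 2 j1.1; have k3 := rL1B k1 k2.
rewrite (rintD k3 j3.1)// (rintB k1 k2)// (rintZ _ j1.1)// -!Re_cint E1 E3.
have -> : Re (\sum_(n <- r) cint 0 1 (fun x => conjc (c n) * (wave (w n) x * f x))) =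
    \sum_(n <- r) nrm (c n) ^+ 2.
  rewrite Re_sum; apply: eq_bigr => n _; rewrite cintZ ?mulJ_nrm//.
  exact/cL2_L1/(cL2_mulAC f2 (W n)).
have -> : Re (\sum_(n <- r) cint 0 1 (fun x => \sum_(m <- r)
    conjc (c n) * c m * (wave (w n) x * conjc (wave (w m) x)))) =
    \sum_(n <- r) nrm (c n) ^+ 2.
  rewrite Re_sum; apply: eq_big_seq => n nr.
  have [_ ->] := cint_sum r (i2 n) l0 l1.
  rewrite (bigD1_seq n)// big1_seq => [|m /andP[mn _]].
    rewrite cintZ; [|exact/AC_L1/(AC_M (W n) (Wc n))|by []|by []].
    by rewrite cint_waves// eqxx mulr1 [X in Re X]addr0 mulJ_nrm.
  rewrite cintZ; [|exact/AC_L1/(AC_M (W n) (Wc m))|by []|by []].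
  by rewrite cint_waves// eq_sym (negbTE mn) mulr0.
by rewrite /c; set S := \sum_(n <- r) _; set I := rint _ _ _; lra.
Qed.

Definition cut s t f x : C := if s <= x <= t then f x else 0.

Lemma cut_rint s t (f : R -> R) : 0 <= s -> t <= 1 ->
  rint 0 1 (fun x => if s <= x <= t then f x else 0) = rint s t f.
Proof.
move=> s0 t1; rewrite /rint.
transitivity (\int[@lebesgue_measure R]_(x in `[0, 1]) (f \_ `[s, t]) x).
  by apply: eq_Rintegral => x _; rewrite patchE mem_setE in_itv.
rewrite -Rintegral_mkcondr; congr (Rintegral _ _ _).
apply: setIidr; apply: subset_itv; rewrite bnd_simp//.
Qed.

Lemma cut_cint s t f : 0 <= s -> t <= 1 -> cint 0 1 (cut s t f) = cint s t f.
Proof.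
move=> s0 t1; apply: complex_ext; rewrite /= -(cut_rint _ s0 t1);
  by apply: eq_rint => x _; rewrite /cut; case: ifP.
Qed.

Lemma rmeas_cut s t (f : R -> R) : rmeas f ->
  rmeas (fun x => if s <= x <= t then f x else 0).
Proof.
move=> mf; apply: (@rmeas_eq _ (fun x => f x * \1_`[s, t] x)).
  move=> x _; rewrite indicE mem_setE in_itv/=.
  by case: ifP; rewrite ?mulr1 ?mulr0.
apply: measurable_funM.
- by [].
- by apply: (measurable_funS measurableT) => //; exact: measurable_indic.
Qed.

Lemma cL2_cut s t f : cL2 f -> cL2 (cut s t f).
Proof.
move=> [[m1 m2] f2]; split.
  split; [apply: rmeas_eq (rmeas_cut s t m1)|apply: rmeas_eq (rmeas_cut s t m2)];
    by move=> x _; rewrite /cut; case: ifP.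
apply: (rL1_dom _ f2).
  apply: rmeas_eq (rmeas_cut s t (rL1_meas f2)) => x _.
  by rewrite /cut; case: ifP => // _; rewrite nrm0 expr0n.
move=> x _; rewrite ger0_norm ?sqr_ge0// /cut; case: ifP => // _.
by rewrite nrm0 expr0n sqr_ge0.
Qed.

(** Extending [f] by 0 outside [s, t] reduces to the whole interval. The halving argument needs the
    inequality on every subinterval, with the norm of [f] on that subinterval only. *)
Lemma bessel (w : int -> R) f s t (r : seq int) : separated w -> cL2 f ->
  0 <= s -> t <= 1 -> uniq r ->
  \sum_(n <- r) nrm (cint s t (fun x => wave (w n) x * f x)) ^+ 2 <=
  rint s t (fun x => nrm (f x) ^+ 2).
Proof.
move=> ws f2 s0 t1 ru.
have := bessel_full ws (cL2_cut s t f2) ru.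
rewrite (_ : rint 0 1 _ = rint s t (fun x => nrm (f x) ^+ 2)); last first.
  rewrite -[RHS](cut_rint _ s0 t1); apply: eq_rint => x _; rewrite /cut; case: ifP => //.
  by rewrite nrm0 expr0n.
suff -> : \sum_(n <- r) nrm (cint 0 1 (fun x => wave (w n) x * cut s t f x)) ^+ 2 =
  \sum_(n <- r) nrm (cint s t (fun x => wave (w n) x * f x)) ^+ 2 by [].
apply: eq_bigr => n _; congr (nrm _ ^+ 2); rewrite -[RHS](cut_cint _ s0 t1).
by apply: eq_cint => x _; rewrite /cut; case: ifP; rewrite ?mulr0.
Qed.

End Bessel.

(** * Double oscillatory integrals in l^d *)

Section PowerSums.
Context {R : realType}.
Variables (d : R) (d1 : 1 < d).
Implicit Types (x y s t : R).

Let d0 : 0 < d. Proof. exact: lt_trans ltr01 d1. Qed.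
Let dn0 : d != 0. Proof. by rewrite gt_eqF. Qed.

(** Convexity of the power in tangent-line form, from Young's inequality for s and t^(d-1) with the
    conjugate exponents d and d/(d-1). *)
Lemma powR_tangent s t : 0 <= s -> 0 <= t ->
  t `^ d + d * t `^ (d - 1) * (s - t) <= s `^ d.
Proof.
move=> s0 t0; have d10 : 0 < d - 1 by rewrite subr_gt0.
have d1n : d - 1 != 0 by rewrite gt_eqF.
have q0 : 0 < d / (d - 1) by rewrite divr_gt0.
have pq : d^-1 + (d / (d - 1))^-1 = 1.
  by field; rewrite d1n dn0.
have := conjugate_powR s0 (powR_ge0 t (d - 1)) d0 q0 pq.
rewrite -powRrM (_ : (d - 1) * (d / (d - 1)) = d); last by field.
have tE : t * t `^ (d - 1) = t `^ d.
  have [->|tn] := eqVneq t 0; first by rewrite mul0r powR0.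
  rewrite -{1}[t]powRr1// -powRD; last by rewrite tn implybT.
  by congr (_ `^ _); ring.
rewrite -(ler_pM2l d0).
have -> : d * (s `^ d / d + t `^ d / (d / (d - 1))) = s `^ d + (d - 1) * t `^ d.
  by field; rewrite d1n dn0.
move=> H; have : d * (t * t `^ (d - 1)) = d * t `^ d by rewrite tE.
by lra.
Qed.

(** The tangent inequalities at the weighted mean [t] are averaged, and their linear terms
    cancel. *)
Lemma powR_convex x y p : 0 <= x -> 0 <= y -> 0 <= p <= 1 ->
  (p * x + (1 - p) * y) `^ d <= p * x `^ d + (1 - p) * y `^ d.
Proof.
move=> x0 y0 /andP[p0 p1]; set t := p * x + (1 - p) * y.
have q0 : 0 <= 1 - p by rewrite subr_ge0.
have t0 : 0 <= t by rewrite addr_ge0// mulr_ge0.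
have H1 := ler_wpM2l p0 (powR_tangent x0 t0).
have H2 := ler_wpM2l q0 (powR_tangent y0 t0).
apply: le_trans (lerD H1 H2).
have E : p * (x - t) + (1 - p) * (y - t) = 0 by rewrite /t; ring.
rewrite [leRHS](_ : _ = t `^ d + d * t `^ (d - 1) *
  (p * (x - t) + (1 - p) * (y - t))); last by ring.
by rewrite E mulr0 addr0.
Qed.

Lemma powR_invE x : 0 < x -> x^-1 `^ d = (x `^ d)^-1.
Proof.
move=> x0; have xn : x != 0 by rewrite gt_eqF.
have xd : x `^ d != 0 by rewrite gt_eqF ?powR_gt0.
apply: (mulfI xd); rewrite mulfV// -powRM ?invr_ge0 ?ltW// mulfV// powR1//.
Qed.

(** Convexity applied to x/a and y/b with the weights a/(a+b) and b/(a+b). Bounds [a] and [b] take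
    the place of the norms, so that estimates can be chained; when one of them is 0, that family
    vanishes on [r]. *)
Lemma minkowski_sum (I : eqType) (r : seq I) (x y : I -> R) (a b : R) :
  (forall i, 0 <= x i) -> (forall i, 0 <= y i) -> 0 <= a -> 0 <= b ->
  \sum_(i <- r) x i `^ d <= a `^ d -> \sum_(i <- r) y i `^ d <= b `^ d ->
  \sum_(i <- r) (x i + y i) `^ d <= (a + b) `^ d.
Proof.
move=> x0 y0 a0 b0 Hx Hy.
have zero (z : I -> R) : (forall i, 0 <= z i) -> \sum_(i <- r) z i `^ d <= 0 `^ d ->
    forall i, i \in r -> z i = 0.
  move=> z0; rewrite powR0// => Hz i ir; apply/eqP.
  suff : z i `^ d == 0 by rewrite powR_eq0 => /andP[].
  rewrite eq_le powR_ge0 andbT; apply: le_trans Hz.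
  elim: r ir {Hx Hy} => // j r' IH; rewrite inE big_cons => /predU1P[->|/IH H].
    by rewrite lerDl sumr_ge0// => k _; exact: powR_ge0.
  by rewrite (le_trans H)// lerDr powR_ge0.
have [aE|an] := eqVneq a 0.
  rewrite aE in Hx *; rewrite add0r; apply: le_trans Hy.
  rewrite le_eqVlt; apply/orP; left; apply/eqP/eq_big_seq => i ir.
  by rewrite (zero x x0 Hx)// add0r.
have [bE|bn] := eqVneq b 0.
  rewrite bE in Hy *; rewrite addr0; apply: le_trans Hx.
  rewrite le_eqVlt; apply/orP; left; apply/eqP/eq_big_seq => i ir.
  by rewrite (zero y y0 Hy)// addr0.
have ap : 0 < a by rewrite lt_def an.
have bp : 0 < b by rewrite lt_def bn.
have abp : 0 < a + b by rewrite addr_gt0.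
have abn : a + b != 0 by rewrite gt_eqF.
set p := a / (a + b).
have pI : 0 <= p <= 1.
  by rewrite /p divr_ge0 ?(ltW ap) ?(ltW abp)//= ler_pdivrMr// mul1r lerDl ltW.
have qE : 1 - p = b / (a + b) by rewrite /p; field; rewrite abn.
have key i : (x i + y i) `^ d <= (a + b) `^ d *
   (p * (x i `^ d / a `^ d) + (1 - p) * (y i `^ d / b `^ d)).
  have H : x i + y i = (a + b) * (p * (x i / a) + (1 - p) * (y i / b)).
    by rewrite qE /p; field; rewrite abn an bn.
  have xa : 0 <= x i / a by rewrite divr_ge0// ltW.
  have yb : 0 <= y i / b by rewrite divr_ge0// ltW.
  have /andP[p0 p1] := pI.
  rewrite H powRM ?(ltW abp)//; last by rewrite addr_ge0// mulr_ge0// subr_ge0.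
  rewrite ler_wpM2l ?powR_ge0//.
  have -> : x i `^ d / a `^ d = (x i / a) `^ d.
    by rewrite powRM ?invr_ge0// powR_invE.
  have -> : y i `^ d / b `^ d = (y i / b) `^ d.
    by rewrite powRM ?invr_ge0// powR_invE.
  exact: powR_convex.
apply: (@le_trans _ _ (\sum_(i <- r) (a + b) `^ d *
   (p * (x i `^ d / a `^ d) + (1 - p) * (y i `^ d / b `^ d)))).
  by apply: ler_sum => i _; exact: key.
rewrite -mulr_sumr -[leRHS]mulr1 ler_wpM2l ?powR_ge0//.
rewrite big_split/= -!mulr_sumr -!mulr_suml.
rewrite [leRHS](_ : _ = p + (1 - p)); last by ring.
have /andP[p0 p1] := pI.
by apply: lerD; rewrite -[leRHS]mulr1 ler_wpM2l ?subr_ge0// ler_pdivrMr ?powR_gt0// mul1r.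
Qed.

Lemma sum_CS (I : Type) (r : seq I) (x y : I -> R) :
  (\sum_(i <- r) x i * y i) ^+ 2 <= (\sum_(i <- r) x i ^+ 2) * \sum_(i <- r) y i ^+ 2.
Proof.
apply: discriminant_le; first by apply: sumr_ge0 => i _; exact: sqr_ge0.
move=> l; have -> : \sum_(i <- r) x i ^+ 2 - 2 * l * \sum_(i <- r) x i * y i +
    l ^+ 2 * \sum_(i <- r) y i ^+ 2 = \sum_(i <- r) (x i - l * y i) ^+ 2.
  rewrite !mulr_sumr -sumrB -big_split/=; apply: eq_bigr => i _; ring.
by apply: sumr_ge0 => i _; exact: sqr_ge0.
Qed.

(** Interpolation between l^1 and the sup norm: q^d <= (hB)^(d-1) q. The factor h^(1-1/d) is the
    gain behind the halving argument; for h < 1 it is below 1 because d > 1. *)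
Lemma sum_powR_interp (I : Type) (r : seq I) (q : I -> R) (h B : R) :
  (forall i, 0 <= q i) -> 0 <= h -> 0 <= B ->
  (forall i, q i <= h * B) -> \sum_(i <- r) q i <= B ->
  \sum_(i <- r) q i `^ d <= (h `^ (1 - d^-1) * B) `^ d.
Proof.
move=> q0 h0 B0 qh qB.
have E z : 0 <= z -> z `^ d = z `^ (d - 1) * z.
  move=> z0; have [->|zn] := eqVneq z 0; first by rewrite mulr0 powR0.
  by rewrite -{3}[z]powRr1// -powRD ?zn ?implybT// subrK.
rewrite powRM ?powR_ge0// -powRrM (_ : (1 - d^-1) * d = d - 1); last by field.
apply: (@le_trans _ _ (\sum_(i <- r) (h * B) `^ (d - 1) * q i)).
  apply: ler_sum => i _; rewrite E// ler_wpM2r//.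
  by rewrite ge0_ler_powR ?nnegrE ?mulr_ge0 ?subr_ge0// ltW.
rewrite -mulr_sumr powRM// -mulrA ler_wpM2l ?powR_ge0// (E B)//.
by rewrite ler_wpM2l ?powR_ge0.
Qed.

End PowerSums.

(** * Halving of triangles *)

Section Triangle.
Context {R : realType}.
Notation C := R[i].
Notation Re := (@complex.Re R).
Notation Im := (@complex.Im R).
Notation nrm := (@Normc.normc R).
Variables (d : R) (d1 : 1 < d).
Implicit Types (s t x : R) (a b : int -> R -> C).

Let d0 : 0 < d. Proof. exact: lt_trans ltr01 d1. Qed.
Let dn0 : d != 0. Proof. by rewrite gt_eqF. Qed.

(** This is what the halving argument uses of the oscillating functions: an envelope independent of
    [n], and Bessel's inequality on every subinterval. *)
Definition bessel_family a (al : R -> R) : Prop :=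
  [/\ rL2 al, forall x, 0 <= al x, forall n, cL2 (a n),
      forall n x, nrm (a n x) <= al x &
      forall s t r, 0 <= s -> t <= 1 -> uniq r ->
        \sum_(n <- r) nrm (cint s t (a n)) ^+ 2 <= rint s t (fun x => al x ^+ 2)].

(** The double integral of [f y * g x] over s <= x <= y <= t. Writing the inner integral as a
    difference of primitives from 0 makes the results on [AC] applicable. *)
Definition tri (f g : R -> C) s t : C :=
  cint s t (fun y => f y * (cint 0 y g - cint 0 s g)).

Lemma AC_primitive_sub (g : R -> C) (c : C) : cL1 g -> AC (fun y => cint 0 y g - c) g.
Proof.
move=> gi; apply: AC_eq (AC_B (AC_primitive gi) (AC_cst c)) => // x _.
by rewrite subr0.
Qed.

(** The triangle over [s, t] consists of those over [s, m] and [m, t] and of a rectangle, on which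
    the double integral factors. *)
Lemma tri_split (f g : R -> C) s m t : cL1 f -> cL1 g ->
  0 <= s -> s <= m -> m <= t -> t <= 1 ->
  tri f g s t = tri f g s m + tri f g m t + cint m t f * cint s m g.
Proof.
move=> fi gi s0 sm mt t1; have m0 := le_trans s0 sm; have m1 := le_trans mt t1.
have i1 c : cL1 (fun y => f y * (cint 0 y g - c)).
  exact: cL1_mulAC fi (AC_primitive_sub c gi).
rewrite /tri (cint_split (i1 _) s0 t1 sm mt) -addrA; congr (_ + _).
rewrite [in RHS]mulrC -cintZ// -cintD//; last exact: cL1Z.
apply: eq_cint => y /andP[my yt].
rewrite (cint_split (s := 0) (t := m) (m := s) gi)//; ring.
Qed.

(** The trivial bound, blind to oscillation: two Cauchy-Schwarz inequalities, each with a factor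
    sqrt(t - s). It starts the recursion in [tri_pow]. *)
Lemma nrm_tri_le (f g : R -> C) (al be : R -> R) s t : cL1 f -> cL1 g -> rL2 al -> rL2 be ->
  (forall x, nrm (f x) <= al x) -> (forall x, nrm (g x) <= be x) ->
  0 <= s -> s <= t -> t <= 1 ->
  nrm (tri f g s t) <= (t - s) * (norm2 s t al * norm2 s t be).
Proof.
move=> fi gi al2 be2 fal gbe s0 st t1; have t0 := le_trans s0 st.
have al0 x : 0 <= al x := le_trans (nrm_ge0 _) (fal x).
have be0 x : 0 <= be x := le_trans (nrm_ge0 _) (gbe x).
have ali := rL2_L1 al2; have bei := rL2_L1 be2.
apply: (@le_trans _ _ (rint s t (fun y => rint s t be * al y))).
  apply: cint_le => //; [exact: cL1_mulAC fi (AC_primitive_sub _ gi)|exact: rL1Z|].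
  move=> y /andP[sy yt]; rewrite nrmM mulrC ler_pM ?nrm_ge0//.
  have y1 := le_trans yt t1; have y0 := le_trans s0 sy.
  rewrite (cint_split (s := 0) (t := y) (m := s) gi)// addrC addKr.
  apply: (@le_trans _ _ (rint s y be)); first by apply: cint_le.
  by apply: rint_subset => // x _; exact: be0.
rewrite rintZ//.
have H1 := rint_L1_norm2 al2 s0 st t1; have H2 := rint_L1_norm2 be2 s0 st t1.
have a0 : 0 <= rint s t al by apply: rint_ge0.
have b0 : 0 <= rint s t be by apply: rint_ge0.
apply: le_trans (ler_pM b0 a0 H2 H1) _.
set q := Num.sqrt _; have qq : q * q = t - s.
  by rewrite -expr2 sqr_sqrtr// subr_ge0.
by rewrite -qq le_eqVlt; apply/orP; left; apply/eqP; ring.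
Qed.

Let sg := 1 - d^-1.
Let ka : R := 2^-1 `^ sg.

Let sg_gt0 : 0 < sg. Proof. by rewrite /sg subr_gt0 invf_lt1. Qed.

Let sg_le1 : sg <= 1. Proof. by rewrite /sg gerBl invr_ge0 ltW. Qed.

Let ka_ge0 : 0 <= ka. Proof. exact: powR_ge0. Qed.

Let ka_lt1 : ka < 1.
Proof.
have E : 1 `^ sg = 1 :> R by rewrite powR1.
by rewrite /ka -[ltRHS]E gt0_ltr_powR// ?nnegrE ?invr_ge0// invf_lt1 ?ltr1n.
Qed.

(** One halving multiplies by [ka] = 2^(-(1-1/d)); the added 1 is the share of the rectangle. *)
Fixpoint tri_cst (N : R) (k : nat) : R :=
  if k is k'.+1 then ka * (tri_cst N k' + 1) else N.

Lemma tri_cst_ge0 N k : 0 <= N -> 0 <= tri_cst N k.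
Proof. by move=> N0; elim: k => //= k IH; rewrite mulr_ge0 ?addr_ge0. Qed.

(* The trivial bound, which depends on the number of terms of the sum, enters
   weighted by [ka ^+ k] after [k] halvings: the dependence vanishes in the limit. *)
Lemma tri_pow a b al be (r : seq int) : bessel_family a al -> bessel_family b be ->
  uniq r -> forall k s t, 0 <= s -> s <= t -> t <= 1 ->
  \sum_(n <- r) nrm (tri (a n) (b n) s t) `^ d <=
  (tri_cst (size r)%:R k * (t - s) `^ sg * (norm2 s t al * norm2 s t be)) `^ d.
Proof.
move=> [al2 al0 aL aal aB] [be2 be0 bL bbe bB] ru.
have aL1 n := cL2_L1 (aL n); have bL1 n := cL2_L1 (bL n).
elim=> [|k IH] s t s0 st t1.
  rewrite /=; have [r0|r0] := posnP (size r).
    by rewrite (size0nil r0) big_nil powR_ge0.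
  set X := norm2 s t al * norm2 s t be.
  have X0 : 0 <= X by rewrite mulr_ge0 ?norm2_ge0.
  have ts0 : 0 <= t - s by rewrite subr_ge0.
  apply: (@le_trans _ _ (\sum_(n <- r) ((t - s) `^ sg * X) `^ d)).
    apply: ler_sum => n _; rewrite ge0_ler_powR ?(ltW d0) ?nnegrE ?nrm_ge0//.
      by rewrite mulr_ge0 ?powR_ge0.
    apply: le_trans (nrm_tri_le (aL1 n) (bL1 n) al2 be2 (aal n) (bbe n) s0 st t1) _.
    rewrite ler_wpM2r//.
    have [->|tsn] := eqVneq (t - s) 0; first exact: powR_ge0.
    rewrite -{1}[t - s]powRr1// ger_powR//.
    by rewrite lt_def tsn ts0/= lerBlDr (le_trans t1)// lerDl.
  rewrite big_const_seq count_predT iter_addr_0 -[leLHS]mulr_natl -mulrA.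
  rewrite [leRHS]powRM ?ler0n ?(mulr_ge0 (powR_ge0 _ _) X0)// ler_wpM2r ?powR_ge0//.
  rewrite -{1}[(size r)%:R]powRr1// ler_powR ?(ltW d1)//.
  by rewrite ler1n.
set m := (s + t) / 2.
have sm : s <= m by rewrite /m; lra.
have mt : m <= t by rewrite /m; lra.
have m0 : 0 <= m := le_trans s0 sm.
have m1 : m <= 1 := le_trans mt t1.
set X1 := norm2 s m al; set X2 := norm2 m t al; set X := norm2 s t al.
set Y1 := norm2 s m be; set Y2 := norm2 m t be; set Y := norm2 s t be.
have XX : X ^+ 2 = X1 ^+ 2 + X2 ^+ 2.
  by rewrite !norm2_sqr; apply: rint_split => //; case: al2.
have YY : Y ^+ 2 = Y1 ^+ 2 + Y2 ^+ 2.
  by rewrite !norm2_sqr; apply: rint_split => //; case: be2.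
have X10 : 0 <= X1 := norm2_ge0 _ _ _.
have X20 : 0 <= X2 := norm2_ge0 _ _ _.
have X0 : 0 <= X := norm2_ge0 _ _ _.
have Y10 : 0 <= Y1 := norm2_ge0 _ _ _.
have Y20 : 0 <= Y2 := norm2_ge0 _ _ _.
have Y0 : 0 <= Y := norm2_ge0 _ _ _.
have X2X : X2 <= X by rewrite -ler_sqr ?nnegrE// XX lerDr sqr_ge0.
have Y1Y : Y1 <= Y by rewrite -ler_sqr ?nnegrE// YY lerDl sqr_ge0.
(* Cauchy-Schwarz in the plane: the norms over the two halves together cost no more than those over
   the whole, so that the smaller size of the triangles is a genuine gain. *)
have XY : X1 * Y1 + X2 * Y2 <= X * Y.
  have XY0 := addr_ge0 (mulr_ge0 X10 Y10) (mulr_ge0 X20 Y20).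
  rewrite -ler_sqr ?nnegrE ?XY0 ?(mulr_ge0 X0 Y0)// exprMn XX YY.
  have := sqr_ge0 (X1 * Y2 - X2 * Y1); nra.
set h := (t - s) / 2.
have h0 : 0 <= h by rewrite /h; lra.
have hE1 : m - s = h by rewrite /m /h; field.
have hE2 : t - m = h by rewrite /m /h; field.
set c := tri_cst (size r)%:R k.
have c0 : 0 <= c by exact: tri_cst_ge0.
have hs0 : 0 <= h `^ sg := powR_ge0 _ _.
have S1 := IH s m s0 sm m1; have S2 := IH m t m0 mt t1.
rewrite -/c -/X1 -/Y1 hE1 in S1; rewrite -/c -/X2 -/Y2 hE2 in S2.
pose q n := nrm (cint m t (a n)) * nrm (cint s m (b n)).
have q0 n : 0 <= q n by rewrite mulr_ge0 ?nrm_ge0.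
(* The rectangle: each [q n] is at most h X2 Y1 by Cauchy-Schwarz in x, and the [q n] sum to at most
   X2 Y1 by Bessel's inequality; interpolation between the two yields h^(1-1/d). *)
have SQ : \sum_(n <- r) q n `^ d <= (h `^ sg * (X2 * Y1)) `^ d.
  apply: (sum_powR_interp d1 q0 h0 (mulr_ge0 X20 Y10)).
    move=> n.
    have H1 : nrm (cint m t (a n)) <= Num.sqrt h * X2.
      rewrite -hE2; apply: le_trans (rint_L1_norm2 al2 m0 mt t1).
      by apply: cint_le => //; exact: rL2_L1.
    have H2 : nrm (cint s m (b n)) <= Num.sqrt h * Y1.
      rewrite -hE1; apply: le_trans (rint_L1_norm2 be2 s0 sm m1).
      by apply: cint_le => //; exact: rL2_L1.
    apply: le_trans (ler_pM (nrm_ge0 _) (nrm_ge0 _) H1 H2) _.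
    rewrite mulrACA -expr2 sqr_sqrtr//.
  have P0 : 0 <= \sum_(n <- r) q n by apply: sumr_ge0.
  rewrite -ler_sqr ?nnegrE ?P0 ?(mulr_ge0 X20 Y10)//.
  apply: le_trans (sum_CS _ _ _) _.
  rewrite exprMn !norm2_sqr ler_pM ?sumr_ge0//.
  - by move=> n _; exact: sqr_ge0.
  - by move=> n _; exact: sqr_ge0.
  - exact: aB.
  - exact: bB.
have T1 := minkowski_sum d1 (fun n => nrm_ge0 _) (fun n => nrm_ge0 _)
  (mulr_ge0 (mulr_ge0 c0 hs0) (mulr_ge0 X10 Y10))
  (mulr_ge0 (mulr_ge0 c0 hs0) (mulr_ge0 X20 Y20)) S1 S2.
have T2 := minkowski_sum d1 (fun n => addr_ge0 (nrm_ge0 _) (nrm_ge0 _)) q0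
  (addr_ge0 (mulr_ge0 (mulr_ge0 c0 hs0) (mulr_ge0 X10 Y10))
    (mulr_ge0 (mulr_ge0 c0 hs0) (mulr_ge0 X20 Y20)))
  (mulr_ge0 hs0 (mulr_ge0 X20 Y10)) T1 SQ.
apply: (@le_trans _ _ (\sum_(n <- r) (nrm (tri (a n) (b n) s m) +
   nrm (tri (a n) (b n) m t) + q n) `^ d)).
  apply: ler_sum => n _; rewrite ge0_ler_powR ?(ltW d0) ?nnegrE ?nrm_ge0 ?(addr_ge0 (addr_ge0 (nrm_ge0 _) (nrm_ge0 _)) (q0 n))//.
  rewrite (tri_split (aL1 n) (bL1 n) s0 sm mt t1).
  apply: le_trans (nrmD _ _) _; rewrite nrmM lerD2r.
  exact: nrmD.
apply: le_trans T2 _.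
rewrite ge0_ler_powR ?(ltW d0) ?nnegrE//=.
- exact: (addr_ge0 (addr_ge0 (mulr_ge0 (mulr_ge0 c0 hs0) (mulr_ge0 X10 Y10))
    (mulr_ge0 (mulr_ge0 c0 hs0) (mulr_ge0 X20 Y20)))
    (mulr_ge0 hs0 (mulr_ge0 X20 Y10))).
- apply: mulr_ge0 (mulr_ge0 X0 Y0); apply: mulr_ge0 (powR_ge0 _ _).
  exact: mulr_ge0 ka_ge0 (addr_ge0 c0 ler01).
have kE : ka * (t - s) `^ sg = h `^ sg.
  by rewrite /ka /h mulrC powRM ?invr_ge0// subr_ge0.
rewrite [leRHS](_ : _ = h `^ sg * ((c + 1) * (X * Y))); last by rewrite -/c -kE; ring.
rewrite [leLHS](_ : _ = h `^ sg * (c * (X1 * Y1 + X2 * Y2) + X2 * Y1)); last by ring.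
rewrite ler_wpM2l// [(c + 1) * _]mulrDl mul1r lerD//; first by rewrite ler_wpM2l.
exact: (ler_pM X20 Y10 X2X Y1Y).
Qed.

(** The recursion converges to its fixed point [ka / (1 - ka)]; after enough halvings the trace of
    [N] is below 1, whence the bound 1 + ka / (1 - ka). *)
Lemma tri_cst_bounded (N : R) : 0 <= N ->
  exists k, tri_cst N k <= (1 - ka)^-1.
Proof.
move=> N0; have k1 : 0 < 1 - ka by rewrite subr_gt0.
have H k : tri_cst N k <= ka ^+ k * N + ka / (1 - ka).
  elim: k => [|k IH] /=; first by rewrite mul1r lerDl divr_ge0// ltW.
  apply: le_trans (ler_wpM2l ka_ge0 (lerD IH (lexx 1))) _.
  rewrite le_eqVlt; apply/orP; left; apply/eqP; rewrite exprS; field.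
  by rewrite gt_eqF.
have /cvgrPdist_lt/(_ 1 ltr01) : (fun k => ka ^+ k * N) @ \oo --> (0 : R).
  rewrite -[X in _ --> X](mul0r N); apply: cvgM; last exact: cvg_cst.
  by apply: cvg_expr; rewrite ger0_norm.
move=> [k _ /(_ k (leqnn k))/=]; rewrite sub0r normrN => Hk.
exists k; apply: le_trans (H k) _.
rewrite [leRHS](_ : _ = 1 + ka / (1 - ka)); last by field; rewrite gt_eqF.
by rewrite lerD2r (le_trans (ler_norm _) (ltW Hk)).
Qed.

Definition tri_const : R := (1 - ka)^-1.

Lemma tri_const_ge0 : 0 <= tri_const.
Proof. by rewrite invr_ge0 subr_ge0 ltW. Qed.

(** The number of halvings is chosen according to the size of [r], so the resulting constant does
    not depend on [r]. *)
Lemma tri_sum a b al be (r : seq int) x : bessel_family a al -> bessel_family b be ->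
  uniq r -> 0 <= x <= 1 ->
  \sum_(n <- r) nrm (cint 0 x (fun y => a n y * cint 0 y (b n))) `^ d <=
  (tri_const * (norm2 0 1 al * norm2 0 1 be)) `^ d.
Proof.
move=> Fa Fb ru /andP[x0 x1]; have l0 : (0 : R) <= 0 by [].
have [k Hk] := tri_cst_bounded (ler0n R (size r)).
have TE n : tri (a n) (b n) 0 x = cint 0 x (fun y => a n y * cint 0 y (b n)).
  by apply: eq_cint => y _; rewrite cint_eq subr0.
apply: (@le_trans _ _ (\sum_(n <- r) nrm (tri (a n) (b n) 0 x) `^ d)).
  by apply: ler_sum => n _; rewrite -TE.
apply: le_trans (tri_pow Fa Fb ru k l0 x0 x1) _; rewrite subr0.
have n2 f : rL2 f -> norm2 0 x f <= norm2 0 1 f.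
  move=> [_ fi]; rewrite -ler_sqr ?nnegrE ?norm2_ge0// !norm2_sqr.
  by apply: rint_subset => // y _; exact: sqr_ge0.
have c0 := tri_cst_ge0 k (ler0n R (size r)).
have [a2 _ _ _ _] := Fa; have [b2 _ _ _ _] := Fb.
rewrite ge0_ler_powR ?(ltW d0) ?nnegrE//.
- by rewrite !mulr_ge0 ?norm2_ge0 ?powR_ge0.
- by rewrite !mulr_ge0 ?norm2_ge0 ?tri_const_ge0.
rewrite ler_pM ?mulr_ge0 ?norm2_ge0 ?powR_ge0//; last first.
  by rewrite ler_pM ?norm2_ge0// n2.
rewrite -[leRHS]mulr1 ler_pM ?powR_ge0//.
have E : 1 `^ sg = 1 :> R by rewrite powR1.
by rewrite -[leRHS]E ge0_ler_powR ?nnegrE// ltW.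
Qed.

(** Jensen's inequality for the measure of density [m] and arbitrary mass: [powR_tangent] at the
    mean value [t] of [S], integrated against [m]. *)
Lemma jensen_powR (m S : R -> R) (M : R) : rL1 m -> (forall x, 0 <= m x) ->
  rmeas S -> (forall x, 0 <= S x) -> (forall x, 0 <= x <= 1 -> S x <= M) ->
  rL1 (fun x => m x * S x `^ d) /\ rint 0 1 (fun x => m x * S x) `^ d <=
    rint 0 1 m `^ (d - 1) * rint 0 1 (fun x => m x * S x `^ d).
Proof.
move=> mi m0 mS S0 SM.
have i1 : rL1 (fun x => m x * S x).
  by apply: (rL1_mul_bounded (M := M) mi mS) => x xI; rewrite ger0_norm ?SM.
have i2 : rL1 (fun x => m x * S x `^ d).
  apply: (rL1_mul_bounded (M := M `^ d) mi).
    by apply: (measurableT_comp (f := fun y : R => y `^ d)) => //; exact: measurable_powR.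
  move=> x xI; rewrite ger0_norm ?powR_ge0// ge0_ler_powR ?(ltW d0) ?nnegrE ?SM//.
  exact: le_trans (S0 x) (SM x xI).
split=> //; set I := rint 0 1 m; set Q := rint 0 1 (fun x => m x * S x).
have l0 : (0 : R) <= 0 by []. have l1 : (1 : R) <= 1 by [].
have I0 : 0 <= I by apply: rint_ge0.
have Q0 : 0 <= Q by apply: rint_ge0 => x _; rewrite mulr_ge0.
have D0 : 0 <= rint 0 1 (fun x => m x * S x `^ d).
  by apply: rint_ge0 => x _; rewrite mulr_ge0 ?powR_ge0.
have QM : Q <= M * I.
  rewrite -rintZ//; apply: rint_le => //; first exact: rL1Z.
  by move=> x xI; rewrite mulrC ler_wpM2r ?SM.
have [IE|IN] := eqVneq I 0.
  have -> : Q = 0 by apply/eqP; rewrite eq_le Q0 andbT -(mulr0 M) -IE.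
  by rewrite powR0// mulr_ge0 ?powR_ge0.
set t := Q / I; have t0 : 0 <= t by rewrite divr_ge0.
have QE : Q = t * I by rewrite /t divfK.
have key : t `^ d * I <= rint 0 1 (fun x => m x * S x `^ d).
  have -> : t `^ d * I = rint 0 1 (fun x => (t `^ d - d * t `^ (d - 1) * t) * m x +
      d * t `^ (d - 1) * (m x * S x)).
    rewrite rintD// ?rintZ//; try exact: rL1Z.
    by rewrite -/I -/Q QE; ring.
  apply: rint_le => //; first by apply: rL1D; exact: rL1Z.
  move=> x _; have := ler_wpM2l (m0 x) (powR_tangent d1 (S0 x) t0).
  by apply: le_trans; rewrite le_eqVlt; apply/orP; left; apply/eqP; ring.
have -> : Q `^ d = I `^ (d - 1) * (t `^ d * I).
  rewrite QE powRM//.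
  rewrite mulrCA; congr (_ * _).
  by rewrite -{3}[I]powRr1// -powRD ?IN ?implybT// subrK.
by rewrite ler_wpM2l ?powR_ge0.
Qed.

(** Transfers an l^d bound that is uniform in the upper limit x to weighted means over x; it is made
    for [second_mean]. *)
Lemma jensen_sum (m : R -> R) (S : int -> R -> R) (r : seq int) (M K : R) :
  rL1 m -> (forall x, 0 <= m x) -> (forall n, rmeas (S n)) ->
  (forall n x, 0 <= S n x) -> (forall n x, 0 <= x <= 1 -> S n x <= M) ->
  (forall x, 0 <= x <= 1 -> \sum_(n <- r) S n x `^ d <= K `^ d) -> 0 <= K ->
  \sum_(n <- r) rint 0 1 (fun x => m x * S n x) `^ d <= (rint 0 1 m * K) `^ d.
Proof.
move=> mi m0 mS S0 SM SK K0.
have l0 : (0 : R) <= 0 by []. have l1 : (1 : R) <= 1 by [].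
have J n := jensen_powR mi m0 (mS n) (S0 n) (SM n).
have I0 : 0 <= rint 0 1 m by apply: rint_ge0.
apply: (@le_trans _ _ (rint 0 1 m `^ (d - 1) *
   \sum_(n <- r) rint 0 1 (fun x => m x * S n x `^ d))).
  by rewrite mulr_sumr; apply: ler_sum => n _; exact: (J n).2.
have [j1 <-] := rint_sum r (fun n => (J n).1) l0 l1.
apply: (@le_trans _ _ (rint 0 1 m `^ (d - 1) * rint 0 1 (fun x => K `^ d * m x))).
  rewrite ler_wpM2l ?powR_ge0//; apply: rint_le => //; first exact: rL1Z.
  by move=> x xI; rewrite -mulr_sumr mulrC ler_wpM2r ?SK.
rewrite rintZ// powRM// [leRHS]mulrC mulrCA ler_wpM2l ?powR_ge0//.
have [->|IN] := eqVneq (rint 0 1 m) 0; first by rewrite mulr0 powR_ge0.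
by rewrite -{2}[rint 0 1 m]powRr1// -powRD ?IN ?implybT// subrK.
Qed.

End Triangle.

(** * The ZS-AKNS system *)

Section Gronwall.
Context {R : realType}.
Implicit Types (x : R).

(** Iterating X -> c + eta X from the a priori bound [M] converges to c / (1 - eta), which no longer
    involves [M]. The general index type allows two functions to be treated at once, labelled by a
    Boolean. *)
Lemma self_bound (T : Type) (P : T -> Prop) (f : T -> R) (c eta M : R) :
  0 <= eta < 1 -> (forall t, P t -> f t <= M) ->
  (forall X, (forall t, P t -> f t <= X) -> forall t, P t -> f t <= c + eta * X) ->
  forall t, P t -> f t <= c / (1 - eta).
Proof.
move=> /andP[e0 e1] fM H; have e1' : 1 - eta != 0 by rewrite subr_eq0 gt_eqF.
pose X n := c / (1 - eta) + eta ^+ n * (M - c / (1 - eta)).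
have HX n t : P t -> f t <= X n.
  elim: n t => [|n IH] t Pt; first by rewrite /X expr0 mul1r addrC subrK fM.
  rewrite (_ : X n.+1 = c + eta * X n); first exact: H.
  by rewrite /X exprS; field.
move=> t Pt; have cX : X n @[n --> \oo] --> c / (1 - eta).
  rewrite -[Y in _ --> Y]addr0; apply: cvgD; first exact: cvg_cst.
  rewrite -[Y in _ --> Y](mul0r (M - c / (1 - eta))).
  by apply: cvgM; [apply: cvg_expr; rewrite ger0_norm|exact: cvg_cst].
have <- := cvg_lim (@Rhausdorff R) cX.
apply: limr_ge; first by apply/cvg_ex; exists (c / (1 - eta)).
by apply: nearW => n; exact: HX.
Qed.

Lemma rint_expR_le (k x : R) : 0 < k -> 0 <= x <= 1 ->
  rL1 (fun y : R => expR (k * y)) /\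
  rint 0 x (fun y => expR (k * y)) <= expR (k * x) / k.
Proof.
move=> k0 xI; have /andP[x0 x1] := xI.
have := AC_cexp (k%:C : R[i]).
have E y : cexp (k%:C * y%:C) = (expR (k * y))%:C.
  have -> : k%:C * y%:C = (k * y)%:C :> R[i] by apply: complex_ext; rewrite /=; ring.
  by rewrite /cexp/= cos0 sin0; apply: complex_ext; rewrite /=; ring.
move=> /(AC_eq (G := fun y => (expR (k * y))%:C) (g := fun y => (k * expR (k * y))%:C)).
case=> [y _|y _|fi /(_ x xI)]; first exact: E.
  by rewrite E; apply: complex_ext; rewrite /=; ring.
move=> /(congr1 (@complex.Re R)); rewrite /= mulr0 expR0 => H.
have ei : rL1 (fun y => expR (k * y)).
  apply: rL1_eq (rL1Z k^-1 fi.1) => y _ /=; rewrite mulKf// gt_eqF//.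
split=> //; rewrite ler_pdivlMr// mulrC -rintZ// H.
by rewrite lerDr ler01.
Qed.

(* Bielecki's weight [expR (k x)] turns the integral operator into a
   contraction by 1/2, using only Cauchy-Schwarz for the L2 kernel. *)
Lemma gronwall (m : R -> R) (L Q M : R) (r1 r2 : R -> R) :
  rL2 m -> (forall x, 0 <= m x) -> 0 < L -> rint 0 1 (fun x => m x ^+ 2) <= L ->
  rmeas r1 -> rmeas r2 -> (forall x, 0 <= r1 x) -> (forall x, 0 <= r2 x) ->
  (forall x, 0 <= x <= 1 -> r1 x <= M) -> (forall x, 0 <= x <= 1 -> r2 x <= M) ->
  (forall x, 0 <= x <= 1 -> r1 x <= Q + rint 0 x (fun y => m y * r2 y)) ->
  (forall x, 0 <= x <= 1 -> r2 x <= Q + rint 0 x (fun y => m y * r1 y)) ->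
  0 <= Q ->
  forall x, 0 <= x <= 1 -> r1 x <= 2 * expR (2 * L) * Q /\ r2 x <= 2 * expR (2 * L) * Q.
Proof.
move=> m2 m0 L0 mL mr1 mr2 r10 r20 r1M r2M H1 H2 Q0.
(* With this k, Cauchy-Schwarz bounds the square of the integral of [m y * expR (k * y)] by L
   e^{2kx} / (2k) = (e^{kx} / 2)^2. *)
pose k := 2 * L; have k0 : 0 < k by rewrite mulr_gt0.
pose r (i : bool) := if i then r1 else r2.
have r0 i x : 0 <= r i x by case: i => /=.
have mr i : rmeas (r i) by case: i.
have rM i x : 0 <= x <= 1 -> r i x <= M by case: i => /=; [exact: r1M|exact: r2M].
have Hr i x : 0 <= x <= 1 -> r i x <= Q + rint 0 x (fun y => m y * r (~~ i) y).
  by case: i => /=; [exact: H1|exact: H2].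
have key : forall t : bool * R, 0 <= t.2 <= 1 ->
    r t.1 t.2 * expR (- (k * t.2)) <= Q / (1 - 2^-1).
  apply: (@self_bound _ (fun t : bool * R => 0 <= t.2 <= 1) _ _ _ M).
  - by rewrite invr_ge0 ler0n invf_lt1// ltr1n.
  - move=> [i x]/= xI; have /andP[x0 _] := xI.
    rewrite -[leRHS]mulr1 ler_pM ?expR_ge0 ?rM//.
    by rewrite -expR0 ler_expR oppr_le0 mulr_ge0// ltW.
  move=> X HX [i x]/= xI; have /andP[x0 x1] := xI.
  have E0 y : 0 < expR (k * y) :> R by exact: expR_gt0.
  have X0 : 0 <= X.
    by apply: le_trans (HX (true, x) xI); rewrite mulr_ge0 ?expR_ge0.
  have HX' j y : 0 <= y <= 1 -> r j y <= X * expR (k * y).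
    by move=> yI; rewrite -ler_pdivrMr// -expRN; exact: (HX (j, y)).
  rewrite expRN ler_pdivrMr//.
  apply: le_trans (Hr i x xI) _.
  have E2 : rL2 (fun y => expR (k * y)).
    split; last first.
      have [ei _] := rint_expR_le (mulr_gt0 (@ltr0n R 2) k0) xI.
      by apply: rL1_eq ei => y _; rewrite -expRM_natl -mulrA.
    by apply: rL1_meas; have [] := rint_expR_le k0 xI.
  apply: (@le_trans _ _ (Q + X * rint 0 x (fun y => m y * expR (k * y)))).
    rewrite lerD2l -rintZ//; last exact: rL2_mul.
    have mi := rL2_L1 m2.
    apply: rint_le => //.
    - by apply: (rL1_mul_bounded (M := M) mi) => // y yI; rewrite ger0_norm ?rM.
    - exact/rL1Z/rL2_mul.
    - move=> y /andP[y0 yx]; rewrite mulrCA ler_wpM2l// HX'// y0.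
      exact: le_trans x1.
  rewrite mulrDl lerD//.
    by rewrite -[leLHS]mulr1 ler_wpM2l// -expR0 ler_expR mulr_ge0// ltW.
  rewrite -mulrA mulrCA ler_wpM2l//.
  have I0 : 0 <= rint 0 x (fun y => m y * expR (k * y)).
    by apply: rint_ge0 => y _; rewrite mulr_ge0 ?expR_ge0.
  rewrite -ler_sqr ?nnegrE ?mulr_ge0 ?invr_ge0 ?expR_ge0//.
  apply: le_trans (rint_CS m2 E2 _ x1) _ => //.
  have mx : rint 0 x (fun y => m y ^+ 2) <= L.
    apply: le_trans mL; apply: rint_subset => //; first by case: m2.
    by move=> y _; exact: sqr_ge0.
  have ex : rint 0 x (fun y => expR (k * y) ^+ 2) <= expR (k * x) ^+ 2 / (2 * k).
    have [_] := rint_expR_le (mulr_gt0 (@ltr0n R 2) k0) xI.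
    rewrite -expRM_natl mulrA; apply: le_trans.
    rewrite le_eqVlt; apply/orP; left; apply/eqP/eq_rint => y _.
    by rewrite -expRM_natl mulrA.
  apply: le_trans (ler_pM _ _ mx ex) _.
  - by apply: rint_ge0 => y _; exact: sqr_ge0.
  - by apply: rint_ge0 => y _; exact: sqr_ge0.
  rewrite le_eqVlt; apply/orP; left; apply/eqP; rewrite /k; field.
  by rewrite gt_eqF.
have half : Q / (1 - 2^-1) = 2 * Q by field.
have fin i x : 0 <= x <= 1 -> r i x <= 2 * expR (2 * L) * Q.
  move=> xI; have := key (i, x) xI; rewrite /= half expRN ler_pdivrMr ?expR_gt0//.
  have e : expR (k * x) <= expR (2 * L).
    rewrite ler_expR -/k -[leRHS]mulr1 ler_wpM2l ?(ltW k0)//.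
    by case/andP: xI.
  move=> /le_trans; apply.
  rewrite [leRHS](_ : _ = 2 * Q * expR (2 * L)); last by ring.
  by rewrite ler_wpM2l// mulr_ge0.
by move=> x xI; split; [exact: (fin true)|exact: (fin false)].
Qed.

End Gronwall.

(** * The system and its a priori bound *)

Section Akns.
Context {R : realType}.
Notation C := R[i].
Notation Re := (@complex.Re R).
Notation Im := (@complex.Im R).
Notation nrm := (@Normc.normc R).
Implicit Types (z : C) (a b p q : R -> C) (x : R).

Definition E2 z x : C := cexp (iC * (z * 2) * x%:C).

Lemma E2N z x : E2 (- z) x = (E2 z x)^-1.
Proof. by rewrite /E2 -cexpN; congr cexp; ring. Qed.

Lemma E2_neq0 z x : E2 z x != 0. Proof. exact: cexp_neq0. Qed.

Lemma AC_E2 z : AC (E2 z) (fun x => iC * (z * 2) * E2 z x).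
Proof. exact: AC_cexp. Qed.

Lemma expR2_le9 : expR 2 <= 9 :> R.
Proof.
(* The bound is raised to the power 16; (7/8)^16 still exceeds 1/9. *)
have H : 7 / 8 <= expR (- 8^-1) :> R.
  by apply: le_trans (expR_ge1Dx _); lra.
have H16 : (7 / 8) ^+ 16 <= expR (- 2) :> R.
  rewrite (_ : -2 = 16%:R * (- 8^-1)); last by field.
  by rewrite expRM_natl lerXn2r ?nnegrE ?expR_ge0//; lra.
have e0 : 0 < expR 2 :> R by exact: expR_gt0.
rewrite expRN in H16.
rewrite -lef_pV2 ?posrE//; apply: le_trans H16; lra.
Qed.

Lemma nrm_E2_le z x : `|Im z| <= 1 -> 0 <= x <= 1 -> nrm (E2 z x) <= 9.
Proof.
move=> z1 /andP[x0 x1]; rewrite nrm_cexp; apply: le_trans expR2_le9.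
rewrite ler_expR (_ : Re _ = - (2 * Im z * x)); last first.
  by case: z {z1} => c e; rewrite /=; ring.
have e2 : - Im z <= 1 by rewrite (le_trans (ler_norm _))// normrN.
have : 0 <= (1 + Im z) * x by rewrite mulr_ge0//; lra.
by rewrite mulrDl mul1r; lra.
Qed.

Definition akns z a b p q : Prop :=
  [/\ AC p (fun x => a x * E2 (- z) x * q x), AC q (fun x => b x * E2 z x * p x),
      p 0 = 1 & q 0 = 1].

Lemma akns_sym z a b p q : akns z a b p q -> akns (- z) b a q p.
Proof. by move=> [Hp Hq p0 q0]; split; rewrite ?opprK. Qed.

(** A common kernel for both equations; 9 bounds |e^{+-2izx}| for |Im z| <= 1. Since (9(x + y))^2 <=
    162 (x^2 + y^2), the hypotheses with 324 bound its squared norm by [L]. *)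
Definition kernel (al be : R -> R) x : R := 9 * (al x + be x).

Section Bounds.
Variables (a b : R -> C) (al be : R -> R) (L : R).
Hypotheses (al2 : rL2 al) (be2 : rL2 be).
Hypotheses (aal : forall x, nrm (a x) <= al x) (bbe : forall x, nrm (b x) <= be x).
Hypotheses (L0 : 0 < L) (alL : 324 * rint 0 1 (fun x => al x ^+ 2) <= L)
  (beL : 324 * rint 0 1 (fun x => be x ^+ 2) <= L).

Local Notation m := (kernel al be).

Let al0 x : 0 <= al x. Proof. exact: le_trans (nrm_ge0 _) (aal x). Qed.
Let be0 x : 0 <= be x. Proof. exact: le_trans (nrm_ge0 _) (bbe x). Qed.

Lemma kernel_L2 : rL2 m. Proof. exact/rL2Z/rL2D. Qed.

Lemma kernel_ge0 x : 0 <= m x. Proof. by rewrite mulr_ge0// addr_ge0. Qed.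

Lemma kernel_le : rint 0 1 (fun x => m x ^+ 2) <= L.
Proof.
apply: (@le_trans _ _ (rint 0 1 (fun x => 162 * al x ^+ 2 + 162 * be x ^+ 2))).
  apply: rint_le => //; first by case: kernel_L2.
    by apply: rL1D; apply: rL1Z; [case: al2|case: be2].
  by move=> x _; rewrite /kernel; have := sqr_ge0 (al x - be x); nra.
rewrite rintD// ?rintZ//; try by [case: al2|case: be2|apply: rL1Z; case: al2|apply: rL1Z; case: be2].
set XA := rint _ _ _; set XB := rint _ _ _. move: alL beL; rewrite -/XA -/XB. by lra.
Qed.

Lemma akns_bound z p q : `|Im z| <= 1 -> akns z a b p q ->
  forall x, 0 <= x <= 1 ->
    nrm (p x) <= 2 * expR (2 * L) /\ nrm (q x) <= 2 * expR (2 * L).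
Proof.
move=> z1 [Hp Hq p0 q0].
have [Mp Mp0 pM] := AC_bounded Hp; have [Mq Mq0 qM] := AC_bounded Hq.
have m2 := kernel_L2; have m0 := kernel_ge0; have mL := kernel_le.
have mi := rL2_L1 m2.
have mp := cmeas_nrm (AC_meas Hp); have mq := cmeas_nrm (AC_meas Hq).
have ip : rL1 (fun y => m y * nrm (p y)).
  by apply: (rL1_mul_bounded (M := Mp) mi mp) => x xI; rewrite ger0_norm ?nrm_ge0 ?pM.
have iq : rL1 (fun y => m y * nrm (q y)).
  by apply: (rL1_mul_bounded (M := Mq) mi mq) => x xI; rewrite ger0_norm ?nrm_ge0 ?qM.
move=> x xI.
suff : nrm (p x) <= 2 * expR (2 * L) * 1 /\ nrm (q x) <= 2 * expR (2 * L) * 1.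
  by rewrite mulr1.
apply: (@gronwall _ m L 1 (Mp + Mq) (fun x => nrm (p x)) (fun x => nrm (q x))) => //.
- by move=> y; exact: nrm_ge0.
- by move=> y; exact: nrm_ge0.
- by move=> y yI; rewrite (le_trans (pM y yI))// lerDl.
- by move=> y yI; rewrite (le_trans (qM y yI))// lerDr.
- move=> y yI; have /andP[y0 y1] := yI; case: Hp => pi ->//; rewrite p0.
  rewrite (le_trans (nrmD _ _))// nrm1 lerD2l; apply: cint_le => // t /andP[t0 ty].
  have tI : 0 <= t <= 1 by rewrite t0 (le_trans ty).
  rewrite nrmM nrmM ler_wpM2r ?nrm_ge0// /kernel mulrC ler_pM ?nrm_ge0//.
    by apply: nrm_E2_le => //; rewrite ImN normrN.
  by rewrite (le_trans (aal t))// lerDl.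
- move=> y yI; have /andP[y0 y1] := yI; case: Hq => qi ->//; rewrite q0.
  rewrite (le_trans (nrmD _ _))// nrm1 lerD2l; apply: cint_le => // t /andP[t0 ty].
  have tI : 0 <= t <= 1 by rewrite t0 (le_trans ty).
  rewrite nrmM nrmM ler_wpM2r ?nrm_ge0// /kernel mulrC ler_pM ?nrm_ge0 ?nrm_E2_le//.
  by rewrite (le_trans (bbe t))// lerDr.
Qed.

End Bounds.

End Akns.

Opaque rint cint cexp Normc.normc.

(** * Second-order expansion of the solutions *)

Section AknsRemainder.
Context {R : realType}.
Notation C := R[i].
Notation Re := (@complex.Re R).
Notation Im := (@complex.Im R).
Notation nrm := (@Normc.normc R).
Implicit Types (z : C) (a b p q : R -> C) (x : R).

Lemma nrm_two : nrm (2 : C) = 2.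
Proof.
have -> : (2 : C) = (2 : R)%:C by rewrite rmorph_nat.
by rewrite nrm_real ger0_norm.
Qed.

Definition second a b x : C := cint 0 x (fun y => a y * cint 0 y b).

(** The first-order term keeps e^{-2izx} outside the primitive; in the second-order term the two
    opposite exponentials then cancel. Thus [z] enters through that one factor, and the integrals
    are fixed functions to which Bessel's inequality and [tri_sum] apply. *)
Definition approx z a b x : C := 1 + second a b x + cint 0 x a * E2 (- z) x.

Lemma cL1_second a b : cL1 a -> cL1 b -> cL1 (fun y => a y * cint 0 y b).
Proof. by move=> ai bi; exact: cL1_mulAC ai (AC_primitive bi). Qed.

Lemma AC_second a b : cL1 a -> cL1 b ->
  AC (second a b) (fun y => a y * cint 0 y b).
Proof. by move=> ai bi; exact/AC_primitive/cL1_second. Qed.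

(** The remainder solves the same system with a source: [a] times the second-order term of the other
    component, and 2iz times the primitive of [a], which comes from differentiating the exponential
    in [approx]. *)
Lemma akns_remainder_AC z a b p q : cL1 a -> cL1 b -> akns z a b p q ->
  AC (fun x => p x - approx z a b x)
     (fun x => a x * E2 (- z) x * (q x - approx (- z) b a x) +
        (a x * second b a x + iC * (z * 2) * cint 0 x a) * E2 (- z) x).
Proof.
move=> ai bi [Hp Hq p0 q0].
have Hk : AC (approx z a b) (fun x => a x * cint 0 x b +
    (a x * E2 (- z) x + cint 0 x a * (iC * (- z * 2) * E2 (- z) x))).
  apply: AC_eq (AC_D (AC_D (AC_cst 1) (AC_second ai bi))
    (AC_M (AC_primitive ai) (AC_E2 (- z)))) => // x _.
  by rewrite add0r.
apply: AC_eq (AC_B Hp Hk) => // x _.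
rewrite /approx opprK E2N; have := E2_neq0 z x; move: (E2 z x) => e e0.
by field.
Qed.

(** Contains the sources of both equations, so that a single constant [Q] serves in [gronwall]. *)
Definition remainder_bound (a b : R -> C) (al be : R -> R) z : R :=
  9 * (rint 0 1 (fun x => al x * nrm (second b a x)) +
       rint 0 1 (fun x => be x * nrm (second a b x)) +
       2 * nrm z * (rint 0 1 (fun x => nrm (cint 0 x a)) +
                    rint 0 1 (fun x => nrm (cint 0 x b)))).

Lemma remainder_bound_sym a b (al be : R -> R) z :
  remainder_bound b a be al (- z) = remainder_bound a b al be z.
Proof.
rewrite /remainder_bound (nrmN z) [X in _ = 9 * (X + _)]addrC.
by rewrite [X in _ = 9 * (_ + 2 * _ * X)]addrC.
Qed.

Lemma akns_remainder_half a b al be z p q : cL2 a -> cL2 b -> rL2 al -> rL2 be ->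
  (forall x, nrm (a x) <= al x) -> (forall x, nrm (b x) <= be x) ->
  `|Im z| <= 1 -> akns z a b p q ->
  forall x, 0 <= x <= 1 -> nrm (p x - approx z a b x) <=
    remainder_bound a b al be z +
    rint 0 x (fun y => kernel al be y * nrm (q y - approx (- z) b a y)).
Proof.
move=> a2 b2 al2 be2 aal bbe z1 Hpq x xI; have /andP[x0 x1] := xI.
have al0 y : 0 <= al y := le_trans (nrm_ge0 _) (aal y).
have be0 y : 0 <= be y := le_trans (nrm_ge0 _) (bbe y).
have [ai bi] := (cL2_L1 a2, cL2_L1 b2).
have HR := akns_remainder_AC ai bi Hpq.
have HRq := akns_remainder_AC bi ai (akns_sym Hpq).
have [ri rE] := HR.
have E0 : p 0 - approx z a b 0 = 0.
  have [_ _ -> _] := Hpq.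
  by rewrite /approx /second !cint_eq mul0r !addr0 subrr.
have S2 := AC_second bi ai; have S1 := AC_second ai bi.
have PA := AC_primitive ai; have PB := AC_primitive bi.
have ali := rL2_L1 al2; have bei := rL2_L1 be2.
have i0 (g G g' : R -> C) (h : R -> R) : rL2 h -> AC G g -> rL1 (fun y => h y * nrm (G y)).
  move=> h2 HG; have [M _ GM] := AC_bounded HG.
  apply: (rL1_mul_bounded (M := M) (rL2_L1 h2) (cmeas_nrm (AC_meas HG))).
  by move=> y yI; rewrite ger0_norm ?nrm_ge0 ?GM.
have i1 : rL1 (fun y => kernel al be y * nrm (q y - approx (- z) b a y)).
  by apply: i0 HRq => //; exact: kernel_L2.
have i2 : rL1 (fun y => al y * nrm (second b a y)) by exact: i0 S2.
have i3 : rL1 (fun y => nrm (cint 0 y a)) by exact: cL1_nrm (AC_L1 PA).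
have i4 : rL1 (fun y => 9 * (al y * nrm (second b a y)) +
    9 * (2 * nrm z) * nrm (cint 0 y a)).
  by apply: rL1D; exact: rL1Z.
rewrite (rE x xI) E0 add0r.
apply: (@le_trans _ _ (rint 0 x (fun y =>
  kernel al be y * nrm (q y - approx (- z) b a y) +
  (9 * (al y * nrm (second b a y)) + 9 * (2 * nrm z) * nrm (cint 0 y a))))).
  apply: cint_le => //; first exact: rL1D.
  move=> y /andP[y0 yx]; have yI : 0 <= y <= 1 by rewrite y0 (le_trans yx).
  have e9 : nrm (E2 (- z) y) <= 9 by apply: nrm_E2_le; rewrite ?ImN ?normrN.
  set e := E2 (- z) y in e9 *; set S := second b a y; set Ay := cint 0 y a.
  set k := q y - _.
  apply: le_trans (nrmD _ _) _; apply: lerD.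
    rewrite nrmM nrmM ler_wpM2r ?nrm_ge0// /kernel mulrC ler_pM ?nrm_ge0//.
    by rewrite (le_trans (aal y))// lerDl.
  rewrite nrmM mulrC.
  have n2 : nrm (a y * S + iC * (z * 2) * Ay) <= al y * nrm S + 2 * nrm z * nrm Ay.
    apply: le_trans (nrmD _ _) _; apply: lerD; first by rewrite nrmM ler_wpM2r ?nrm_ge0.
    rewrite nrmM nrmM nrm_i mul1r nrmM ler_wpM2r ?nrm_ge0// mulrC.
    by rewrite nrm_two.
  apply: le_trans (ler_pM (nrm_ge0 _) (nrm_ge0 _) e9 n2) _.
  by rewrite le_eqVlt; apply/orP; left; apply/eqP; ring.
rewrite rintD// addrC lerD2r.
have pos f : (forall y, 0 <= f y) -> 0 <= rint 0 1 f by move=> f0; apply: rint_ge0.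
apply: (@le_trans _ _ (rint 0 1 (fun y => 9 * (al y * nrm (second b a y)) +
    9 * (2 * nrm z) * nrm (cint 0 y a)))).
  by apply: rint_subset => // y _; rewrite addr_ge0// !mulr_ge0 ?nrm_ge0.
have j3 := rL1Z (9 * (2 * nrm z)) i3; have j2 := rL1Z 9 i2.
rewrite rintD// !rintZ// /remainder_bound.
have I30 : 0 <= rint 0 1 (fun y => be y * nrm (second a b y)).
  by apply: pos => y; rewrite mulr_ge0 ?nrm_ge0.
have I40 : 0 <= nrm z * rint 0 1 (fun y => nrm (cint 0 y b)).
  by rewrite mulr_ge0 ?nrm_ge0//; apply: pos => y; exact: nrm_ge0.
have gen (I1 I2 I3 I4 n : R) : 0 <= I3 -> 0 <= n * I4 ->
  9 * I1 + 9 * (2 * n) * I2 <= 9 * (I1 + I3 + 2 * n * (I2 + I4)) by lra.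
exact: gen.
Qed.

Lemma akns_remainder a b al be L z p q : cL2 a -> cL2 b -> rL2 al -> rL2 be ->
  (forall x, nrm (a x) <= al x) -> (forall x, nrm (b x) <= be x) ->
  0 < L -> 324 * rint 0 1 (fun x => al x ^+ 2) <= L ->
  324 * rint 0 1 (fun x => be x ^+ 2) <= L ->
  `|Im z| <= 1 -> akns z a b p q ->
  nrm (p 1 - approx z a b 1) <= 2 * expR (2 * L) * remainder_bound a b al be z /\
  nrm (q 1 - approx (- z) b a 1) <= 2 * expR (2 * L) * remainder_bound a b al be z.
Proof.
move=> a2 b2 al2 be2 aal bbe L0 alL beL z1 Hpq.
have al0 y : 0 <= al y := le_trans (nrm_ge0 _) (aal y).
have be0 y : 0 <= be y := le_trans (nrm_ge0 _) (bbe y).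
have [ai bi] := (cL2_L1 a2, cL2_L1 b2).
have HR := akns_remainder_AC ai bi Hpq.
have HRq := akns_remainder_AC bi ai (akns_sym Hpq).
have [M1 M10 HM1] := AC_bounded HR; have [M2 M20 HM2] := AC_bounded HRq.
have Nz1 : `|Im (- z)| <= 1 by rewrite ImN normrN.
apply: (@gronwall _ (kernel al be) L _ (M1 + M2)
  (fun x => nrm (p x - approx z a b x)) (fun x => nrm (q x - approx (- z) b a x))).
- exact: kernel_L2.
- exact: kernel_ge0 aal bbe.
- by [].
- exact: kernel_le.
- exact: cmeas_nrm (AC_meas HR).
- exact: cmeas_nrm (AC_meas HRq).
- by move=> x; exact: nrm_ge0.
- by move=> x; exact: nrm_ge0.
- by move=> x xI; rewrite (le_trans (HM1 x xI))// lerDl.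
- by move=> x xI; rewrite (le_trans (HM2 x xI))// lerDr.
- exact: akns_remainder_half.
- move=> x xI; have := akns_remainder_half b2 a2 be2 al2 bbe aal Nz1 (akns_sym Hpq) xI.
  rewrite opprK remainder_bound_sym => /le_trans; apply; rewrite lerD2l.
  rewrite le_eqVlt; apply/orP; left; apply/eqP; apply: eq_rint => y _.
  by rewrite /kernel [be y + _]addrC.
- rewrite /remainder_bound mulr_ge0// !addr_ge0//.
  + by apply: rint_ge0 => x _; rewrite mulr_ge0 ?nrm_ge0.
  + by apply: rint_ge0 => x _; rewrite mulr_ge0 ?nrm_ge0.
  + rewrite !mulr_ge0 ?nrm_ge0// addr_ge0//; apply: rint_ge0 => x _; exact: nrm_ge0.
- by rewrite ler01 lexx.
Qed.

(* Near-constancy of solutions when the mean oscillation of [a] and [b] is small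
   up to a part that is itself small in L1: integrate the oscillating part by parts. *)
Lemma akns_small_half a b a1 (al1 : R -> R) z p q (w G nb zz eta X : R) :
  cL2 a -> cL2 b -> cL2 a1 -> rL1 al1 -> (forall x, nrm (a1 x) <= al1 x) ->
  `|Im z| <= 1 -> nrm z <= zz -> akns z a b p q ->
  (forall x, 0 <= x <= 1 -> nrm (p x) <= G) ->
  (forall x, 0 <= x <= 1 -> nrm (q x) <= G) ->
  (forall x, 0 <= x <= 1 -> nrm (q x) <= X) ->
  (forall x, 0 <= x <= 1 -> nrm (cint 0 x (fun y => a y - a1 y)) <= w) ->
  rint 0 1 (fun x => nrm (b x)) <= nb -> 9 * rint 0 1 al1 <= eta ->
  forall x, 0 <= x <= 1 -> nrm (p x - 1) <= w * G * (9 + 18 * zz + nb) + eta * X.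
Proof.
move=> a2 b2 a12 al1i aal1 z1 zzz Hpq pG qG qX Aw bnb al1e x xI.
have /andP[x0 x1] := xI; have I01 : 0 <= (0 : R) <= 1 by rewrite lexx ler01.
have [Hp Hq p0 q0] := Hpq; have [pi pE] := Hp.
have [[ai bi] a1i] := (cL2_L1 a2, cL2_L1 b2, cL2_L1 a12).
have w0 : 0 <= w := le_trans (nrm_ge0 _) (Aw 0 I01).
have G0 : 0 <= G := le_trans (nrm_ge0 _) (pG 0 I01).
have X0 : 0 <= X := le_trans (nrm_ge0 _) (qX 0 I01).
have zz0 : 0 <= zz := le_trans (nrm_ge0 _) zzz.
have a0i : cL1 (fun y => a y - a1 y) by exact: cL1B.
have e9 y : 0 <= y <= 1 -> nrm (E2 (- z) y) <= 9.
  by move=> yI; apply: nrm_E2_le; rewrite ?ImN ?normrN.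
(* The exponential of q' = b e^{2izx} p cancels here. The boundary term of the integration by parts
   gives the 9 of the bound, the term with 2iz the [18 * zz], and the term with [b] the [nb]. *)
have Hpsi : AC (fun y => E2 (- z) y * q y)
    (fun y => b y * p y - iC * (z * 2) * (E2 (- z) y * q y)).
  apply: AC_eq (AC_M (AC_E2 (- z)) Hq) => // y _; rewrite E2N.
  by have := E2_neq0 z y; move: (E2 z y) => e e0; field.
have [hi hE] := AC_M (AC_primitive a0i) Hpsi.
have k1 : cL1 (fun y => (a y - a1 y) * (E2 (- z) y * q y)) by exact: cL1_mulAC Hpsi.
have k2 : cL1 (fun y => cint 0 y (fun y => a y - a1 y) *
    (b y * p y - iC * (z * 2) * (E2 (- z) y * q y))).
  under eq_fun do rewrite mulrC.
  by apply: cL1_mulAC (AC_primitive a0i); case: Hpsi.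
have k3 : cL1 (fun y => a1 y * (E2 (- z) y * q y)) by exact: cL1_mulAC Hpsi.
have E1 := hE x xI; rewrite cint_eq mul0r add0r in E1.
have E3 := cintD k1 k2 (lexx 0) x1.
rewrite E3 in E1.
have -> : p x - 1 = cint 0 x (fun y => a y - a1 y) * (E2 (- z) x * q x) -
   cint 0 x (fun y => cint 0 y (fun y => a y - a1 y) *
    (b y * p y - iC * (z * 2) * (E2 (- z) y * q y))) +
   cint 0 x (fun y => a1 y * (E2 (- z) y * q y)).
  rewrite E1 addrK -(cintD k1 k3)// (pE x xI) p0 addrC addKr.
  by apply: eq_cint => y _; ring.
have psiG y : 0 <= y <= 1 -> nrm (E2 (- z) y * q y) <= 9 * G.
  by move=> yI; rewrite nrmM ler_pM ?nrm_ge0 ?e9 ?qG.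
apply: le_trans (nrmD _ _) _; apply: lerD.
  have -> : w * G * (9 + 18 * zz + nb) = w * (9 * G) + w * (G * nb + 18 * zz * G) by ring.
  apply: le_trans (nrmB _ _) _; apply: lerD.
    by rewrite nrmM ler_pM ?nrm_ge0 ?Aw ?psiG.
  have ib : rL1 (fun y => nrm (b y)) by exact: cL1_nrm.
  apply: (@le_trans _ _ (rint 0 x (fun y => w * G * nrm (b y) + w * (18 * zz * G)))).
    apply: cint_le => //; first by apply: rL1D; [exact: rL1Z|exact: rL1_cst].
    move=> y /andP[y0 yx]; have yI : 0 <= y <= 1 by rewrite y0 (le_trans yx).
    rewrite nrmM [leRHS](_ : _ = w * (G * nrm (b y) + 18 * zz * G)); last by ring.
    rewrite ler_pM ?nrm_ge0 ?Aw//.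
    apply: le_trans (nrmB _ _) _; apply: lerD.
      by rewrite nrmM mulrC ler_wpM2r ?nrm_ge0 ?pG.
    rewrite nrmM (_ : 18 * zz * G = (2 * zz) * (9 * G)); last by ring.
    rewrite ler_pM ?nrm_ge0 ?psiG// nrmM nrm_i mul1r nrmM mulrC.
    by rewrite nrm_two ler_wpM2l.
  have jb := rL1Z (w * G) ib; have jc := rL1_cst (w * (18 * zz * G)).
  rewrite rintD// rintZ// rint_cst// subr0 mulrDr lerD//.
    rewrite mulrA ler_wpM2l ?mulr_ge0//; apply: le_trans bnb.
    by apply: rint_subset => // y _; exact: nrm_ge0.
  by rewrite -[leRHS]mulr1 ler_wpM2l ?mulr_ge0.
have j1 := rL1Z (9 * X) al1i.
apply: (@le_trans _ _ (rint 0 x (fun y => 9 * X * al1 y))).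
  apply: cint_le => // y /andP[y0 yx]; have yI : 0 <= y <= 1 by rewrite y0 (le_trans yx).
  by rewrite nrmM mulrC ler_pM ?nrm_ge0// nrmM ler_pM ?nrm_ge0 ?e9 ?qX.
rewrite rintZ// mulrAC ler_wpM2r//; apply: le_trans al1e; rewrite ler_wpM2l//.
by apply: rint_subset => // y _; exact: le_trans (nrm_ge0 _) (aal1 y).
Qed.

End AknsRemainder.

(** * Near-constancy, the Lagrange identity and Lipschitz dependence on [z] *)

Section AknsSmall.
Context {R : realType}.
Notation C := R[i].
Notation Re := (@complex.Re R).
Notation Im := (@complex.Im R).
Notation nrm := (@Normc.normc R).
Implicit Types (z : C) (a b p q : R -> C) (x : R).

(** The bootstrap: with eta = 1/20, the estimate of [akns_small_half] is fed back through
    [self_bound], starting from the Gronwall bound [G]. This bounds |p| and |q| by (1 + t) / (1 -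
    1/20), hence the deviations from 1 by t + (1 + t)/19, which is below 1/18 for t <= 1/1000. *)
Lemma akns_small a b a1 b1 (al1 be1 : R -> R) z p q (w G nb zz : R) :
  cL2 a -> cL2 b -> cL2 a1 -> cL2 b1 -> rL1 al1 -> rL1 be1 ->
  (forall x, nrm (a1 x) <= al1 x) -> (forall x, nrm (b1 x) <= be1 x) ->
  `|Im z| <= 1 -> nrm z <= zz -> akns z a b p q ->
  (forall x, 0 <= x <= 1 -> nrm (p x) <= G) ->
  (forall x, 0 <= x <= 1 -> nrm (q x) <= G) ->
  (forall x, 0 <= x <= 1 -> nrm (cint 0 x (fun y => a y - a1 y)) <= w) ->
  (forall x, 0 <= x <= 1 -> nrm (cint 0 x (fun y => b y - b1 y)) <= w) ->
  rint 0 1 (fun x => nrm (a x)) <= nb -> rint 0 1 (fun x => nrm (b x)) <= nb ->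
  9 * rint 0 1 al1 <= 20^-1 -> 9 * rint 0 1 be1 <= 20^-1 ->
  w * G * (9 + 18 * zz + nb) <= 1000^-1 ->
  forall x, 0 <= x <= 1 -> nrm (p x - 1) <= 18^-1 /\ nrm (q x - 1) <= 18^-1.
Proof.
move=> a2 b2 a12 b12 al1i be1i aal bbe z1 zzz Hpq pG qG Aw Bw ann bnb al1e be1e tau.
have Nz1 : `|Im (- z)| <= 1 by rewrite ImN normrN.
have Nzz : nrm (- z) <= zz by rewrite nrmN.
have Hp X (qX : forall x, 0 <= x <= 1 -> nrm (q x) <= X) :=
  akns_small_half a2 b2 a12 al1i aal z1 zzz Hpq pG qG qX Aw bnb al1e.
have Hq X (pX : forall x, 0 <= x <= 1 -> nrm (p x) <= X) :=
  akns_small_half b2 a2 b12 be1i bbe Nz1 Nzz (akns_sym Hpq) qG pG pX Bw ann be1e.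
set t := w * G * _ in tau Hp Hq.
pose f (u : bool * R) := if u.1 then nrm (p u.2) else nrm (q u.2).
have n1 (c : C) : nrm c <= 1 + nrm (c - 1).
  by rewrite -(@nrm1 R) -{1}[c](subrK 1) addrC nrmD.
have key u : 0 <= u.2 <= 1 -> f u <= (1 + t) / (1 - 20^-1).
  move=> uI; apply: (@self_bound _ _ (fun u : bool * R => 0 <= u.2 <= 1) f _ _ G) uI.
  - by apply/andP; split; lra.
  - by move=> [[] x] /= xI; [exact: pG|exact: qG].
  move=> X HX [[] x] /= xI; rewrite /f /=.
    apply: le_trans (n1 _) _; rewrite -addrA lerD2l; apply: (Hp X) => // y yI.
    exact: (HX (false, y)).
  apply: le_trans (n1 _) _; rewrite -addrA lerD2l; apply: (Hq X) => // y yI.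
  exact: (HX (true, y)).
have fin : t + 20^-1 * ((1 + t) / (1 - 20^-1)) <= 18^-1.
  rewrite (_ : _ + _ = t * (20 / 19) + 19^-1); last by field.
  lra.
move=> x xI; split.
  by apply: le_trans (Hp _ _ x xI) fin => y yI; exact: (key (false, y)).
by apply: le_trans (Hq _ _ x xI) fin => y yI; exact: (key (true, y)).
Qed.

Definition ee (c : C) x : C := cexp (iC * c * x%:C).

Lemma eeD c c' x : ee (c + c') x = ee c x * ee c' x.
Proof. by rewrite /ee -cexpD; congr cexp; ring. Qed.

Lemma eeN c x : ee (- c) x = (ee c x)^-1.
Proof. by rewrite /ee -cexpN; congr cexp; ring. Qed.

Lemma ee_neq0 c x : ee c x != 0. Proof. exact: cexp_neq0. Qed.

Lemma E2_ee z x : E2 z x = ee z x * ee z x.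
Proof. by rewrite -eeD /E2 /ee; congr cexp; ring. Qed.

Lemma AC_ee c : AC (ee c) (fun x => iC * c * ee c x).
Proof. exact: AC_cexp. Qed.

(** Here [p'] and [q'] are the solutions at [z']. In the derivative of e^{i(z'-z)x} q p' -
    e^{i(z-z')x} p q' all terms with [a] or [b] cancel, and at 0 this function vanishes because all
    initial values are 1. The first conjunct supplies the integrability of the sum. *)
Lemma akns_lagrange z z' a b p q p' q' :
  akns z a b p q -> akns z' a b p' q' ->
  AC (fun x => ee (z' - z) x * (q x * p' x) + ee (z - z') x * (p x * q' x))
     (fun x => iC * (z' - z) * ee (z' - z) x * (q x * p' x) +
       ee (z' - z) x * (b x * E2 z x * p x * p' x + q x * (a x * E2 (- z') x * q' x)) +
       (iC * (z - z') * ee (z - z') x * (p x * q' x) +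
       ee (z - z') x * (a x * E2 (- z) x * q x * q' x + p x * (b x * E2 z' x * p' x)))) /\
  ee (z' - z) 1 * (q 1 * p' 1) - ee (z - z') 1 * (p 1 * q' 1) =
  iC * (z' - z) * cint 0 1 (fun x =>
    ee (z' - z) x * (q x * p' x) + ee (z - z') x * (p x * q' x)).
Proof.
move=> [Hp Hq p0 q0] [Hp' Hq' p0' q0'].
have H1 := AC_M (AC_ee (z' - z)) (AC_M Hq Hp').
have H2 := AC_M (AC_ee (z - z')) (AC_M Hp Hq').
have S1 := AC_D H1 H2; split=> //.
have [_ E] := AC_B H1 H2.
have I1 : 0 <= (1 : R) <= 1 by rewrite ler01 lexx.
have l0 : (0 : R) <= 0 by []. have l1 : (1 : R) <= 1 by [].
rewrite -cintZ//; last exact: AC_L1 S1.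
rewrite (E 1 I1) p0 q0 p0' q0' /ee !mulr0 cexp0 subrr add0r.
apply: eq_cint => x _; rewrite -!/(ee _ _).
rewrite !E2N !E2_ee -(opprB z' z) eeN eeD eeN.
have := ee_neq0 z x; have := ee_neq0 z' x.
move: (ee z x) (ee z' x) => u u' un un'.
by field; rewrite un un'.
Qed.

(** The difference of two solutions obeys the inequality of [gronwall] with a source proportional to
    |z' - z|. A crude [K] is enough, as it only serves to differentiate the characteristic function
    at a zero. *)
Lemma akns_lipschitz a b al be L z p q : cL2 a -> cL2 b -> rL2 al -> rL2 be ->
  (forall x, nrm (a x) <= al x) -> (forall x, nrm (b x) <= be x) ->
  0 < L -> 324 * rint 0 1 (fun x => al x ^+ 2) <= L ->
  324 * rint 0 1 (fun x => be x ^+ 2) <= L ->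
  `|Im z| <= 1 -> akns z a b p q ->
  exists2 K, 0 <= K & forall z' p' q', akns z' a b p' q' -> `|Im z'| <= 1 -> nrm (z' - z) <= 1 ->
    forall x, 0 <= x <= 1 ->
      nrm (p' x - p x) <= K * nrm (z' - z) /\ nrm (q' x - q x) <= K * nrm (z' - z).
Proof.
move=> a2 b2 al2 be2 aal bbe L0 alL beL z1 Hpq.
have G := akns_bound al2 be2 aal bbe L0 alL beL z1 Hpq.
set GG := 2 * expR (2 * L) in G.
have GG0 : 0 <= GG by rewrite mulr_ge0 ?expR_ge0.
have m2 := kernel_L2 al2 be2; have mi := rL2_L1 m2.
have m0 := kernel_ge0 aal bbe.
exists (GG * (2 * expR 2 * GG * rint 0 1 (kernel al be))) => [|z' p' q' Hpq' z1' dz x xI].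
  have k0 : 0 <= rint 0 1 (kernel al be) by apply: rint_ge0.
  have e0 : 0 <= 2 * expR 2 :> R by rewrite mulr_ge0 ?expR_ge0.
  exact: (mulr_ge0 GG0 (mulr_ge0 (mulr_ge0 e0 GG0) k0)).
have G' := akns_bound al2 be2 aal bbe L0 alL beL z1' Hpq'.
have [Hp Hq p0 q0] := Hpq; have [Hp' Hq' p0' q0'] := Hpq'.
have HP := AC_B Hp' Hp; have HQ := AC_B Hq' Hq.
have al0 y : 0 <= al y := le_trans (nrm_ge0 _) (aal y).
have be0 y : 0 <= be y := le_trans (nrm_ge0 _) (bbe y).
set dl := nrm (z' - z) in dz *; have dl0 : 0 <= dl := nrm_ge0 _.
have bound (c c' : C) (f g g' : C) (h : R) y : 0 <= y <= 1 -> nrm (c' - c) = dl ->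
    `|Im c| <= 1 -> `|Im c'| <= 1 -> nrm f <= h ->
    nrm g <= GG -> nrm (f * E2 c' y * g' - f * E2 c y * g) <=
      9 * h * nrm (g' - g) + 9 * h * (2 * expR 2 * GG * dl).
  move=> yI cdl c1 c1' fh gG; have /andP[y0 y1] := yI.
  have h0 : 0 <= h := le_trans (nrm_ge0 _) fh.
  have -> : f * E2 c' y * g' - f * E2 c y * g =
     f * E2 c' y * (g' - g) + f * (E2 c' y - E2 c y) * g by ring.
  apply: le_trans (nrmD _ _) _; apply: lerD.
    rewrite nrmM nrmM ler_wpM2r ?nrm_ge0// mulrC ler_pM ?nrm_ge0//.
    exact: nrm_E2_le.
  have -> : E2 c' y - E2 c y = E2 c y * (cexp (iC * ((c' - c) * 2) * y%:C) - 1).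
    rewrite mulrBr mulr1 /E2 -cexpD; congr (cexp _ - _); ring.
  have En : nrm (cexp (iC * ((c' - c) * 2) * y%:C) - 1) <= 2 * expR 2 * dl.
    apply: le_trans (cexp_sub1_le _) _.
    have nn : nrm (iC * ((c' - c) * 2) * y%:C) <= 2 * dl.
      rewrite nrmM nrmM nrmM nrm_i nrm_two mul1r cdl nrm_real ger0_norm//.
      by rewrite [dl * 2]mulrC ler_piMr ?mulr_ge0.
    rewrite [leRHS]mulrAC ler_pM ?nrm_ge0 ?expR_ge0// ler_expR (le_trans nn)//.
    by rewrite -[leRHS]mulr1 ler_wpM2l.
  rewrite nrmM nrmM nrmM.
  have H1 := nrm_E2_le c1 yI.
  have H2 := ler_pM (nrm_ge0 _) (nrm_ge0 _) H1 En.
  have H3 := ler_pM (nrm_ge0 _) (mulr_ge0 (nrm_ge0 _) (nrm_ge0 _)) fh H2.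
  apply: le_trans (ler_pM (mulr_ge0 (nrm_ge0 _) (mulr_ge0 (nrm_ge0 _) (nrm_ge0 _))) (nrm_ge0 _) H3 gG) _.
  by rewrite le_eqVlt; apply/orP; left; apply/eqP; ring.
have [M1 M10 HM1] := AC_bounded HP; have [M2 M20 HM2] := AC_bounded HQ.
have mP := cmeas_nrm (AC_meas HP); have mQ := cmeas_nrm (AC_meas HQ).
have half (f f' g g' h h' : R -> C) (eta : R -> R) (c c' : C) M :
    AC (fun y => f' y - f y) (fun y => h y * E2 c' y * g' y - h y * E2 c y * g y) ->
    f' 0 - f 0 = 0 -> rmeas (fun y => nrm (g' y - g y)) ->
    (forall y, 0 <= y <= 1 -> nrm (g' y - g y) <= M) ->
    nrm (c' - c) = dl -> `|Im c| <= 1 -> `|Im c'| <= 1 ->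
    (forall y, nrm (h y) <= eta y) -> (forall y, 9 * eta y <= kernel al be y) ->
    (forall y, 0 <= y <= 1 -> nrm (g y) <= GG) ->
    forall y, 0 <= y <= 1 -> nrm (f' y - f y) <=
      2 * expR 2 * GG * dl * rint 0 1 (kernel al be) +
      rint 0 y (fun t => kernel al be t * nrm (g' t - g t)).
  move=> [hi hE] f0 mg gM cdl c1 c1' heta etam gG y yI; have /andP[y0 y1] := yI.
  have i1 : rL1 (fun t => kernel al be t * nrm (g' t - g t)).
    by apply: (rL1_mul_bounded (M := M) mi mg) => t tI; rewrite ger0_norm ?nrm_ge0 ?gM.
  have k0 : 0 <= 2 * expR 2 * GG * dl.
    by apply: mulr_ge0 dl0; apply: mulr_ge0 GG0; rewrite mulr_ge0 ?expR_ge0.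
  have i2 := rL1Z (2 * expR 2 * GG * dl) mi.
  rewrite (hE y yI) f0 add0r.
  apply: (@le_trans _ _ (rint 0 y (fun t => 2 * expR 2 * GG * dl * kernel al be t +
     kernel al be t * nrm (g' t - g t)))).
    apply: cint_le => //; first exact: rL1D.
    move=> t /andP[t0 ty]; have tI : 0 <= t <= 1 by rewrite t0 (le_trans ty).
    apply: le_trans (bound c c' (h t) (g t) (g' t) (eta t) t tI cdl c1 c1' (heta t) (gG t tI)) _.
    rewrite addrC; apply: lerD; last by rewrite ler_wpM2r ?nrm_ge0.
    by rewrite mulrC ler_wpM2l.
  rewrite rintD// rintZ// lerD2r ler_wpM2l//.
  by apply: rint_subset.
have NI : `|Im (- z)| <= 1 by rewrite ImN normrN.
have NI' : `|Im (- z')| <= 1 by rewrite ImN normrN.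
have := @gronwall _ (kernel al be) L (2 * expR 2 * GG * dl * rint 0 1 (kernel al be)) (M1 + M2)
   (fun y => nrm (p' y - p y)) (fun y => nrm (q' y - q y)) m2 m0 L0
   (kernel_le al2 be2 alL beL) mP mQ (fun _ => nrm_ge0 _) (fun _ => nrm_ge0 _).
move=> /(_ _ _ _ _ _ x xI) H.
have [|||||H1 H2] := H.
- by move=> y yI; rewrite (le_trans (HM1 y yI))// lerDl.
- by move=> y yI; rewrite (le_trans (HM2 y yI))// lerDr.
- move=> y yI; apply: (half _ _ _ _ _ a al (- z) (- z') M2 HP) => //.
  + by rewrite p0 p0' subrr.
  + by rewrite opprK addrC nrm_distC.
  + by move=> t; rewrite /kernel ler_wpM2l// lerDl.
  + by move=> t tI; have [] := G t tI.
- move=> y yI; apply: (half _ _ _ _ _ b be z z' M1 HQ) => //.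
  + by rewrite q0 q0' subrr.
  + by move=> t; rewrite /kernel ler_wpM2l// lerDr.
  + by move=> t tI; have [] := G t tI.
- apply: mulr_ge0; last by apply: rint_ge0.
  by apply: mulr_ge0 dl0; apply: mulr_ge0 GG0; rewrite mulr_ge0 ?expR_ge0.
have e : GG * (2 * expR 2 * GG * rint 0 1 (kernel al be)) * dl =
   2 * expR (2 * L) * (2 * expR 2 * GG * dl * rint 0 1 (kernel al be)).
  by rewrite -/GG mulrAC; move: (rint _ _ _) => I; ring.
by rewrite e.
Qed.

End AknsSmall.

(** * Zeros of the characteristic function *)

Section FixedPoint.
Context {R : realType}.
Notation C := R[i].
Notation Re := (@complex.Re R).
Notation Im := (@complex.Im R).
Notation nrm := (@Normc.normc R).

Lemma geometric_le0 (r K x : R) : 0 <= r < 1 -> (forall n, x <= K * r ^+ n) -> x <= 0.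
Proof.
move=> /andP[r0 r1] H.
have c : (fun n => K * r ^+ n) @ \oo --> (0 : R).
  rewrite -[X in _ --> X](mulr0 K); apply: cvgM; first exact: cvg_cst.
  by apply: cvg_expr; rewrite ger0_norm.
have <- := cvg_lim (@Rhausdorff R) c.
by apply: limr_ge; [apply/cvg_ex; exists 0|apply: nearW].
Qed.

(** The sequences x_n -+ c r^n / (1 - r) are monotone and enclose all later terms; the limit is the
    supremum of the lower one. The explicit rate is what the fixed-point argument uses. *)
Lemma real_geometric_limit (r c : R) (x : nat -> R) : 0 <= r < 1 ->
  (forall n, `|x n.+1 - x n| <= c * r ^+ n) ->
  exists l, forall n, `|l - x n| <= c / (1 - r) * r ^+ n.
Proof.
move=> /andP[r0 r1] H; have r1' : 1 - r != 0 by rewrite subr_eq0 gt_eqF.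
pose e n := c / (1 - r) * r ^+ n.
have eS n : e n - e n.+1 = c * r ^+ n by rewrite /e exprS; field.
have c0 : 0 <= c by have := le_trans (normr_ge0 _) (H 0%N); rewrite expr0 mulr1.
have e0 n : 0 <= e n by rewrite mulr_ge0 ?exprn_ge0// divr_ge0// subr_ge0 ltW.
pose w n := x n - e n; pose y n := x n + e n.
have wS n : w n <= w n.+1.
  by have := H n; rewrite ler_norml -eS /w => /andP[]; lra.
have yS n : y n.+1 <= y n.
  by have := H n; rewrite ler_norml -eS /y => /andP[]; lra.
have wm n k : w n <= w (n + k)%N.
  by elim: k => [|k IH]; rewrite ?addn0// addnS (le_trans IH).
have ym n k : y (n + k)%N <= y n.
  by elim: k => [|k IH]; rewrite ?addn0// addnS (le_trans (yS _)).
have wy n m : w n <= y m.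
  apply: le_trans (wm n m) _; rewrite addnC; apply: le_trans _ (ym m n).
  by rewrite /w /y lerD2l; have := e0 (m + n)%N; lra.
pose S := [set t | exists n, t = w n].
have S0 : S !=set0 by exists (w 0%N); exists 0%N.
have Sub m : ubound S (y m) by move=> _ [n ->]; exact: wy.
exists (sup S) => n; rewrite ler_norml.
have hS : has_sup S by split=> //; exists (y 0%N).
have H1 : w n <= sup S by apply: sup_upper_bound => //; exists n.
have H2 : sup S <= y n by apply: ge_sup.
by move: H1 H2; rewrite /w /y -/(e n); lra.
Qed.

(** Banach's theorem on a closed disc about 0, with separate limits for real and imaginary parts;
    the bound on [T 0] keeps the iterates in the disc. *)
Lemma contraction_fixed (T : C -> C) (r rho : R) : 0 <= r < 1 -> 0 <= rho ->
  (forall z z', nrm z <= rho -> nrm z' <= rho -> nrm (T z - T z') <= r * nrm (z - z')) ->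
  nrm (T 0) <= (1 - r) * rho ->
  exists2 l, nrm l <= rho & T l = l.
Proof.
move=> r01 rho0 HT T0; have /andP[r0 r1] := r01.
have self z : nrm z <= rho -> nrm (T z) <= rho.
  move=> zr; rewrite -[T z](subrK (T 0)); apply: le_trans (nrmD _ _) _.
  have := HT z 0 zr; rewrite nrm0 subr0 => /(_ rho0) H1.
  have := ler_wpM2l r0 zr; lra.
pose z := fix z n := if n is n'.+1 then T (z n') else 0.
have zr n : nrm (z n) <= rho by elim: n => [|n IH] /=; rewrite ?nrm0 ?self.
have dz n : nrm (z n.+1 - z n) <= nrm (T 0) * r ^+ n.
  elim: n => [|n IH]; first by rewrite /= subr0 expr0 mulr1.
  apply: le_trans (HT _ _ (zr n.+1) (zr n)) _.
  by rewrite exprS mulrCA ler_wpM2l.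
have [lr Hr] := @real_geometric_limit r (nrm (T 0)) (fun n => Re (z n)) r01
  (fun n => le_trans (eq_ind_r (fun t => `|t| <= _) (ler_Re _) (esym (ReB _ _))) (dz n)).
have [li Hi] := @real_geometric_limit r (nrm (T 0)) (fun n => Im (z n)) r01
  (fun n => le_trans (eq_ind_r (fun t => `|t| <= _) (ler_Im _) (esym (ImB _ _))) (dz n)).
pose l := lr +i* li; pose K := 2 * (nrm (T 0) / (1 - r)).
have Hl n : nrm (l - z n) <= K * r ^+ n.
  apply: le_trans (nrm_le_ReIm _) _; rewrite ReB ImB /=.
  by rewrite /K -mulrA mulr2n mulrDl !mul1r lerD.
have lrho : nrm l <= rho.
  rewrite -subr_le0; apply: (@geometric_le0 r K) => // n.
  rewrite lerBlDr; rewrite -[l](subrK (z n)); apply: le_trans (nrmD _ _) _.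
  exact: lerD.
exists l => //; apply/eqP; rewrite -subr_eq0 -nrm_eq0 eq_le nrm_ge0 andbT.
apply: (@geometric_le0 r (2 * K)) => // n.
have -> : T l - l = (T l - T (z n)) - (l - z n.+1) by rewrite /=; ring.
apply: le_trans (nrmB _ _) _.
have K0 : 0 <= K * r ^+ n := le_trans (nrm_ge0 _) (Hl n).
rewrite -mulrA mulr2n mulrDl !mul1r; apply: lerD.
  apply: le_trans (HT _ _ lrho (zr n)) _; apply: le_trans (Hl n).
  by rewrite ler_piMl ?nrm_ge0// ltW.
apply: le_trans (Hl n.+1) _; rewrite exprS mulrCA ler_piMl// ltW//.
Qed.

Lemma expR_le_inv (r : R) : r < 1 -> expR r <= (1 - r)^-1.
Proof.
move=> r1; rewrite -[r in expR r]opprK expRN lef_pV2 ?posrE ?expR_gt0 ?subr_gt0//.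
exact: expR_ge1Dx.
Qed.

Lemma ee_bounds (c : C) (x r : R) : 0 <= x <= 1 -> nrm c <= r -> r < 1 ->
  nrm (ee c x) <= (1 - r)^-1 /\
  nrm (ee c x - 1 - iC * c * x%:C) <= r ^+ 2 * (1 - r)^-1.
Proof.
move=> /andP[x0 x1] cr r1.
have n1 : nrm (iC * c * x%:C) <= r.
  rewrite nrmM nrmM nrm_i mul1r nrm_real ger0_norm//; apply: le_trans cr.
  by rewrite ler_piMr ?nrm_ge0.
have e1 : expR (nrm (iC * c * x%:C)) <= (1 - r)^-1.
  by apply: le_trans (expR_le_inv r1); rewrite ler_expR.
split; first exact: le_trans (nrm_cexp_le _) e1.
apply: le_trans (cexp_sub1_lin _) _.
by rewrite ler_pM ?sqr_ge0 ?expR_ge0// lerXn2r ?nnegrE ?nrm_ge0// (le_trans (nrm_ge0 _) n1).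
Qed.

(** Applied to opposite exponentials: their linear terms [w] and [- w] cancel in the mean, and only
    the quadratic errors [k] remain. *)
Lemma avg_bound (e1 e2 s1 s2 w : C) (E k S : R) :
  nrm e1 <= E -> nrm e2 <= E -> nrm (e1 - 1 - w) <= k -> nrm (e2 - 1 + w) <= k ->
  nrm (s1 - 1) <= S -> nrm (s2 - 1) <= S ->
  nrm ((e1 * s1 + e2 * s2) / 2 - 1) <= E * S + k.
Proof.
move=> h1 h2 h3 h4 h5 h6.
have -> : (e1 * s1 + e2 * s2) / 2 - 1 =
  (e1 * (s1 - 1) + e2 * (s2 - 1) + ((e1 - 1 - w) + (e2 - 1 + w))) / 2 by field.
rewrite nrmM nrmV nrm_two ler_pdivrMr//.
have H1 : nrm (e1 * (s1 - 1)) <= E * S by rewrite nrmM ler_pM ?nrm_ge0.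
have H2 : nrm (e2 * (s2 - 1)) <= E * S by rewrite nrmM ler_pM ?nrm_ge0.
have := nrmD (e1 * (s1 - 1) + e2 * (s2 - 1)) ((e1 - 1 - w) + (e2 - 1 + w)).
have := nrmD (e1 * (s1 - 1)) (e2 * (s2 - 1)).
have := nrmD (e1 - 1 - w) (e2 - 1 + w).
by lra.
Qed.

Lemma mul_sub1_le (s t : C) (S : R) : nrm (s - 1) <= S -> nrm (t - 1) <= S ->
  nrm (s * t - 1) <= 2 * S + S ^+ 2.
Proof.
move=> h1 h2; have -> : s * t - 1 = (s - 1) * (t - 1) + ((s - 1) + (t - 1)) by ring.
have := nrmD ((s - 1) * (t - 1)) ((s - 1) + (t - 1)).
have := nrmD (s - 1) (t - 1).
have : nrm ((s - 1) * (t - 1)) <= S * S by rewrite nrmM ler_pM ?nrm_ge0.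
by rewrite expr2; lra.
Qed.

End FixedPoint.

(** * Existence, uniqueness and location of the zero near an unperturbed eigenvalue *)

Section Zeros.
Context {R : realType}.
Notation C := R[i].
Notation Re := (@complex.Re R).
Notation Im := (@complex.Im R).
Notation nrm := (@Normc.normc R).
Variables (a b : R -> C) (p q : C -> R -> C).
Implicit Types (z : C) (x : R).

(** The half-width 2 exceeds pi/2, half the spacing of the o_n, so a whole period of the
    characteristic function is controlled; the disc of radius 1 is contained as well. *)
Definition region z := `|Re z| <= 2 /\ `|Im z| <= 1.

Hypothesis Hak : forall z, region z -> akns z a b (p z) (q z).
Hypothesis Hsm : forall z, region z -> forall x, 0 <= x <= 1 ->
  nrm (p z x - 1) <= 18^-1 /\ nrm (q z x - 1) <= 18^-1.

(** For a = b = 0 one has p = q = 1, and [char_fun], [norm_fun] and [pairing] become sin z, cos z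
    and the mean of cos((z'-z)x) over [0, 1]; [char_pairing] is then the subtraction formula of the
    sine. *)
Definition char_fun z : C := (ee z 1 * p z 1 - ee (- z) 1 * q z 1) / (2 * iC).
Definition norm_fun z : C := (ee z 1 * p z 1 + ee (- z) 1 * q z 1) / 2.
Definition pairing z z' : C := cint 0 1 (fun x =>
  ee (z' - z) x * (q z x * p z' x) + ee (z - z') x * (p z x * q z' x)) / 2.

Let I1 : 0 <= (1 : R) <= 1. Proof. by rewrite ler01 lexx. Qed.

Lemma iC_sqr : iC * iC = -1 :> C.
Proof. by apply: complex_ext; rewrite /=; ring. Qed.

Lemma iC_neq0 : iC != 0 :> C.
Proof. by rewrite -nrm_gt0 nrm_i ltr01. Qed.

Lemma two_neq0 : (2 : C) != 0.
Proof. by rewrite pnatr_eq0. Qed.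

Lemma small_region z : nrm z <= 1 -> region z.
Proof.
move=> z1; split; last exact: le_trans (ler_Im _) z1.
by apply: le_trans (ler_Re _) (le_trans z1 _); rewrite ler1n.
Qed.

Lemma char_pairing z z' : region z -> region z' ->
  char_fun z' * norm_fun z - char_fun z * norm_fun z' = (z' - z) * pairing z z'.
Proof.
move=> rz rz'; have [_ E] := akns_lagrange (Hak rz) (Hak rz').
have -> : char_fun z' * norm_fun z - char_fun z * norm_fun z' =
  (ee (z' - z) 1 * (q z 1 * p z' 1) - ee (z - z') 1 * (p z 1 * q z' 1)) / (2 * iC).
  rewrite /char_fun /norm_fun !eeD; field.
  by rewrite ?iC_neq0 ?two_neq0.
rewrite E /pairing; move: (cint _ _ _) => I; field.
by rewrite ?iC_neq0 ?two_neq0.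
Qed.

(** For |z'-z| <= 1/4 the exponentials are at most 4/3 and within 1/12 of their linear parts, and a
    product of two factors within 1/18 of 1 is within 37/324 of 1; and 4/3 * 37/324 + 1/12 =
    229/972. The constant 41/504 of [norm_fun_sub1] is 8/7 * 1/18 + 1/56 in the same way. *)
Lemma pairing_sub1 z z' : region z -> region z' -> nrm (z' - z) <= 4^-1 ->
  nrm (pairing z z' - 1) <= 229 / 972.
Proof.
move=> rz rz' dz; have [HS _] := akns_lagrange (Hak rz) (Hak rz').
have Hi := AC_L1 HS.
have -> : pairing z z' - 1 = cint 0 1 (fun x => 2^-1 * (ee (z' - z) x * (q z x * p z' x) +
    ee (z - z') x * (p z x * q z' x)) + (-1)).
  rewrite cintD//; [|exact: cL1Z|exact: cL1_cst].
  by rewrite cintZ// cint_cst// subr0 mulr1 /pairing mulrC.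
apply: (@le_trans _ _ (rint 0 1 (fun=> 229 / 972))); last first.
  by rewrite rint_cst// subr0 mulr1.
apply: cint_le => //; [by apply: cL1D; [exact: cL1Z|exact: cL1_cst]|exact: rL1_cst|].
move=> x xI; rewrite mulrC.
have [p1 q1] := Hsm rz xI; have [p2 q2] := Hsm rz' xI.
have r41 : 4^-1 < 1 :> R by lra.
have [e1 e2] := ee_bounds xI dz r41.
have dz' : nrm (z - z') <= 4^-1 by rewrite nrm_distC.
have [f1 f2] := ee_bounds xI dz' r41.
have f3 : nrm (ee (z - z') x - 1 + iC * (z' - z) * x%:C) <= 4^-1 ^+ 2 * (1 - 4^-1)^-1.
  by rewrite -(opprB z z') mulrN mulNr.
have s1 := mul_sub1_le q1 p2; have s2 := mul_sub1_le p1 q2.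
apply: le_trans (avg_bound e1 f1 e2 f3 s1 s2) _.
rewrite (_ : (1 - 4^-1)^-1 = 4 / 3); last by field.
by lra.
Qed.

Lemma norm_fun_sub1 z : nrm z <= 8^-1 -> nrm (norm_fun z - 1) <= 41 / 504.
Proof.
move=> z8; have rz : region z by apply: small_region; apply: le_trans z8 _; lra.
have [p1 q1] := Hsm rz I1; have r81 : 8^-1 < 1 :> R by lra.
have [e1 e2] := ee_bounds I1 z8 r81.
have z8' : nrm (- z) <= 8^-1 by rewrite nrmN.
have [f1 f2] := ee_bounds I1 z8' r81.
have f3 : nrm (ee (- z) 1 - 1 + iC * z * 1%:C) <= 8^-1 ^+ 2 * (1 - 8^-1)^-1.
  by move: f2; rewrite mulrN mulNr opprK.
apply: le_trans (avg_bound e1 f1 e2 f3 p1 q1) _.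
rewrite (_ : (1 - 8^-1)^-1 = 8 / 7); last by field.
by lra.
Qed.

Lemma nrm_ge_sub1 (c : C) (e : R) : nrm (c - 1) <= e -> 1 - e <= nrm c.
Proof.
move=> H; have := nrmB_ge 1 (1 - c); rewrite nrm1 (_ : 1 - (1 - c) = c); last by ring.
by rewrite nrm_distC; lra.
Qed.

Lemma norm_fun_neq0 z : nrm z <= 8^-1 -> norm_fun z != 0.
Proof.
by move=> /norm_fun_sub1/nrm_ge_sub1 H; rewrite -nrm_gt0; apply: lt_le_trans H; lra.
Qed.

Lemma Re_norm_fun_gt0 z : nrm z <= 8^-1 -> 0 < Re (norm_fun z).
Proof.
move=> /norm_fun_sub1 H; have := le_trans (ler_Re _) H; rewrite ReB /=.
by rewrite ler_norml => /andP[]; lra.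
Qed.

Let T z := z - char_fun z / norm_fun z.

(** [T] is Newton's map with F' replaced by G, just as sin' = cos. The identity [char_pairing] gives
    the difference of F/G exactly, so that no derivative has to be estimated. *)
Lemma T_contraction z z' : nrm z <= 8^-1 -> nrm z' <= 8^-1 ->
  nrm (T z - T z') <= 12 / 25 * nrm (z - z').
Proof.
move=> z8 z8'; have g0 := norm_fun_neq0 z8; have g0' := norm_fun_neq0 z8'.
have r1 : 8^-1 <= 1 :> R by lra.
have rz := small_region (le_trans z8 r1); have rz' := small_region (le_trans z8' r1).
have E := char_pairing rz rz'.
have -> : T z - T z' = (z - z') * ((norm_fun z * norm_fun z' - pairing z z') /
    (norm_fun z * norm_fun z')).
  have -> : (z - z') * ((norm_fun z * norm_fun z' - pairing z z') /
    (norm_fun z * norm_fun z')) = ((z - z') * (norm_fun z * norm_fun z') +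
     (z' - z) * pairing z z') / (norm_fun z * norm_fun z').
    by field; rewrite g0 g0'.
  by rewrite -E /T; field; rewrite g0 g0'.
rewrite nrmM mulrC ler_wpM2r ?nrm_ge0// nrmM nrmV.
have G1 := norm_fun_sub1 z8; have G1' := norm_fun_sub1 z8'.
have dz : nrm (z' - z) <= 4^-1.
  by have := nrmB z' z; have := z8; have := z8'; lra.
have Q1 := pairing_sub1 rz rz' dz.
have GG := mul_sub1_le G1 G1'.
have num : nrm (norm_fun z * norm_fun z' - pairing z z') <=
    2 * (41 / 504) + (41 / 504) ^+ 2 + 229 / 972.
  rewrite (_ : _ - _ = (norm_fun z * norm_fun z' - 1) - (pairing z z' - 1)); last by ring.
  by apply: le_trans (nrmB _ _) _; exact: lerD.
have den : (1 - 41 / 504) ^+ 2 <= nrm (norm_fun z * norm_fun z').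
  have h0 : 0 <= 1 - 41 / 504 :> R by lra.
  by rewrite nrmM expr2; exact: (ler_pM h0 h0 (nrm_ge_sub1 G1) (nrm_ge_sub1 G1')).
have dpos : 0 < nrm (norm_fun z * norm_fun z') by apply: lt_le_trans den; lra.
rewrite ler_pdivrMr//; apply: le_trans num _.
have k0 : 0 <= 12 / 25 :> R by lra.
apply: le_trans (ler_wpM2l k0 den); lra.
Qed.

Lemma char_zero_exists : exists2 z, nrm z <= 8^-1 & char_fun z = 0.
Proof.
have z8 : nrm 0 <= 8^-1 :> R by rewrite nrm0; lra.
(* |T 0| is at most (1/9) / (2 - 1/9) = 1/17, which is below (13/25)/8. *)
have T0 : nrm (T 0) <= (1 - 12 / 25) * 8^-1.
  have r0 : region 0 by apply: small_region; rewrite nrm0 ler01.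
  have [p1 q1] := Hsm r0 I1.
  rewrite /T sub0r nrmN /char_fun /norm_fun oppr0 /ee mulr0 mul0r cexp0 !mul1r.
  set P := p 0 1 in p1 *; set Q := q 0 1 in q1 *.
  have PQ : nrm (P - Q) <= 9^-1.
    rewrite (_ : P - Q = (P - 1) - (Q - 1)); last by ring.
    by apply: le_trans (nrmB _ _) _; lra.
  have PQ2 : 2 - 9^-1 <= nrm (P + Q).
    have H := nrmB_ge 2 ((1 - P) + (1 - Q)).
    rewrite (_ : 2 - _ = P + Q) in H; last by ring.
    have := nrmD (1 - P) (1 - Q); rewrite nrm_two in H.
    by rewrite !(nrm_distC 1); lra.
  have PQ0 : P + Q != 0 by rewrite -nrm_gt0; apply: lt_le_trans PQ2; lra.
  have -> : (P - Q) / (2 * iC) / ((P + Q) / 2) = (P - Q) / (iC * (P + Q)).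
    by field; rewrite ?PQ0 ?iC_neq0 ?two_neq0.
  rewrite nrmM nrmV nrmM nrm_i mul1r ler_pdivrMr; last by apply: lt_le_trans PQ2; lra.
  by apply: le_trans PQ _; lra.
have r01 : 0 <= (12 / 25 : R) < 1 by apply/andP; split; lra.
have rho0 : 0 <= 8^-1 :> R by lra.
have [z zr Tz] := contraction_fixed r01 rho0 T_contraction T0.
exists z => //; move/eqP: Tz; rewrite /T subr_eq addrC -subr_eq subrr eq_sym mulf_eq0.
by rewrite invr_eq0 (negbTE (norm_fun_neq0 zr)) orbF => /eqP.
Qed.

Lemma char_zero_unique z z' : nrm z <= 8^-1 -> nrm z' <= 8^-1 ->
  char_fun z = 0 -> char_fun z' = 0 -> z = z'.
Proof.
move=> z8 z8' F0 F0'; have := T_contraction z8 z8'.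
rewrite /T F0 F0' !mul0r !subr0 => H; apply/eqP.
rewrite -subr_eq0 -nrm_eq0 eq_le nrm_ge0 andbT; lra.
Qed.

Lemma sin_ge_mul_cos (t : R) : 0 <= t <= pi / 2 -> t * cos t <= sin t.
Proof.
move=> /andP[t0 t1]; have p0 := @pi_gt0 R.
move: t0; rewrite le_eqVlt => /predU1P[<-|t0]; first by rewrite mul0r sin0.
have [c cI] := @MVT R sin cos 0 t t0 (fun x _ => is_derive_sin x)
  (continuous_subspaceT (@continuous_sin R)).
rewrite sin0 !subr0 => ->; rewrite mulrC ler_wpM2r ?(ltW t0)//.
move: cI; rewrite in_itv/= => /andP[c0 ct].
apply: ltW; rewrite ltr_cos// in_itv/=; apply/andP; split; lra.
Qed.

(** At a zero e^{2iz} = q/p lies within 2/17 of 1. Its modulus gives |Im z| <= 1/15; its real part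
    makes cos(2 Re z) positive, which under |Re z| <= pi/2 rules out the neighbourhoods of +-pi; its
    imaginary part and t cos t <= sin t then give |Re z| <= 1/11. Finally 1/121 + 1/225 < 1/64. *)
Lemma char_zero_small z : `|Re z| <= pi / 2 -> `|Im z| <= 1 -> region z ->
  char_fun z = 0 -> nrm z <= 8^-1.
Proof.
move=> x1 y1 rz F0; have [p1 q1] := Hsm rz I1.
have en := ee_neq0 z 1.
have E : E2 z 1 * p z 1 = q z 1.
  move/eqP: F0; rewrite /char_fun mulf_eq0 invr_eq0 mulf_eq0 (negbTE iC_neq0).
  rewrite (negbTE two_neq0) !orbF subr_eq0 => /eqP H.
  by rewrite E2_ee -mulrA H eeN mulrA mulfV// mul1r.
have pn := nrm_ge_sub1 p1.
have Ee : nrm (E2 z 1 - 1) <= 2 / 17.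
  have pp : 0 < nrm (p z 1) by apply: lt_le_trans pn; lra.
  rewrite -(ler_pM2r pp) -nrmM mulrBl mul1r E.
  rewrite (_ : _ - _ = (q z 1 - 1) - (p z 1 - 1)); last by ring.
  by have := nrmB (q z 1 - 1) (p z 1 - 1); lra.
have [x [y zE]] : exists x y, z = x +i* y by case: (z) => x y; exists x, y.
rewrite zE /= in x1 y1 *.
have EE : E2 z 1 = (expR (- (2 * y)))%:C * (cos (2 * x) +i* sin (2 * x)).
  rewrite /E2 zE.
  have -> : iC * ((x +i* y) * 2) * 1%:C = (- (2 * y)) +i* (2 * x).
    by apply: complex_ext; rewrite /=; ring.
  by [].
have HR := le_trans (ler_Re _) Ee; have HI := le_trans (ler_Im _) Ee.
rewrite EE ReB ReM /= in HR; rewrite EE ImB ImM /= in HI.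
have NE := nrm_ge_sub1 Ee.
have NE' : nrm (E2 z 1) <= 1 + 2 / 17.
  by have := nrmD (E2 z 1 - 1) 1; rewrite subrK nrm1; lra.
have nE : nrm (E2 z 1) = expR (- (2 * y)).
  rewrite /E2 nrm_cexp zE; congr expR; rewrite /=; ring.
rewrite nE in NE NE'.
set e := expR (- (2 * y)) in HR HI NE NE'.
have e0 : 0 < e by exact: expR_gt0.
have y1' : `|y| <= 15^-1.
  have h1 : 1 + - (2 * y) <= e by exact: expR_ge1Dx.
  have h2 : 1 + 2 * y <= e^-1 by rewrite /e -expRN opprK; exact: expR_ge1Dx.
  have h3 : e^-1 <= 17 / 15.
    by rewrite -(ler_pM2l e0) mulfV ?gt_eqF//; lra.
  by rewrite ler_norml; apply/andP; split; lra.
move: HR HI; rewrite !mul0r !subr0 !addr0 !ler_norml => /andP[HR _] HI.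
have cosx : 15 / 19 <= cos (2 * x).
  have : 15 / 17 <= e * cos (2 * x) by lra.
  move=> h; rewrite leNgt; apply/negP => hc.
  have : e * cos (2 * x) < e * (15 / 19) by rewrite ltr_pM2l.
  by lra.
have sinx : `|sin (2 * x)| <= 2 / 15.
  rewrite -(ler_pM2l e0) -{1}(gtr0_norm e0) -normrM.
  have h : `|e * sin (2 * x)| <= 2 / 17 by rewrite ler_norml.
  by apply: le_trans h _; lra.
have x1' : `|x| <= 11^-1.
  set t := `|2 * x|.
  have ct : cos t = cos (2 * x) by rewrite cos_norm.
  have st : `|sin t| = `|sin (2 * x)|.
    by rewrite /t; case: (ger0P (2 * x)) => _; rewrite ?sinN ?normrN.
  have tx : t = 2 * `|x| by rewrite /t normrM ger0_norm.
  have t0 : 0 <= t by exact: normr_ge0.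
  have p0 := @pi_gt0 R.
  have t1 : t <= pi / 2.
    rewrite leNgt; apply/negP => h.
    have : cos t < cos (pi / 2) by rewrite ltr_cos// in_itv/=; apply/andP; split; lra.
    by rewrite cos_pihalf ct; lra.
  have h := sin_ge_mul_cos (t := t); rewrite t0 t1 in h; have {}h := h isT.
  have h2 : sin t <= 2 / 15 by apply: le_trans (ler_norm _) _; rewrite st.
  have h3 : t * (15 / 19) <= t * cos t by rewrite ler_wpM2l// ct.
  have := le_trans h3 (le_trans h h2); rewrite tx; lra.
have e80 : 0 <= 8^-1 :> R by lra.
rewrite -ler_sqr ?nnegrE ?nrm_ge0 ?e80//.
rewrite nrm_sqr /= -(real_normK (num_real x)) -(real_normK (num_real y)).
have h1 : `|x| ^+ 2 <= 11^-1 ^+ 2 by rewrite lerXn2r ?nnegrE ?normr_ge0//; lra.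
have h2 : `|y| ^+ 2 <= 15^-1 ^+ 2 by rewrite lerXn2r ?nnegrE ?normr_ge0//; lra.
by lra.
Qed.

End Zeros.

(** * Simplicity of the zeros *)

Section Derivative.
Context {R : realType}.
Notation C := R[i].
Notation nrm := (@Normc.normc R).

Lemma is_derive_quadratic (F : C -> C) (z w : C) (K dl : R) : 0 < dl ->
  (forall h, nrm h < dl -> nrm (F (z + h) - F z - h * w) <= K * nrm h ^+ 2) ->
  is_derive (z : C^o) (1 : C^o) (F : C^o -> C^o) (w : C^o).
Proof.
move=> dl0 H.
have lim : (fun h : C^o => h^-1 *: (((F : C^o -> C^o) \o shift (z : C^o)) (h *: (1 : C^o)) -
    (F : C^o -> C^o) z)) @ (0 : C^o)^' --> (w : C^o).
  apply/cvgrPdist_lt => e e0.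
  have [eR eE] : exists r, e = r%:C.
    by exists (complex.Re e); apply: complex_ext => //=; move: e0; rewrite ltcE /= => /andP[/eqP].
  have eR0 : 0 < eR by move: e0; rewrite eE ltcR.
  pose k := `|K| + 1; have k0 : 0 < k by rewrite ltr_wpDl.
  have m0 : 0 < Num.min dl (eR / k) by rewrite lt_min dl0 divr_gt0.
  near=> h.
  have h0 : h != 0 by near: h; exact: nbhs_dnbhs_neq.
  have hm : nrm h < Num.min dl (eR / k).
    rewrite -ltcR -norm_nrm; near: h; apply: dnbhs0_lt; by rewrite ltcR.
  move: hm; rewrite lt_min => /andP[hd he].
  rewrite eE norm_nrm ltcR nrm_distC /=.
  have -> : h^-1 *: (F (h *: (1 : C^o) + z) - F z) - w = h^-1 * (F (z + h) - F z - h * w).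
    rewrite /GRing.scale /= mulr1 [h + z]addrC [RHS]mulrBr mulKf//.
  rewrite nrmM nrmV mulrC ltr_pdivrMr ?nrm_gt0//.
  apply: le_lt_trans (H h hd) _.
  rewrite expr2 mulrA ltr_pM2r ?nrm_gt0//.
  apply: (@le_lt_trans _ _ (k * nrm h)).
    by rewrite ler_wpM2r ?nrm_ge0// /k (le_trans (ler_norm K))// lerDl.
  by rewrite mulrC -ltr_pdivlMr.
split; first by apply/cvg_ex; exists w.
exact: cvg_lim lim.
Unshelve. all: by end_near. Qed.

Variables (a b : R -> C) (p q : C -> R -> C).
Hypothesis Hak : forall z, region z -> akns z a b (p z) (q z).
Hypothesis Hsm : forall z, region z -> forall x, 0 <= x <= 1 ->
  nrm (p z x - 1) <= 18^-1 /\ nrm (q z x - 1) <= 18^-1.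

Lemma nrm_le_of_sub1 (c : C) : nrm (c - 1) <= 18^-1 -> nrm c <= 2.
Proof. by move=> H; have := nrmD (c - 1) 1; rewrite subrK nrm1; lra. Qed.

(** At a zero, [char_pairing] reads F(z + h) = h pairing(z, z + h) / G(z). The derivative is
    therefore pairing(z, z) / G(z), nonzero because the pairing is near 1, and the Lipschitz bound
    makes the error quadratic. *)
Lemma char_derivative z K : nrm z <= 8^-1 -> char_fun p q z = 0 -> 0 <= K ->
  (forall h, nrm h <= 8^-1 -> forall x, 0 <= x <= 1 ->
     nrm (p (z + h) x - p z x) <= K * nrm h /\ nrm (q (z + h) x - q z x) <= K * nrm h) ->
  exists2 w, w != 0 & exists K', forall h, nrm h <= 8^-1 ->
    nrm (char_fun p q (z + h) - h * w) <= K' * nrm h ^+ 2.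
Proof.
move=> z8 F0 K0 HK; have r1 : 8^-1 <= 1 :> R by lra.
have rz := small_region (le_trans z8 r1).
have g0 := norm_fun_neq0 Hsm z8.
have l0 : (0 : R) <= 0 by []. have l1 : (1 : R) <= 1 by [].
exists (pairing p q z z / norm_fun p q z).
  rewrite mulf_neq0 ?invr_eq0// -nrm_gt0.
  have := pairing_sub1 Hak Hsm rz rz; rewrite subrr nrm0 => /(_ _)/nrm_ge_sub1 H.
  by apply: lt_le_trans (H _); lra.
exists ((4 * K + 8) / nrm (norm_fun p q z)) => h h8.
have zh1 : nrm (z + h) <= 1 by have := nrmD z h; lra.
have rzh := small_region zh1.
have E := char_pairing Hak rz rzh; rewrite F0 mul0r subr0 [z + h - z]addrAC subrr add0r in E.
have -> : char_fun p q (z + h) = h * pairing p q z (z + h) / norm_fun p q z.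
  by rewrite -E mulfK.
have -> : h * pairing p q z (z + h) / norm_fun p q z - h * (pairing p q z z / norm_fun p q z) =
  h * (pairing p q z (z + h) - pairing p q z z) / norm_fun p q z by field.
rewrite nrmM nrmM nrmV.
rewrite [leRHS](_ : _ = nrm h * ((4 * K + 8) * nrm h) * (nrm (norm_fun p q z))^-1);
  last by ring.
rewrite ler_wpM2r ?invr_ge0 ?nrm_ge0// ler_wpM2l ?nrm_ge0//.
have [S1 _] := akns_lagrange (Hak rz) (Hak rzh).
have [S0 _] := akns_lagrange (Hak rz) (Hak rz).
have i1 := AC_L1 S1; have i0 := AC_L1 S0.
rewrite /pairing -mulrBl -cintB// nrmM nrmV nrm_two ler_pdivrMr//.
apply: (@le_trans _ _ (rint 0 1 (fun=> (4 * K + 8) * nrm h * 2))); last first.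
  by rewrite rint_cst// subr0 mulr1.
apply: cint_le => //; [exact: cL1B|exact: rL1_cst|move=> x xI].
have [p1 q1] := Hsm rz xI; have [dp dq] := HK h h8 x xI.
have p2 := nrm_le_of_sub1 p1; have q2 := nrm_le_of_sub1 q1.
have ebnd (c : C) : nrm c = nrm h -> nrm (ee c x) <= 2 /\ nrm (ee c x - 1) <= 2 * nrm h.
  move=> ch; have c8 : nrm c <= 8^-1 by rewrite ch.
  have r81 : 8^-1 < 1 :> R by lra.
  have [e1 _] := ee_bounds xI c8 r81.
  have E87 : (1 - 8^-1)^-1 = 8 / 7 :> R by field.
  split; first by apply: le_trans e1 _; rewrite E87; lra.
  apply: le_trans (cexp_sub1_le _) _.
  have /andP[x0 x1] := xI.
  have n1 : nrm (iC * c * x%:C) <= nrm h.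
    by rewrite nrmM nrmM nrm_i mul1r nrm_real ger0_norm// ch ler_piMr ?nrm_ge0.
  rewrite mulrC; apply: ler_pM => //; rewrite ?expR_ge0 ?nrm_ge0//.
  apply: (@le_trans _ _ (expR 8^-1)); first by rewrite ler_expR (le_trans n1).
  by apply: le_trans (expR_le_inv r81) _; rewrite E87; lra.
have half (c s t t' : C) : nrm c = nrm h -> nrm s <= 2 -> nrm t <= 2 ->
    nrm (t' - t) <= K * nrm h -> nrm (ee c x * (s * t') - s * t) <= (4 * K + 8) * nrm h.
  move=> ch s2 t2 tt; have [e1 e2] := ebnd c ch.
  have -> : ee c x * (s * t') - s * t = ee c x * s * (t' - t) + (ee c x - 1) * s * t by ring.
  apply: le_trans (nrmD _ _) _; rewrite nrmM nrmM nrmM nrmM.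
  have h1 := ler_pM (mulr_ge0 (nrm_ge0 _) (nrm_ge0 _)) (nrm_ge0 _)
    (ler_pM (nrm_ge0 _) (nrm_ge0 _) e1 s2) tt.
  have h2 := ler_pM (mulr_ge0 (nrm_ge0 _) (nrm_ge0 _)) (nrm_ge0 _)
    (ler_pM (nrm_ge0 _) (nrm_ge0 _) e2 s2) t2.
  apply: le_trans (lerD h1 h2) _.
  by rewrite le_eqVlt; apply/orP; left; apply/eqP; ring.
have E1 : z + h - z = h by ring.
have E2' : z - (z + h) = - h by ring.
have H1 := half h (q z x) (p z x) (p (z + h) x) erefl q2 p2 dp.
have H2 := half (- h) (p z x) (q z x) (q (z + h) x) (nrmN h) p2 q2 dq.
rewrite E1 E2' subrr.
have -> : ee 0 x = 1 by rewrite /ee mulr0 mul0r cexp0.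
rewrite (_ : _ - _ = (ee h x * (q z x * p (z + h) x) - q z x * p z x) +
  (ee (- h) x * (p z x * q (z + h) x) - p z x * q z x)); last by ring.
by apply: le_trans (nrmD _ _) _; lra.
Qed.

End Derivative.

(** * First-order expansion of eigenvalues and norming constants *)

Section Logarithm.
Context {R : realType}.
Notation C := R[i].
Notation Re := (@complex.Re R).
Notation Im := (@complex.Im R).
Notation nrm := (@Normc.normc R).

(** The lower bound is ln(1 + t) <= t applied to 1/(1 + s) = 1 - s/(1 + s). *)
Lemma ln1D_bound (s : R) : -1 < s -> `|ln (1 + s) - s| <= s ^+ 2 / (1 + s).
Proof.
move=> s1; have s0 : 0 < 1 + s by lra.
have H1 := le_ln1Dx s1.
have H2 : s - s ^+ 2 / (1 + s) <= ln (1 + s).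
  have : ln (1 + (- s / (1 + s))) <= - s / (1 + s).
    by apply: le_ln1Dx; rewrite ltr_pdivlMr//; lra.
  rewrite (_ : 1 + _ = (1 + s)^-1); last by field; rewrite gt_eqF.
  rewrite lnV ?posrE// => H.
  rewrite (_ : s - _ = s / (1 + s)); last by field; rewrite gt_eqF.
  by rewrite -lerN2 -mulNr.
have H3 : 0 <= s ^+ 2 / (1 + s) by rewrite divr_ge0 ?sqr_ge0// ltW.
by rewrite ler_norml; apply/andP; split; lra.
Qed.

Lemma sin_le_id (t : R) : 0 <= t -> sin t <= t.
Proof.
rewrite le_eqVlt => /predU1P[<-|t0]; first by rewrite sin0.
have [c _] := @MVT R sin cos 0 t t0 (fun x _ => is_derive_sin x)
  (continuous_subspaceT (@continuous_sin R)).
rewrite sin0 !subr0 => ->; rewrite -[leRHS]mul1r ler_wpM2r ?cos_le1//.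
exact: ltW.
Qed.

(** For t = acos c one has cos t = c and sin t = r, so that this is sin t <= t <= tan t. *)
Lemma acos_bound (c r : R) : 0 < c -> c ^+ 2 + r ^+ 2 = 1 -> 0 <= r ->
  r <= acos c <= r / c.
Proof.
move=> c0 cr r0; have c1 : -1 <= c <= 1.
  have r2 := sqr_ge0 r; apply/andP; split; nra.
have sE : sin (acos c) = r.
  rewrite sin_acos// (_ : 1 - c ^+ 2 = r ^+ 2); last lra.
  by rewrite sqrtr_sqr ger0_norm.
have cE : cos (acos c) = c by rewrite acosK.
have t0 := acos_ge0 c1; have tpi := acos_lepi c1.
rewrite -{1}sE sin_le_id//= ler_pdivlMr//.
have th : acos c <= pi / 2.
  rewrite leNgt; apply/negP => h.
  have p0 := @pi_gt0 R.
  have : cos (acos c) < cos (pi / 2) by rewrite ltr_cos// in_itv/=; apply/andP; split; lra.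
  by rewrite cos_pihalf cE ltNge ltW.
have := sin_ge_mul_cos (t := acos c); rewrite t0 th cE sE; exact.
Qed.

(** Real and imaginary parts are treated apart: 2 ln|1 + z| = ln(1 + s) with s = 2 Re z + |z|^2
    costs 5 |z|^2, and the arccosine in [Carg] costs 4/3 |z|^2. *)
Lemma Clog_bound (z : C) : nrm z <= 4^-1 ->
  nrm (Clog (1 + z) - z) <= 7 * nrm z ^+ 2.
Proof.
move=> z4; set n := nrm z in z4 *; have n0 : 0 <= n := nrm_ge0 _.
have [x [y zE]] : exists x y, z = x +i* y by case: (z) => x y; exists x, y.
have nE : n ^+ 2 = x ^+ 2 + y ^+ 2 by rewrite /n nrm_sqr zE.
have xn : `|x| <= n by rewrite /n zE; exact: (ler_Re (x +i* y)).
have yn : `|y| <= n by rewrite /n zE; exact: (ler_Im (x +i* y)).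
set rho := nrm (1 + z).
have rhoE : rho ^+ 2 = 1 + (2 * x + n ^+ 2).
  by rewrite /rho nrm_sqr ReD ImD zE /= nE; ring.
have rho0 : 0 <= rho := nrm_ge0 _.
have rhol : 1 - n <= rho by have := nrmB_ge 1 (- z); rewrite nrm1 nrmN opprK.
have rhou : rho <= 1 + n by have := nrmD 1 z; rewrite nrm1.
have rp : 0 < rho by lra.
set s := 2 * x + n ^+ 2 in rhoE.
have n2 : n ^+ 2 <= n * 4^-1 by rewrite expr2 ler_wpM2l.
have sn : `|s| <= 9 / 4 * n.
  have e1 : `|2 * x| = 2 * `|x| by rewrite normrM ger0_norm.
  have e2 : `|n ^+ 2| = n ^+ 2 by rewrite ger0_norm ?sqr_ge0.
  by have := ler_normD (2 * x) (n ^+ 2); rewrite e1 e2 -/s; lra.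
have s1 : 9 / 16 <= 1 + s.
  have r34 : 3 / 4 <= rho by lra.
  have q0 : 0 <= 3 / 4 :> R by lra.
  by have := ler_pM q0 q0 r34 r34; rewrite -rhoE expr2; lra.
have Hre : `|ln rho - x| <= 5 * n ^+ 2.
  have l2 : ln (1 + s) = 2 * ln rho by rewrite -rhoE lnXn// mulr_natl.
  have sm1 : -1 < s by lra.
  have := ln1D_bound sm1; rewrite l2 => H.
  have s2 : s ^+ 2 / (1 + s) <= 9 * n ^+ 2.
    rewrite ler_pdivrMr; last lra.
    have h1 : `|s| ^+ 2 <= (9 / 4 * n) ^+ 2.
      by rewrite lerXn2r ?nnegrE ?normr_ge0//; lra.
    rewrite real_normK ?num_real// in h1.
    have h2 : 9 * n ^+ 2 * (9 / 16) <= 9 * n ^+ 2 * (1 + s).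
      by rewrite ler_wpM2l// mulr_ge0 ?sqr_ge0.
    apply: le_trans h1 _; apply: le_trans _ h2; rewrite exprMn; lra.
  have := le_trans H s2; rewrite ler_norml => /andP[h1 h2].
  rewrite ler_norml; apply/andP; split; rewrite /s in h1 h2; lra.
have x1 : 3 / 4 <= 1 + x by move: xn; rewrite ler_norml => /andP[]; lra.
set c := (1 + x) / rho; set r := `|y| / rho.
have c0 : 0 < c by rewrite divr_gt0//; lra.
have r0 : 0 <= r by rewrite divr_ge0.
have cr : c ^+ 2 + r ^+ 2 = 1.
  rewrite /c /r !exprMn real_normK ?num_real// -mulrDl.
  rewrite (_ : (1 + x) ^+ 2 + y ^+ 2 = rho ^+ 2); last by rewrite rhoE /s nE; ring.
  by rewrite exprVn mulfV// expf_neq0// gt_eqF.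
have /andP[t1 t2] := acos_bound c0 cr r0.
have rc : r / c = `|y| / (1 + x).
  by rewrite /r /c; field; rewrite !gt_eqF//; lra.
have y0 : 0 <= `|y| by [].
have Him : `|acos c - `|y| | <= 4 / 3 * n ^+ 2.
  have yn2 : `|y| * n <= n * n by rewrite ler_wpM2r.
  have h1 : `|y| - acos c <= 4 / 3 * n ^+ 2.
    have : `|y| - `|y| / rho <= 4 / 3 * n ^+ 2.
      rewrite (_ : _ - _ = `|y| * (rho - 1) / rho); last by field; rewrite gt_eqF.
      rewrite ler_pdivrMr//.
      have : `|y| * (rho - 1) <= `|y| * n by rewrite ler_wpM2l//; lra.
      have : 4 / 3 * n ^+ 2 * (3 / 4) <= 4 / 3 * n ^+ 2 * rho.
        by rewrite ler_wpM2l//; [rewrite mulr_ge0 ?sqr_ge0//; lra|lra].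
      by rewrite expr2; lra.
    by rewrite -/r; lra.
  have h2 : acos c - `|y| <= 4 / 3 * n ^+ 2.
    rewrite rc in t2.
    have : `|y| / (1 + x) - `|y| <= 4 / 3 * n ^+ 2.
      rewrite (_ : _ - _ = `|y| * (- x) / (1 + x)); last by field; rewrite gt_eqF//; lra.
      rewrite ler_pdivrMr; last lra.
      have : `|y| * (- x) <= `|y| * n.
        by rewrite ler_wpM2l//; move: xn; rewrite ler_norml => /andP[]; lra.
      have : 4 / 3 * n ^+ 2 * (3 / 4) <= 4 / 3 * n ^+ 2 * (1 + x).
        by rewrite ler_wpM2l//; rewrite mulr_ge0 ?sqr_ge0//; lra.
      by rewrite expr2; lra.
    by lra.
  by rewrite ler_norml; apply/andP; split; lra.
apply: le_trans (nrm_le_ReIm _) _.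
rewrite ReB ImB /Clog /= -/rho zE /=.
have IE : Im (1 + (x +i* y)) = y by rewrite ImD /= add0r.
have RE : Re (1 + (x +i* y)) = 1 + x by rewrite ReD.
have -> : Carg (1 + (x +i* y)) = if 0 <= y then acos c else - acos c.
  by rewrite /Carg IE RE /c /rho zE.
have Him' : `|(if 0 <= y then acos c else - acos c) - y| <= 4 / 3 * n ^+ 2.
  move: Him; case: (ger0P y) => yy //.
  by rewrite -normrN opprD !opprK.
have := sqr_ge0 n; lra.
Qed.

End Logarithm.

Section EigenvalueError.
Context {R : realType}.
Notation C := R[i].
Notation nrm := (@Normc.normc R).

(** The expansions turn e^{2iz} p = q into e^{2iz} - 1 = B e^{2iz} - A + O(s). As |e^{2iz} - 1| >=
    4/3 |z| on the disc, this bounds z, and linearising then gives 2iz = B - A to first order. At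
    the zero g = e^{-iz} q, which to first order is 1 - iz + B = 1 + (A + B)/2. *)
Lemma zero_expansion (z A B SA SB rp rq p q : C) (w s : R) :
  nrm z <= 8^-1 -> p = 1 + SA + A * E2 (- z) 1 + rp ->
  q = 1 + SB + B * E2 z 1 + rq -> E2 z 1 * p = q ->
  nrm A + nrm B <= w -> nrm SA + nrm SB + nrm rp + nrm rq <= s ->
  let g := (ee z 1 * p + ee (- z) 1 * q) / 2 in
  [/\ nrm z <= 2 * (w + s),
      nrm (z - (B - A) / (2 * iC)) <= 14 * (w + s) ^+ 2 + 2 * s,
      nrm (g - 1) <= 4 * (w + s) &
      nrm (g - 1 - (A + B) / 2) <= 26 * (w + s) ^+ 2 + 4 * s].
Proof.
move=> z8 pE qE Epq ABw Ss g.
have I1 : 0 <= (1 : R) <= 1 by rewrite ler01 lexx.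
set r := nrm z in z8 *; have r0 : 0 <= r := nrm_ge0 _.
have An := nrm_ge0 A; have Bn := nrm_ge0 B.
have n1 := nrm_ge0 SA; have n2 := nrm_ge0 SB; have n3 := nrm_ge0 rp; have n4 := nrm_ge0 rq.
have r8 : r < 1 by lra.
have inv8 : (1 - r)^-1 <= 8 / 7.
  by rewrite (_ : 8 / 7 = (7 / 8)^-1) ?lef_pV2 ?posrE; [lra|lra|lra|field].
have [f1 f2] := ee_bounds I1 (lexx r) r8.
have zN : nrm (- z) <= r by rewrite nrmN.
have [g1 g2] := ee_bounds I1 zN r8.
have z2 : nrm (z * 2) <= 2 * r by rewrite nrmM nrm_two mulrC.
have r28 : 2 * r < 1 by lra.
have inv4 : (1 - 2 * r)^-1 <= 4 / 3.
  by rewrite (_ : 4 / 3 = (3 / 4)^-1) ?lef_pV2 ?posrE; [lra|lra|lra|field].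
have [h1 h2] := ee_bounds I1 z2 r28.
rewrite -/(E2 z 1) in h1 h2.
set E := E2 z 1 in h1 h2 qE Epq *; set e := ee z 1 in f1 f2 g *.
set e' := ee (- z) 1 in g1 g2 g *.
rewrite !mulr1 in f2 g2 h2.
have e0 : e != 0 := ee_neq0 _ _.
have Ee : E = e * e by rewrite /E E2_ee.
have e'E : e' = e^-1 by rewrite /e' eeN.
have EN : E2 (- z) 1 = E^-1 by rewrite E2N.
rewrite EN in pE.
have E0 : E != 0 by rewrite Ee mulf_neq0.
have rr : r ^+ 2 <= r * 8^-1 by rewrite expr2 ler_wpM2l.
have r20 : 0 <= r ^+ 2 by exact: sqr_ge0.
have Eb : nrm E <= 4 / 3 by exact: le_trans inv4.
have eb : nrm e <= 8 / 7 by exact: le_trans inv8.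
have e'b : nrm e' <= 8 / 7 by exact: le_trans inv8.
have h2' : nrm (E - 1 - iC * (z * 2)) <= 16 / 3 * r ^+ 2.
  apply: le_trans h2 _; rewrite exprMn.
  have := ler_wpM2l r20 inv4; lra.
have f2' : nrm (e - 1 - iC * z) <= 8 / 7 * r ^+ 2.
  by apply: le_trans f2 _; rewrite mulrC ler_wpM2r.
have g2' : nrm (e' - 1 + iC * z) <= 8 / 7 * r ^+ 2.
  rewrite -[iC * z]opprK -mulrN.
  by apply: le_trans g2 _; rewrite mulrC ler_wpM2r.
have iz : nrm (iC * z) = r by rewrite nrmM nrm_i mul1r.
have iz2 : nrm (iC * (z * 2)) = 2 * r by rewrite nrmM nrm_i mul1r nrmM nrm_two mulrC.
have E1 : nrm (E - 1) <= 8 / 3 * r.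
  by have := nrmD (E - 1 - iC * (z * 2)) (iC * (z * 2)); rewrite subrK iz2; clear -h2' rr; lra.
have E1' : 4 / 3 * r <= nrm (E - 1).
  have := nrmB_ge (iC * (z * 2)) (- (E - 1 - iC * (z * 2))).
  rewrite nrmN iz2 (_ : iC * (z * 2) - - _ = E - 1); last by ring.
  by clear -h2' rr; lra.
have e1 : nrm (e - 1) <= 8 / 7 * r.
  by have := nrmD (e - 1 - iC * z) (iC * z); rewrite subrK iz; clear -f2' rr; lra.
have e'1 : nrm (e' - 1) <= 8 / 7 * r.
  by have := nrmB (e' - 1 + iC * z) (iC * z); rewrite addrK iz; clear -g2' rr; lra.
have key : E - 1 = B * E - A + ((SB + rq) - E * (SA + rp)).
  move: Epq; rewrite pE qE => H.
  have : E * (1 + SA + A / E + rp) - (1 + SB + B * E + rq) = 0 by rewrite H subrr.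
  have -> : E * (1 + SA + A / E + rp) = E * (1 + SA + rp) + A by field.
  move=> H'; apply/eqP; rewrite -subr_eq0; apply/eqP/(eq_trans _ H'); ring.
have rem : nrm ((SB + rq) - E * (SA + rp)) <= 4 / 3 * s.
  have H1 := nrmB (SB + rq) (E * (SA + rp)).
  have H2 := nrmD SB rq; have H3 := nrmD SA rp.
  have H4 : nrm (E * (SA + rp)) <= 4 / 3 * (nrm SA + nrm rp).
    by rewrite nrmM ler_pM ?nrm_ge0.
  by clear -H1 H2 H4 Ss n2 n4; lra.
have BE : nrm (B * E) <= nrm B * (4 / 3) by rewrite nrmM ler_wpM2l.
have zws : r <= 2 * (w + s).
  have H1 := nrmD (B * E - A) ((SB + rq) - E * (SA + rp)).
  have H2 := nrmB (B * E) A; rewrite -key in H1.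
  by clear -H1 H2 E1' BE rem ABw An Bn Ss n1 n2 n3 n4; lra.
have s0 : 0 <= s by clear -Ss n1 n2 n3 n4; lra.
have w0 : 0 <= w by clear -ABw An Bn; lra.
have Aw : nrm A <= w by clear -ABw Bn; lra.
have Bw : nrm B <= w by clear -ABw An; lra.
have ws0 : 0 <= w + s := addr_ge0 w0 s0.
set ws := w + s in zws ws0 *.
have r2ws : r ^+ 2 <= 4 * ws ^+ 2.
  by rewrite expr2; apply: le_trans (ler_pM r0 r0 zws zws) _; rewrite -expr2 exprMn; clear; lra.
have wr : w * r <= 2 * ws ^+ 2.
  apply: le_trans (ler_wpM2l w0 zws) _; rewrite mulrCA expr2 ler_wpM2l// ler_wpM2r//.
  by rewrite /ws lerDl.
have zest : nrm (iC * z - (B - A) / 2) <= 14 * ws ^+ 2 + 2 * s.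
  have -> : iC * z - (B - A) / 2 = (- (E - 1 - iC * (z * 2)) +
     (B * (E - 1) + ((SB + rq) - E * (SA + rp)))) / 2.
    by rewrite {1}key; field.
  rewrite nrmM nrmV nrm_two ler_pdivrMr//.
  have H1 := nrmD (- (E - 1 - iC * (z * 2))) (B * (E - 1) + ((SB + rq) - E * (SA + rp))).
  have H2 := nrmD (B * (E - 1)) ((SB + rq) - E * (SA + rp)).
  have H3 : nrm (B * (E - 1)) <= w * (8 / 3 * r).
    by rewrite nrmM ler_pM ?nrm_ge0.
  by rewrite nrmN in H1; clear -H1 H2 H3 h2' rem wr r2ws r20 s0; lra.
have gE : g = e' * q.
  rewrite /g -Epq Ee e'E; field; rewrite e0; done.
have gE' : g = e' + e' * (SB + rq) + B * e.
  by rewrite gE qE Ee e'E; field.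
have e'S : nrm (e' * (SB + rq)) <= 8 / 7 * s.
  have H2 := nrmD SB rq.
  by rewrite nrmM ler_pM ?nrm_ge0//; clear -H2 Ss n1 n3; lra.
split=> //.
- have -> : z - (B - A) / (2 * iC) = (iC * z - (B - A) / 2) / iC.
    by field; rewrite ?iC_neq0 ?two_neq0.
  by rewrite nrmM nrmV nrm_i invr1 mulr1.
- have -> : g - 1 = (e' - 1) + (e' * (SB + rq) + B * e) by rewrite gE'; ring.
  have H1 := nrmD (e' - 1) (e' * (SB + rq) + B * e).
  have H2 := nrmD (e' * (SB + rq)) (B * e).
  have H3 : nrm (B * e) <= w * (8 / 7) by rewrite nrmM ler_pM ?nrm_ge0.
  by move: zws; rewrite /ws; clear -H1 H2 H3 e'1 e'S w0 s0; lra.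
- have -> : g - 1 - (A + B) / 2 = (e' - 1 + iC * z) - (iC * z - (B - A) / 2) +
     (e' * (SB + rq) + B * (e - 1)) by rewrite gE'; field.
  have H1 := nrmD ((e' - 1 + iC * z) - (iC * z - (B - A) / 2)) (e' * (SB + rq) + B * (e - 1)).
  have H2 := nrmB (e' - 1 + iC * z) (iC * z - (B - A) / 2).
  have H3 := nrmD (e' * (SB + rq)) (B * (e - 1)).
  have H4 : nrm (B * (e - 1)) <= w * (8 / 7 * r) by rewrite nrmM ler_pM ?nrm_ge0.
  by clear -H1 H2 H3 H4 zest g2' e'S wr r2ws r20 s0; lra.
Qed.

Definition first_size (a b : R -> C) : R := nrm (cint 0 1 a) + nrm (cint 0 1 b).
Definition first_mean (a b : R -> C) : R :=
  rint 0 1 (fun x => nrm (cint 0 x a)) + rint 0 1 (fun x => nrm (cint 0 x b)).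
Definition second_size (a b : R -> C) : R := nrm (second a b 1) + nrm (second b a 1).
Definition second_mean (a b : R -> C) (al be : R -> R) : R :=
  rint 0 1 (fun x => al x * nrm (second b a x)) +
  rint 0 1 (fun x => be x * nrm (second a b x)).
(** Free of [z]: the two first-order quantities are in l^2 over [n] and enter squared, while the two
    second-order ones are in l^d. *)
Definition error_size (a b : R -> C) (al be : R -> R) : R :=
  first_size a b ^+ 2 + first_mean a b ^+ 2 + second_size a b + second_mean a b al be.

Definition error_const (L : R) : R :=
  let k := 72 * expR (2 * L) in
  4 * (138 + 4 * k) * k ^+ 2 * (1 + 2 * (1 + L) ^+ 3) + 8 * k.

(** The bounds on [s] and [z] refer to each other. Using z <= 1 once gives a bound [t] of s without
    z, hence z <= 2(w + t), which is put back through z W <= (w + t)^2 + W^2. As S and Sg are only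
    in l^d, their squares are linearised by S, Sg <= b. The 138 is 26 + 7 * 4^2, from
    [zero_expansion] and [Clog_bound]. *)
Lemma error_algebra (k b w W S Sg s z : R) : 1 <= k -> 0 <= b -> 0 <= w -> 0 <= W ->
  0 <= S -> 0 <= Sg -> S <= b -> Sg <= b -> 0 <= s -> 0 <= z -> z <= 1 ->
  s <= S + k * (Sg + z * W) -> z <= 2 * (w + s) ->
  138 * (w + s) ^+ 2 + 4 * s <=
  (4 * (138 + 4 * k) * k ^+ 2 * (1 + b) + 8 * k) * (w ^+ 2 + W ^+ 2 + S + Sg).
Proof.
move=> k1 b0 w0 W0 S0 Sg0 Sb Sgb s0 z0 z1 Hs Hz.
have k0 : 0 <= k by lra.
set t := S + k * (Sg + W).
have st : s <= t.
  apply: le_trans Hs _; rewrite /t lerD2l ler_wpM2l// lerD2l ler_piMl//.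
have t0 : 0 <= t by exact: le_trans st.
have zt : z <= 2 * (w + t) by lra.
set X := (w + t) ^+ 2; have X0 : 0 <= X := sqr_ge0 _.
have sX : (w + s) ^+ 2 <= X by apply: lerXn2r; rewrite ?nnegrE ?lerD2l// addr_ge0.
have zW : z * W <= X + W ^+ 2.
  have h := ler_wpM2r W0 zt; have := sqr_ge0 (w + t - W).
  by rewrite /X; move: h; nra.
have s2 : s <= S + k * Sg + k * X + k * W ^+ 2.
  have h := ler_wpM2l k0 zW; rewrite mulrDr in h.
  by rewrite mulrDr in Hs; lra.
have X4 : X <= 4 * (w ^+ 2 + S ^+ 2 + k ^+ 2 * Sg ^+ 2 + k ^+ 2 * W ^+ 2).
  rewrite /X /t -!exprMn mulrDr; move: (k * Sg) (k * W) => x y.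
  have := sqr_ge0 (w - S); have := sqr_ge0 (w - x); have := sqr_ge0 (w - y).
  have := sqr_ge0 (S - x); have := sqr_ge0 (S - y); have := sqr_ge0 (x - y).
  by rewrite !expr2; lra.
have S2 : S ^+ 2 <= b * S by rewrite expr2 ler_wpM2r.
have Sg2 : Sg ^+ 2 <= b * Sg by rewrite expr2 ler_wpM2r.
have W2 : 0 <= W ^+ 2 := sqr_ge0 _. have w2 : 0 <= w ^+ 2 := sqr_ge0 _.
have k2 : 1 <= k ^+ 2 by rewrite exprn_ege1.
set T := w ^+ 2 + W ^+ 2 + S + Sg.
have X5 : X <= 4 * (k ^+ 2 * (1 + b) * T).
  apply: le_trans X4 _; rewrite ler_wpM2l//.
  have c1 : 1 <= k ^+ 2 * (1 + b).
    by rewrite -[leLHS]mulr1 ler_pM//; lra.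
  have c2 : b <= k ^+ 2 * (1 + b).
    by rewrite -[leLHS]mul1r ler_pM//; lra.
  have c3 : k ^+ 2 * b <= k ^+ 2 * (1 + b) by rewrite ler_wpM2l//; lra.
  have c4 : k ^+ 2 <= k ^+ 2 * (1 + b) by rewrite -[leLHS]mulr1 ler_wpM2l//; lra.
  set c := k ^+ 2 * (1 + b) in c1 c2 c3 c4 *.
  have d1 : w ^+ 2 <= c * w ^+ 2 by rewrite ler_peMl.
  have d2 : S ^+ 2 <= c * S by apply: le_trans S2 _; rewrite ler_wpM2r.
  have d3 : k ^+ 2 * Sg ^+ 2 <= c * Sg.
    have k20 : 0 <= k ^+ 2 by lra.
    apply: le_trans (ler_wpM2l k20 Sg2) _; rewrite mulrA ler_wpM2r//.
  have d4 : k ^+ 2 * W ^+ 2 <= c * W ^+ 2 by rewrite ler_wpM2r.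
  by rewrite /T !mulrDr; lra.
have rest : 4 * (S + k * Sg + k * W ^+ 2) <= 8 * k * T.
  have d1 : S <= k * S by rewrite ler_peMl.
  have d2 : 0 <= k * w ^+ 2 by rewrite mulr_ge0.
  have d3 : 0 <= k * S by rewrite mulr_ge0.
  have d4 : 0 <= k * Sg by rewrite mulr_ge0.
  have d5 : 0 <= k * W ^+ 2 by rewrite mulr_ge0.
  by rewrite /T -mulrA !mulrDr; lra.
have kk : 0 <= 138 + 4 * k by lra.
have h := ler_wpM2l kk X5.
rewrite [leRHS](_ : _ = (138 + 4 * k) * (4 * (k ^+ 2 * (1 + b) * T)) + 8 * k * T);
  last by ring.
by rewrite mulrDl in h; lra.
Qed.

Lemma rint_le_1D (al : R -> R) L : rL2 al -> rint 0 1 (fun x => al x ^+ 2) <= L ->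
  rint 0 1 al <= 1 + L.
Proof.
move=> al2 alL; have l0 : (0 : R) <= 0 by []. have l1 : (1 : R) <= 1 by [].
have := rint_L1_norm2 al2 l0 ler01 l1; rewrite subr0 sqrtr1 mul1r.
have := norm2_sqr 0 1 al; set n := norm2 0 1 al => nE.
by move=> /le_trans; apply; have := sqr_ge0 (n - 1); rewrite -nE in alL; nra.
Qed.

Lemma nrm_second_le (a b : R -> C) (al be : R -> R) (Lam : R) : cL2 a -> cL2 b ->
  rL2 al -> (forall x, nrm (a x) <= al x) -> (forall x, nrm (b x) <= be x) ->
  rL1 be -> rint 0 1 al <= Lam -> rint 0 1 be <= Lam -> 0 <= Lam ->
  forall x, 0 <= x <= 1 -> nrm (second a b x) <= Lam ^+ 2.
Proof.
move=> a2 b2 al2 aal bbe bei alL beL L0 x xI; have /andP[x0 x1] := xI.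
have ali := rL2_L1 al2; have bi := cL2_L1 b2.
apply: (@le_trans _ _ (rint 0 x (fun y => Lam * al y))).
  apply: cint_le => //; [exact: cL1_second (cL2_L1 a2) bi|exact: rL1Z|].
  move=> y /andP[y0 yx]; have y1 := le_trans yx x1.
  rewrite nrmM mulrC ler_pM ?nrm_ge0//.
  apply: (@le_trans _ _ (rint 0 y be)); first exact: cint_le.
  apply: le_trans beL; apply: rint_subset => // t _.
  exact: le_trans (nrm_ge0 _) (bbe t).
rewrite rintZ// expr2 ler_wpM2l//; apply: le_trans alL.
by apply: rint_subset => // t _; exact: le_trans (nrm_ge0 _) (aal t).
Qed.

Lemma add_le_double (x y c : R) : x <= c -> y <= c -> x + y <= 2 * c.
Proof. lra. Qed.

Lemma eigen_error (a b : R -> C) (al be : R -> R) L (z : C) p q : cL2 a -> cL2 b ->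
  rL2 al -> rL2 be ->
  (forall x, nrm (a x) <= al x) -> (forall x, nrm (b x) <= be x) ->
  0 < L -> 324 * rint 0 1 (fun x => al x ^+ 2) <= L ->
  324 * rint 0 1 (fun x => be x ^+ 2) <= L ->
  akns z a b p q -> nrm z <= 8^-1 -> E2 z 1 * p 1 = q 1 ->
  let g := (ee z 1 * p 1 + ee (- z) 1 * q 1) / 2 in
  nrm (g - 1) <= 4^-1 ->
  nrm (z - (cint 0 1 b - cint 0 1 a) / (2 * iC)) <= error_const L * error_size a b al be /\
  nrm (Clog g - (cint 0 1 a + cint 0 1 b) / 2) <= error_const L * error_size a b al be.
Proof.
move=> a2 b2 al2 be2 aal bbe L0 alL beL Hpq z8 Epq g g4.
have l0 : (0 : R) <= 0 by []. have l1 : (1 : R) <= 1 by [].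
have I1 : 0 <= (1 : R) <= 1 by rewrite ler01 lexx.
have al0 y : 0 <= al y := le_trans (nrm_ge0 _) (aal y).
have be0 y : 0 <= be y := le_trans (nrm_ge0 _) (bbe y).
have z1 : `|complex.Im z| <= 1 by apply: le_trans (ler_Im _) _; lra.
have [R1 R2] := akns_remainder a2 b2 al2 be2 aal bbe L0 alL beL z1 Hpq.
set rp := p 1 - _ in R1; set rq := q 1 - _ in R2.
set A := cint 0 1 a; set B := cint 0 1 b.
have pE : p 1 = 1 + second a b 1 + A * E2 (- z) 1 + rp.
  by rewrite /rp /approx -/A; ring.
have qE : q 1 = 1 + second b a 1 + B * E2 z 1 + rq.
  by rewrite /rq /approx -/B opprK; ring.
set s := nrm (second a b 1) + nrm (second b a 1) + nrm rp + nrm rq.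
have [Z1 Z2 Z3 Z4] := zero_expansion z8 pE qE Epq (lexx _) (lexx s).
rewrite -/(first_size a b) in Z1 Z2 Z3 Z4; rewrite -/g in Z3 Z4.
set w := first_size a b in Z1 Z2 Z3 Z4.
have pos f : (forall y, 0 <= f y) -> 0 <= rint 0 1 f by move=> f0; apply: rint_ge0.
have w0 : 0 <= w by rewrite addr_ge0 ?nrm_ge0.
have W0 : 0 <= first_mean a b by apply: addr_ge0; apply: pos => y; exact: nrm_ge0.
have S0 : 0 <= second_size a b by rewrite addr_ge0 ?nrm_ge0.
have Sg0 : 0 <= second_mean a b al be.
  by apply: addr_ge0; apply: pos => y; apply: mulr_ge0 (nrm_ge0 _).
set k := 72 * expR (2 * L).
have e1 : 1 <= expR (2 * L) by rewrite -expR0 ler_expR mulr_ge0// ltW.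
have k1 : 1 <= k by rewrite /k; lra.
have rb : remainder_bound a b al be z =
  9 * (second_mean a b al be + 2 * nrm z * first_mean a b) by [].
rewrite rb in R1 R2.
have s0 : 0 <= s by rewrite !addr_ge0 ?nrm_ge0.
(* Two remainders of at most 2 e^{2L} * 9 (Sg + 2 |z| W) each add up to 36 e^{2L} (Sg + 2 |z| W),
   rounded up to 72 e^{2L} (Sg + |z| W). *)
have sE : s <= second_size a b + k * (second_mean a b al be + nrm z * first_mean a b).
  rewrite /s -[leLHS]addrA lerD2l.
  apply: le_trans (lerD R1 R2) _.
  have gen (e S n W : R) : 0 <= e * S ->
      2 * e * (9 * (S + 2 * n * W)) + 2 * e * (9 * (S + 2 * n * W)) <=
      72 * e * (S + n * W).
    move=> h; rewrite [leRHS](_ : _ = 2 * e * (9 * (S + 2 * n * W)) +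
      2 * e * (9 * (S + 2 * n * W)) + 36 * (e * S)); last by ring.
    by rewrite lerDl mulr_ge0.
  exact: gen _ _ _ _ (mulr_ge0 (expR_ge0 (2 * L)) Sg0).
have c324 : 1 <= 324 :> R by rewrite ler1n.
have be1 : rint 0 1 be <= 1 + L.
  apply: rint_le_1D => //; apply: le_trans beL.
  by apply: ler_peMl => //; apply: pos => y; exact: sqr_ge0.
have al1 : rint 0 1 al <= 1 + L.
  apply: rint_le_1D => //; apply: le_trans alL.
  by apply: ler_peMl => //; apply: pos => y; exact: sqr_ge0.
have L1 : 0 <= 1 + L by lra.
have ali := rL2_L1 al2; have bei := rL2_L1 be2.
have [ai bi] := (cL2_L1 a2, cL2_L1 b2).
have N1 := nrm_second_le a2 b2 al2 aal bbe bei al1 be1 L1.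
have N2 := nrm_second_le b2 a2 be2 bbe aal ali be1 al1 L1.
have L23 : (1 + L) ^+ 2 <= (1 + L) ^+ 3.
  by rewrite [leRHS]exprS ler_peMl ?sqr_ge0//; lra.
have Sb : second_size a b <= 2 * (1 + L) ^+ 3.
  by apply: add_le_double; [apply: le_trans (N1 1 I1) L23|apply: le_trans (N2 1 I1) L23].
have half (f : R -> R) (G g' : R -> C) : rL1 f -> (forall y, 0 <= f y) ->
    rint 0 1 f <= 1 + L -> AC G g' ->
    (forall y, 0 <= y <= 1 -> nrm (G y) <= (1 + L) ^+ 2) ->
    rint 0 1 (fun y => f y * nrm (G y)) <= (1 + L) ^+ 3.
  move=> fi f0 fL HG GL.
  have i1 : rL1 (fun y => f y * nrm (G y)).
    apply: (rL1_mul_bounded (M := (1 + L) ^+ 2) fi (cmeas_nrm (AC_meas HG))).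
    by move=> y yI; rewrite ger0_norm ?nrm_ge0 ?GL.
  apply: (@le_trans _ _ (rint 0 1 (fun y => (1 + L) ^+ 2 * f y))).
    apply: rint_le => //; first exact: rL1Z.
    by move=> y yI; rewrite mulrC ler_wpM2r ?GL.
  by rewrite rintZ// [leRHS]exprSr ler_wpM2l ?sqr_ge0.
have Sgb : second_mean a b al be <= 2 * (1 + L) ^+ 3.
  have h1 := half al _ _ ali al0 al1 (AC_second bi ai) N2.
  have h2 := half be _ _ bei be0 be1 (AC_second ai bi) N1.
  exact: add_le_double h1 h2.
have b0 : 0 <= 2 * (1 + L) ^+ 3 by rewrite mulr_ge0// exprn_ge0.
have nz1 : nrm z <= 1 by lra.
have main := error_algebra k1 b0 w0 W0 S0 Sg0 Sb Sgb s0 (nrm_ge0 z) nz1 sE Z1.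
have ws2 : 0 <= (w + s) ^+ 2 := sqr_ge0 _.
split; first by apply: le_trans main; apply: le_trans Z2 _; lra.
have g4' : nrm (g - 1) <= 4^-1 by [].
have := Clog_bound g4'; rewrite addrCA subrr addr0 => HC.
apply: le_trans main.
have -> : Clog g - (A + B) / 2 = (Clog g - (g - 1)) + (g - 1 - (A + B) / 2) by ring.
apply: le_trans (nrmD _ _) _.
have sq : nrm (g - 1) ^+ 2 <= 16 * (w + s) ^+ 2.
  by rewrite expr2; apply: le_trans (ler_pM (nrm_ge0 _) (nrm_ge0 _) Z3 Z3) _; rewrite -expr2 exprMn; lra.
by lra.
Qed.

End EigenvalueError.

(** * Summation of the errors *)

Section ErrorSum.
Context {R : realType}.
Notation C := R[i].
Notation nrm := (@Normc.normc R).
Variables (d : R) (d1 : 1 < d).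

Let d0 : 0 < d. Proof. exact: lt_trans ltr01 d1. Qed.

(** A nonnegative sequence with sums at most 4L also has terms at most 4L, so [sum_powR_interp]
    applies with h = 1. *)
Lemma sum_square_powR (r : seq int) (x y : int -> R) (L : R) : 0 <= L -> uniq r ->
  (forall r, uniq r -> \sum_(n <- r) x n ^+ 2 <= L) ->
  (forall r, uniq r -> \sum_(n <- r) y n ^+ 2 <= L) ->
  \sum_(n <- r) ((x n + y n) ^+ 2) `^ d <= (4 * L) `^ d.
Proof.
move=> L0 ru Hx Hy.
have H s : uniq s -> \sum_(n <- s) (x n + y n) ^+ 2 <= 4 * L.
  move=> su; apply: (@le_trans _ _ (\sum_(n <- s) (2 * x n ^+ 2 + 2 * y n ^+ 2))).
    by apply: ler_sum => n _; have := sqr_ge0 (x n - y n); nra.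
  rewrite big_split/= -!mulr_sumr; have := Hx s su; have := Hy s su; lra.
have L4 : 0 <= 4 * L by rewrite mulr_ge0.
have := @sum_powR_interp _ d d1 _ r (fun n => (x n + y n) ^+ 2) 1 (4 * L)
  (fun n => sqr_ge0 _) ler01 L4.
rewrite (_ : 1 `^ _ = 1) ?mul1r ?powR1//; apply; last exact: H.
by move=> n; have := H [:: n] isT; rewrite big_seq1.
Qed.

Lemma norm2_mul_le (al be : R -> R) L : rint 0 1 (fun x => al x ^+ 2) <= L ->
  rint 0 1 (fun x => be x ^+ 2) <= L -> norm2 0 1 al * norm2 0 1 be <= L.
Proof.
rewrite -!norm2_sqr; move: (norm2 0 1 al) (norm2 0 1 be) => x y hx hy.
have := sqr_ge0 (x - y); nra.
Qed.

(** Cauchy-Schwarz moves the square inside the mean; Bessel's inequality for each upper limit x is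
    then integrated over x. *)
Lemma bessel_mean (a : int -> R -> C) al L (r : seq int) : bessel_family a al ->
  rint 0 1 (fun x => al x ^+ 2) <= L -> uniq r ->
  \sum_(n <- r) rint 0 1 (fun x => nrm (cint 0 x (a n))) ^+ 2 <= L.
Proof.
move=> [al2 al0 aL aal aB] alL ru.
have l0 : (0 : R) <= 0 by []. have l1 : (1 : R) <= 1 by [].
have P n := AC_primitive (cL2_L1 (aL n)).
have P2 n : rL2 (fun x => nrm (cint 0 x (a n))).
  have [M _ HM] := AC_bounded (P n).
  apply: (rL2_bounded (M := M) (cmeas_nrm (AC_meas (P n)))) => x xI.
  by rewrite ger0_norm ?nrm_ge0 ?HM.
apply: (@le_trans _ _ (\sum_(n <- r) rint 0 1 (fun x => nrm (cint 0 x (a n)) ^+ 2))).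
  apply: ler_sum => n _; rewrite -norm2_sqr.
  have := rint_L1_norm2 (P2 n) l0 ler01 l1; rewrite subr0 sqrtr1 mul1r => H.
  apply: lerXn2r => //; rewrite nnegrE ?norm2_ge0//.
  by apply: rint_ge0 => x _; exact: nrm_ge0.
have [j1 <-] := rint_sum r (fun n => (P2 n).2) l0 l1.
apply: (@le_trans _ _ (rint 0 1 (fun=> L))); last by rewrite rint_cst// subr0 mulr1.
apply: rint_le => //; first exact: rL1_cst.
move=> x /andP[x0 x1]; apply: le_trans (aB 0 x r l0 x1 ru) _.
by apply: le_trans alL; apply: rint_subset => //; [case: al2|move=> y _; exact: sqr_ge0].
Qed.

Definition error_total (L : R) : R :=
  4 * L + 4 * L + (tri_const d * L + tri_const d * L) +
  ((1 + L) * (tri_const d * L) + (1 + L) * (tri_const d * L)).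

Lemma error_sum (a b : int -> R -> C) al be L (r : seq int) : 0 <= L ->
  bessel_family a al -> bessel_family b be ->
  rint 0 1 (fun x => al x ^+ 2) <= L -> rint 0 1 (fun x => be x ^+ 2) <= L ->
  uniq r ->
  \sum_(n <- r) error_size (a n) (b n) al be `^ d <= error_total L `^ d.
Proof.
move=> L0 Fa Fb alL beL ru.
have l0 : (0 : R) <= 0 by []. have l1 : (1 : R) <= 1 by [].
have I1 : 0 <= (1 : R) <= 1 by rewrite ler01 lexx.
have [al2 al0 aL aal aB] := Fa; have [be2 be0 bL bbe bB] := Fb.
have ali := rL2_L1 al2; have bei := rL2_L1 be2.
have ab := norm2_mul_le alL beL; have ba := norm2_mul_le beL alL.
set k := tri_const d * L.
have t0 := tri_const_ge0 d1.
have k0 : 0 <= k by exact: mulr_ge0.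
have T1 s x : uniq s -> 0 <= x <= 1 -> \sum_(n <- s) nrm (second (a n) (b n) x) `^ d <= k `^ d.
  move=> su xI; apply: le_trans (tri_sum d1 Fa Fb su xI) _.
  rewrite ge0_ler_powR ?(ltW d0) ?nnegrE ?k0 ?(mulr_ge0 t0 (mulr_ge0 (norm2_ge0 _ _ _) (norm2_ge0 _ _ _)))//.
  by rewrite ler_wpM2l.
have T2 s x : uniq s -> 0 <= x <= 1 -> \sum_(n <- s) nrm (second (b n) (a n) x) `^ d <= k `^ d.
  move=> su xI; apply: le_trans (tri_sum d1 Fb Fa su xI) _.
  rewrite ge0_ler_powR ?(ltW d0) ?nnegrE ?k0 ?(mulr_ge0 t0 (mulr_ge0 (norm2_ge0 _ _ _) (norm2_ge0 _ _ _)))//.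
  by rewrite ler_wpM2l.
have L1 : 0 <= 1 + L by rewrite addr_ge0.
have al1 := rint_le_1D al2 alL; have be1 := rint_le_1D be2 beL.
have AS n := AC_second (cL2_L1 (aL n)) (cL2_L1 (bL n)).
have BS n := AC_second (cL2_L1 (bL n)) (cL2_L1 (aL n)).
have N1 n := nrm_second_le (aL n) (bL n) al2 (aal n) (bbe n) bei al1 be1 L1.
have N2 n := nrm_second_le (bL n) (aL n) be2 (bbe n) (aal n) ali be1 al1 L1.
have J (m : R -> R) (S : int -> R -> R) : rL1 m -> (forall x, 0 <= m x) ->
    rint 0 1 m <= 1 + L -> (forall n, rmeas (S n)) -> (forall n x, 0 <= S n x) ->
    (forall n x, 0 <= x <= 1 -> S n x <= (1 + L) ^+ 2) ->
    (forall x, 0 <= x <= 1 -> \sum_(n <- r) S n x `^ d <= k `^ d) ->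
    \sum_(n <- r) rint 0 1 (fun x => m x * S n x) `^ d <= ((1 + L) * k) `^ d.
  move=> mi m0 mL mS S0 SM SK.
  apply: le_trans (jensen_sum d1 mi m0 mS S0 SM SK k0) _.
  have i0 : 0 <= rint 0 1 m by apply: rint_ge0.
  rewrite ge0_ler_powR ?(ltW d0) ?nnegrE ?(mulr_ge0 i0 k0) ?(mulr_ge0 L1 k0)//.
  by rewrite ler_wpM2r.
have J1 := J al (fun n x => nrm (second (b n) (a n) x)) ali al0 al1
  (fun n => cmeas_nrm (AC_meas (BS n))) (fun _ _ => nrm_ge0 _) N2 (fun x => T2 r x ru).
have J2 := J be (fun n x => nrm (second (a n) (b n) x)) bei be0 be1
  (fun n => cmeas_nrm (AC_meas (AS n))) (fun _ _ => nrm_ge0 _) N1 (fun x => T1 r x ru).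
have F1 := @sum_square_powR r (fun n => nrm (cint 0 1 (a n))) (fun n => nrm (cint 0 1 (b n)))
  L L0 ru (fun s su => le_trans (aB 0 1 s l0 l1 su) alL)
  (fun s su => le_trans (bB 0 1 s l0 l1 su) beL).
have F2 := @sum_square_powR r (fun n => rint 0 1 (fun x => nrm (cint 0 x (a n))))
  (fun n => rint 0 1 (fun x => nrm (cint 0 x (b n)))) L L0 ru
  (fun s su => bessel_mean Fa alL su) (fun s su => bessel_mean Fb beL su).
have L4 : 0 <= 4 * L by rewrite mulr_ge0.
have rp (m : R -> R) (G : R -> C) : (forall x, 0 <= m x) ->
    0 <= rint 0 1 (fun x => m x * nrm (G x)).
  by move=> m0; apply: rint_ge0 => x _; rewrite mulr_ge0 ?nrm_ge0.
have M1 := minkowski_sum d1 (fun n => sqr_ge0 _) (fun n => sqr_ge0 _) L4 L4 F1 F2.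
have M2 := minkowski_sum d1 (fun n => nrm_ge0 _) (fun n => nrm_ge0 _) k0 k0
  (T1 r 1 ru I1) (T2 r 1 ru I1).
have M3 := minkowski_sum d1 (fun n => rp al (second (b n) (a n)) al0)
  (fun n => rp be (second (a n) (b n)) be0) (mulr_ge0 L1 k0) (mulr_ge0 L1 k0) J1 J2.
have M4 := minkowski_sum d1 (fun n => addr_ge0 (sqr_ge0 _) (sqr_ge0 _))
  (fun n => addr_ge0 (nrm_ge0 _) (nrm_ge0 _)) (addr_ge0 L4 L4) (addr_ge0 k0 k0) M1 M2.
have M5 := minkowski_sum d1
  (fun n => addr_ge0 (addr_ge0 (sqr_ge0 _) (sqr_ge0 _)) (addr_ge0 (nrm_ge0 _) (nrm_ge0 _)))
  (fun n => addr_ge0 (rp al (second (b n) (a n)) al0) (rp be (second (a n) (b n)) be0))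
  (addr_ge0 (addr_ge0 L4 L4) (addr_ge0 k0 k0))
  (addr_ge0 (mulr_ge0 L1 k0) (mulr_ge0 L1 k0)) M4 M3.
exact: M5.
Qed.

End ErrorSum.

(* Uniform Riemann-Lebesgue lemma: Bessel's inequality on a finite grid, and the
   1/2-Hoelder continuity of the primitives of L2 functions between grid points. *)
Section RiemannLebesgue.
Context {R : realType}.
Notation C := R[i].
Notation nrm := (@Normc.normc R).

Lemma bessel_tends0 (c : int -> R) (K e : R) : 0 < e ->
  (forall r, uniq r -> \sum_(n <- r) c n ^+ 2 <= K) ->
  exists N : nat, forall n : int, (N <= `|n|)%N -> `|c n| <= e.
Proof.
move=> e0 H.
suff half (f : nat -> int) : injective f ->
    exists N : nat, forall n, (N <= n)%N -> `|c (f n)| <= e.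
  have [N1 H1] := half Posz (fun x y (E : Posz x = Posz y) => let: erefl := E in erefl).
  have [N2 H2] := half (fun n => - Posz n) (fun x y E => let: erefl := oppr_inj E in erefl).
  exists (maxn N1 N2) => n; rewrite geq_max => /andP[n1 n2].
  case: n n1 n2 => n n1 n2; first exact: H1.
  by rewrite NegzE; apply: H2.
move=> finj.
have mono : nondecreasing_seq (series (fun n => c (f n) ^+ 2)).
  by apply: nondecreasing_series => n _ _; exact: sqr_ge0.
have bnd : has_ubound (range (series (fun n => c (f n) ^+ 2))).
  exists K => _ [n _ <-]; rewrite /series /= big_mkord.
  rewrite -(big_mkord xpredT (fun i => c (f i) ^+ 2)).
  rewrite -(big_map f xpredT (fun n => c n ^+ 2)); apply: H.
  by rewrite map_inj_uniq// iota_uniq.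
have cv : cvgn (series (fun n => c (f n) ^+ 2)).
  by apply: nondecreasing_is_cvgn.
have := cvg_series_cvg_0 cv => /cvgrPdist_lt /(_ (e ^+ 2)).
rewrite exprn_gt0// => /(_ isT)[N _ HN]; exists N => n Nn.
have := HN n Nn; rewrite /= sub0r normrN ger0_norm ?sqr_ge0// => h.
rewrite -ler_sqr ?nnegrE ?normr_ge0 ?(ltW e0)// real_normK ?num_real//.
exact: ltW.
Qed.

Lemma riemann_lebesgue (a : int -> R -> C) al e : bessel_family a al -> 0 < e ->
  exists N : nat, forall n : int, (N <= `|n|)%N ->
    forall x, 0 <= x <= 1 -> nrm (cint 0 x (a n)) <= e.
Proof.
move=> [al2 al0 aL aal aB] e0.
have l0 : (0 : R) <= 0 by [].
set K := rint 0 1 (fun x => al x ^+ 2).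
have K0 : 0 <= K by apply: rint_ge0 => x _; exact: sqr_ge0.
(* The grid is fine enough that a cell of length 1/m contributes at most sqrt(K/m) <= e/2. *)
pose m := (Num.truncn (K / (e / 2) ^+ 2)).+1.
have m0 : (0 : R) < m%:R by rewrite ltr0n.
have mn : (m%:R : R) != 0 by rewrite gt_eqF.
have Km : K / m%:R <= (e / 2) ^+ 2.
  have e2 : 0 < (e / 2) ^+ 2 by rewrite exprn_gt0// divr_gt0.
  rewrite ler_pdivrMr// mulrC -ler_pdivrMr//; apply: ltW.
  by rewrite /m truncnS_gt.
have e2 : 0 < e / 2 by rewrite divr_gt0.
have grid (j : nat) : exists N : nat, forall n : int, (N <= `|n|)%N ->
    (j <= m)%N -> nrm (cint 0 (j%:R / m%:R) (a n)) <= e / 2.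
  have [jm|jm] := leqP j m; last by exists 0%N.
  have t1 : j%:R / m%:R <= 1 :> R by rewrite ler_pdivrMr// mul1r ler_nat.
  have B r : uniq r -> \sum_(n <- r) nrm (cint 0 (j%:R / m%:R) (a n)) ^+ 2 <= K.
    move=> ru; apply: le_trans (aB 0 _ r l0 t1 ru) _; apply: rint_subset => //.
    - by case: al2.
    - by move=> x _; exact: sqr_ge0.
  have [N HN] := bessel_tends0 e2 B.
  by exists N => n Nn _; have := HN n Nn; rewrite ger0_norm ?nrm_ge0.
have [Nf HNf] := choice grid.
exists (\max_(j < m.+1) Nf j)%N => n Nn x /andP[x0 x1].
pose j := Num.truncn (x * m%:R).
have xm0 : 0 <= x * m%:R by rewrite mulr_ge0.
have jx : j%:R <= x * m%:R by rewrite truncn_le.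
have xj : x * m%:R < j.+1%:R by rewrite truncnS_gt.
have jm : (j <= m)%N.
  rewrite -(ler_nat R); apply: le_trans jx _.
  by rewrite -[leRHS]mul1r ler_wpM2r.
have jm' : (j < m.+1)%N by [].
have Nj : (Nf j <= `|n|)%N.
  by apply: leq_trans Nn; exact: (leq_bigmax (Ordinal jm')).
pose t : R := j%:R / m%:R.
have tx : t <= x by rewrite ler_pdivrMr.
have t0 : 0 <= t by rewrite divr_ge0.
have ai := cL2_L1 (aL n).
rewrite (cint_split (m := t) ai)//.
apply: le_trans (nrmD _ _) _.
rewrite [leRHS]splitr; apply: lerD; first exact: HNf.
apply: (@le_trans _ _ (rint t x al)); first by apply: cint_le => //; exact: rL2_L1.
apply: le_trans (rint_L1_norm2 al2 t0 tx x1) _.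
rewrite -ler_sqr ?nnegrE ?(ltW e2) ?(mulr_ge0 (sqrtr_ge0 _) (norm2_ge0 _ _ _))//.
rewrite exprMn sqr_sqrtr ?subr_ge0// norm2_sqr; apply: le_trans Km.
rewrite mulrC; apply: ler_pM.
- by apply: rint_ge0 => y _; exact: sqr_ge0.
- by rewrite subr_ge0.
- by apply: rint_subset => //; [case: al2|move=> y _; exact: sqr_ge0].
- rewrite lerBlDr /t -[X in X + _]div1r -mulrDl ler_pdivlMr//.
  by rewrite addrC -natr1 in xj *; exact: ltW.
Qed.

End RiemannLebesgue.

(** * Asymptotics for an abstract family of systems *)

Section Labelling.
Context {R : realType}.

(* Descending from large n: the n-th point lies below the (n+1)-st, which is
   known to sit in its disc, and above the point found in the n-th disc. *)
Lemma labelling_nonneg (mu o : int -> R) (N : nat) :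
  {homo mu : m n / m < n} -> (forall n, o (n + 1) = o n + pi) ->
  (forall n : int, (N <= `|n|)%N -> exists k, `|mu k - o n| <= 8^-1) ->
  (forall (n k : int), (N <= `|n|)%N -> `|mu k - o n| <= pi / 2 -> `|mu k - o n| <= 8^-1) ->
  (forall (n k l : int), (N <= `|n|)%N -> `|mu k - o n| <= 8^-1 -> `|mu l - o n| <= 8^-1 ->
     mu k = mu l) ->
  (exists K : nat, forall n : int, (K <= `|n|)%N -> `|mu n - o n| < 1) ->
  forall n : nat, (N <= n)%N -> `|mu n - o n| <= 8^-1.
Proof.
move=> mu_lt oS ex_zero near uniq_zero [K HK].
have p1 := @pihalf_ge1 R; have p2 := @pi_ge2 R.
have mu_le m n : m <= n -> mu m <= mu n.
  by rewrite le_eqVlt => /predU1P[->//|/mu_lt/ltW].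
have big n : (N <= n)%N -> (K <= n)%N -> `|mu n - o n| <= 8^-1.
  by move=> Nn Kn; apply: near => //; apply: le_trans p1; exact/ltW/HK.
have step n : (N <= n)%N -> `|mu n.+1 - o n.+1| <= 8^-1 -> `|mu n - o n| <= 8^-1.
  move=> Nn Hn1; have [k Hk] := ex_zero n%:Z Nn.
  have oE : o n.+1 = o n + pi by rewrite -oS; congr o; lia.
  have k_le : k <= n%:Z.
    rewrite leNgt; apply/negP => nk.
    have : mu n.+1 <= mu k by apply: mu_le; lia.
    by move: Hk Hn1; rewrite oE !ler_norml => /andP[? ?] /andP[? ?]; lra.
  have h1 := mu_le _ _ k_le.
  have h2 : mu n < mu n.+1 by apply: mu_lt; lia.
  (* If [mu n] is not near [o n], then, being squeezed between [mu k] and [mu n.+1], it lies within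
     pi/2 of [o n.+1]; uniqueness in that disc would give [mu n = mu n.+1]. *)
  have [c|c] := lerP `|mu n - o n| (pi / 2); first exact: near.
  have c' : `|mu n - o n.+1| <= 8^-1.
    apply: near; first exact: leqW.
    move: c Hk Hn1; rewrite oE !ler_norml ltNge ler_norml negb_and -!ltNge.
    by move=> /orP[|] ? /andP[? ?] /andP[? ?]; apply/andP; split; lra.
  by have := uniq_zero n.+1 n n.+1 (leqW Nn) c' Hn1 => E; move: h2; rewrite E ltxx.
have down j : forall n : nat, (N <= n)%N -> (K <= n + j)%N -> `|mu n - o n| <= 8^-1.
  elim: j => [|j IH] n Nn Kn; first by apply: big; rewrite ?addn0 in Kn *.
  by apply: step => //; apply: IH; [exact: leqW|lia].
by move=> n Nn; apply: (down K) => //; exact: leq_addl.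
Qed.

(** Negative indices reduce to nonnegative ones by the reflection that replaces [mu n] and [o n] by
    [- mu (- n)] and [- o (- n)]. *)
Lemma labelling (mu o : int -> R) (N : nat) :
  {homo mu : m n / m < n} -> (forall n, o (n + 1) = o n + pi) ->
  (forall n : int, (N <= `|n|)%N -> exists k, `|mu k - o n| <= 8^-1) ->
  (forall (n k : int), (N <= `|n|)%N -> `|mu k - o n| <= pi / 2 -> `|mu k - o n| <= 8^-1) ->
  (forall (n k l : int), (N <= `|n|)%N -> `|mu k - o n| <= 8^-1 -> `|mu l - o n| <= 8^-1 ->
     mu k = mu l) ->
  (exists K : nat, forall n : int, (K <= `|n|)%N -> `|mu n - o n| < 1) ->
  forall n : int, (N <= `|n|)%N -> `|mu n - o n| <= 8^-1.
Proof.
move=> mu_lt oS ex_zero near uniq_zero [K HK] n Nn.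
have [n0|n0] := leP 0 n.
  have -> : n = `|n|%N by lia.
  by apply: labelling_nonneg Nn => //; exists K.
have D (k m : int) : `|- mu (- k) - - o (- m)| = `|mu (- k) - o (- m)|.
  by rewrite -opprD normrN.
have := @labelling_nonneg (fun n => - mu (- n)) (fun n => - o (- n)) N _ _ _ _ _ _ `|n|%N Nn.
rewrite D (_ : - `|n|%N%:Z = n); last by lia.
apply.
- by move=> i j ij; rewrite ltrN2; apply: mu_lt; lia.
- by move=> i; rewrite (_ : - i = - (i + 1) + 1) ?oS; [ring|ring].
- move=> i; rewrite -abszN => /ex_zero[k Hk]; exists (- k).
  by rewrite D opprK.
- by move=> i k Ni; rewrite D; apply: near; rewrite abszN.
- move=> i k l Ni; rewrite !D => h1 h2.
  by congr (- _); apply: (uniq_zero (- i)) => //; rewrite abszN.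
- by exists K => i Ki; rewrite D; apply: HK; rewrite abszN.
Qed.

End Labelling.

(** * From the zeros of [char_fun] to eigenvalues and norming constants *)

Section Core.
Context {R : realType}.
Notation C := R[i].
Notation Re := (@complex.Re R).
Notation Im := (@complex.Im R).
Notation nrm := (@Normc.normc R).

Lemma norm_lt1 (z : C) : (`|z| < 1) = (nrm z < 1).
Proof. by rewrite norm_nrm -[1%R : C]/(1%R%:C) ltcR. Qed.

Lemma esum_le_of_sums (S : set int) (f : int -> R) (M : R) :
  (forall r, uniq r -> (forall n, n \in r -> S n) -> \sum_(n <- r) f n <= M) ->
  (\esum_(n in S) (f n)%:E <= M%:E)%E.
Proof.
move=> H; apply: ge_ereal_sup => _ [A [finA AS] <-].
rewrite fsbig_finite//= sumEFin lee_fin; apply: H; first exact: fset_uniq.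
by move=> n; rewrite in_fset_set// => /set_mem/AS.
Qed.

Variables (v : R -> 'cV[C]_2) (a b : int -> R -> C) (al be : R -> R) (L d : R) (N : nat).
Variables (o : int -> R) (sgn kap : int -> C) (F G : C -> C) (P Q : C -> R -> C).
Variable main : int -> 'cV[C]_2.
Hypotheses (d1 : 1 < d) (Fa : bessel_family a al) (Fb : bessel_family b be).
Hypotheses (L0 : 0 < L) (alL : 324 * rint 0 1 (fun x => al x ^+ 2) <= L)
  (beL : 324 * rint 0 1 (fun x => be x ^+ 2) <= L).
Hypothesis oS : forall n, o (n + 1) = o n + pi.
Hypothesis Hak : forall n z,
  akns z (a n) (b n) (P ((o n)%:C + z)) (Q ((o n)%:C + z)).
Hypothesis Hsm : forall n : int, (N <= `|n|)%N -> forall z, region z ->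
  forall x, 0 <= x <= 1 ->
  nrm (P ((o n)%:C + z) x - 1) <= 18^-1 /\ nrm (Q ((o n)%:C + z) x - 1) <= 18^-1.
Local Notation p n := (fun z => P ((o n)%:C + z)).
Local Notation q n := (fun z => Q ((o n)%:C + z)).
Hypothesis FE : forall n z, kap n * F ((o n)%:C + z) = char_fun (p n) (q n) z.
Hypothesis GE : forall n z, sgn n * G ((o n)%:C + z) = norm_fun (p n) (q n) z.
Hypotheses (kap1 : forall n, nrm (kap n) = 1) (sgn1 : forall n, nrm (sgn n) = 1).
Hypothesis main0 : forall n,
  main n 0 0 = (cint 0 1 (b n) - cint 0 1 (a n)) / (2 * iC).
Hypothesis main1 : forall n,
  main n 1 0 = - ((cint 0 1 (a n) + cint 0 1 (b n)) / 2).
Hypothesis main_real : real_potential v -> forall n, Im (main n 1 0) = 0.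

Let Hak' n z : region z -> akns z (a n) (b n) (p n z) (q n z).
Proof. by []. Qed.

Let kap0 n : kap n != 0.
Proof. by rewrite -nrm_gt0 kap1. Qed.

Let F0E n z : F ((o n)%:C + z) = 0 <-> char_fun (p n) (q n) z = 0.
Proof.
rewrite -FE; split=> [->|]; first by rewrite mulr0.
by move/eqP; rewrite mulf_eq0 (negPf (kap0 n)) => /eqP.
Qed.

Lemma zero_in_disc (n : int) : (N <= `|n|)%N ->
  exists2 z, nrm z <= 8^-1 & F ((o n)%:C + z) = 0.
Proof.
by move=> Nn; have [z z8 /F0E] := char_zero_exists (p := p n) (q := q n) (@Hak' n) (Hsm Nn); exists z.
Qed.

Lemma zero_near (n : int) z : (N <= `|n|)%N -> `|Re z| <= pi / 2 -> `|Im z| <= 1 ->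
  F ((o n)%:C + z) = 0 -> nrm z <= 8^-1.
Proof.
move=> Nn z1 z2 /F0E; apply: (char_zero_small (p := p n) (q := q n) (Hsm Nn)) => //.
by split => //; apply: le_trans z1 _; exact/ltW/pihalf_lt2.
Qed.

Lemma zero_near1 (n : int) z : (N <= `|n|)%N -> nrm z <= 1 ->
  F ((o n)%:C + z) = 0 -> nrm z <= 8^-1.
Proof.
move=> Nn z1; apply: zero_near => //; last exact: le_trans (ler_Im _) z1.
exact: le_trans (ler_Re _) (le_trans z1 (@pihalf_ge1 R)).
Qed.

Lemma zero_unique (n : int) z z' : (N <= `|n|)%N -> nrm z <= 8^-1 -> nrm z' <= 8^-1 ->
  F ((o n)%:C + z) = 0 -> F ((o n)%:C + z') = 0 -> z = z'.
Proof.
by move=> Nn z8 z8' /F0E Fz /F0E; exact: (char_zero_unique (p := p n) (q := q n) (@Hak' n) (Hsm Nn)).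
Qed.

Lemma zero_simple (n : int) z : (N <= `|n|)%N -> nrm z <= 8^-1 ->
  F ((o n)%:C + z) = 0 -> simple_zero F ((o n)%:C + z).
Proof.
move=> Nn z8 Fz; split=> //; have /F0E Cz := Fz.
have [al2 al0 aL aal _] := Fa; have [be2 be0 bL bbe _] := Fb.
have z1 : `|Im z| <= 1 by apply: le_trans (ler_Im _) _; lra.
have [K K0 HK] := akns_lipschitz (aL n) (bL n) al2 be2 (aal n) (bbe n) L0 alL beL z1 (Hak n z).
have [] := char_derivative (p := p n) (q := q n) (@Hak' n) (Hsm Nn) z8 Cz K0.
  move=> h h8 x xI; have E : h = z + h - z by rewrite addrC addKr.
  have zh : nrm (z + h) <= 1 by have := nrmD z h; lra.
  have := HK _ _ _ (Hak n (z + h)) (le_trans (ler_Im _) zh) _ x xI.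
  by rewrite -E; apply; lra.
move=> w w0 [K' HK']; exists ((kap n)^-1 * w); first by rewrite mulf_neq0 ?invr_eq0.
have e8 : 0 < 8^-1 :> R by rewrite invr_gt0.
apply: (is_derive_quadratic (K := K') e8) => h h8; rewrite Fz subr0 -addrA.
have -> : F ((o n)%:C + (z + h)) - h * ((kap n)^-1 * w) =
    (kap n)^-1 * (char_fun (p n) (q n) (z + h) - h * w).
  by rewrite -FE; field.
by rewrite nrmM nrmV kap1 invr1 mul1r; apply/HK'/ltW.
Qed.

Lemma sign_not_le0 (n : int) z : (N <= `|n|)%N -> nrm z <= 8^-1 ->
  ~~ (sgn n * G ((o n)%:C + z) <= 0).
Proof.
move=> Nn z8; rewrite GE; have := Re_norm_fun_gt0 (p := p n) (q := q n) (Hsm Nn) z8.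
by rewrite lecE => h; rewrite negb_and -ltNge h orbT.
Qed.

Lemma disc_data_core : disc_data_defined F G o sgn N.
Proof.
move=> n Nn; have [z z8 Fz] := zero_in_disc Nn.
exists ((o n)%:C + z); split.
- by rewrite addrC addKr norm_lt1; apply: le_lt_trans z8 _; lra.
- exact: zero_simple.
- move=> z'; rewrite norm_lt1 => z1 Fz'.
  have E : z' = (o n)%:C + (z' - (o n)%:C) by ring.
  rewrite E in Fz' *; congr (_ + _); apply: (zero_unique Nn) => //.
  exact: (zero_near1 Nn (ltW z1) Fz').
- exact: sign_not_le0.
Qed.

Let bound n := error_const L * error_size (a n) (b n) al be.

Lemma core_error (n : int) z : (N <= `|n|)%N -> nrm z <= 8^-1 ->
  F ((o n)%:C + z) = 0 ->
  nrm (z - main n 0 0) <= bound n /\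
  nrm (- Clog (sgn n * G ((o n)%:C + z)) - main n 1 0) <= bound n.
Proof.
move=> Nn z8 /F0E Cz.
have [al2 al0 aL aal _] := Fa; have [be2 be0 bL bbe _] := Fb.
have e1 : ee z 1 * P ((o n)%:C + z) 1 = ee (- z) 1 * Q ((o n)%:C + z) 1.
  move: Cz => /eqP; rewrite mulf_eq0 invr_eq0 mulf_eq0 (negPf two_neq0) (negPf iC_neq0).
  by rewrite /= orbF subr_eq0 => /eqP.
have E : E2 z 1 * P ((o n)%:C + z) 1 = Q ((o n)%:C + z) 1.
  by rewrite E2_ee -mulrA e1 mulrA eeN mulfV ?ee_neq0// mul1r.
have g4 : nrm (norm_fun (p n) (q n) z - 1) <= 4^-1.
  by apply: le_trans (norm_fun_sub1 (p := p n) (q := q n) (Hsm Nn) z8) _; lra.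
have [H1 H2] := eigen_error (aL n) (bL n) al2 be2 (aal n) (bbe n) L0 alL beL
  (Hak n z) z8 E g4.
rewrite main0 main1 GE; split=> //.
by rewrite -opprD nrmN.
Qed.

(** Disc data yield the zero near o_n directly. For real data [labelling] identifies the n-th
    eigenvalue with that zero; the norming constant is then the real part of [- Clog], and as the
    main term is real, passing to real parts does not increase the error. *)
Lemma ev_error (ev nc : int -> C) : spectral_data v F G o sgn N ev nc ->
  forall n : int, (N <= `|n|)%N ->
    nrm (ev n - (o n)%:C - main n 0 0) <= bound n /\ nrm (nc n - main n 1 0) <= bound n.
Proof.
move=> [[vr [mu [muF mu_lt muo] evE]]|D] n Nn; last first.
  have [] := D n Nn; rewrite norm_lt1 => e1 Fe ->.
  have E : ev n = (o n)%:C + (ev n - (o n)%:C) by ring.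
  have Fe' := Fe; rewrite E in Fe'.
  have := core_error Nn (zero_near1 Nn (ltW e1) Fe') Fe'.
  by rewrite -E.
have [-> ->] := evE n.
have muE k m : (mu k)%:C = (o m)%:C + (mu k - o m)%:C :> C.
  by apply: complex_ext; rewrite /=; ring.
have Fmu k m : F ((o m)%:C + (mu k - o m)%:C) = 0.
  by rewrite -muE; apply/muF; exists k.
have small : `|mu n - o n| <= 8^-1.
  apply: (@labelling _ mu o N) => //.
  - move=> m Nm; have [z z8 Fz] := zero_in_disc Nm.
    have [k zk] := (muF _).1 Fz.
    exists k; move: z8; rewrite (_ : z = (mu k - o m)%:C) ?nrm_real//.
    by apply: (addrI (o m)%:C); rewrite zk -muE.
  - move=> m k Nm H; have := zero_near (z := (mu k - o m)%:C) Nm _ _ (Fmu k m).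
    by rewrite nrm_real/= normr0; apply.
  - move=> m k l Nm Hk Hl; have := zero_unique Nm _ _ (Fmu k m) (Fmu l m).
    by rewrite !nrm_real => /(_ Hk Hl)/(congr1 Re)/= /addIr.
  - exact: muo.
have s8 : nrm (mu n - o n)%:C <= 8^-1 by rewrite nrm_real.
have [H1 H2] := core_error Nn s8 (Fmu n n).
rewrite -muE in H2; split; first by rewrite (muE n n) [X in nrm (X - _)](_ : _ = (mu n - o n)%:C)//; ring.
apply: le_trans H2; apply: le_trans _ (ler_Re _).
have -> : main n 1 0 = (Re (main n 1 0))%:C.
  by apply: complex_ext => //=; rewrite main_real.
rewrite -[X in nrm X](_ : (- ln (nrm (G (mu n)%:C)) - Re (main n 1 0))%:C = _); last first.
  by apply: complex_ext; rewrite /=; ring.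
by rewrite nrm_real ReB ReN /Clog nrmM sgn1 mul1r.
Qed.

Lemma asymptotics_core :
  asymptotics d N (2 * (error_const L * error_total d L) `^ d) v F G o sgn main.
Proof.
split; first exact: disc_data_core.
move=> ev nc H; apply: esum_le_of_sums => r ru rN.
have d0 : 0 <= d := ltW (lt_trans ltr01 d1).
have L0' := ltW L0.
have c0 : 0 <= error_const L.
  rewrite /error_const.
  have e0 : 0 <= expR (2 * L) := expR_ge0 _.
  have h : 0 <= (1 + L) ^+ 3 by rewrite exprn_ge0//; lra.
  have k0 : 0 <= 72 * expR (2 * L) by rewrite mulr_ge0.
  set k := 72 * _ in k0 *; set w := _ ^+ 3 in h *.
  apply: addr_ge0; last by lra.
  by apply: mulr_ge0; [apply: mulr_ge0 (sqr_ge0 _)|]; lra.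
have e0 n : 0 <= error_size (a n) (b n) al be.
  have [_ al0 _ _ _] := Fa; have [_ be0 _ _ _] := Fb.
  apply: addr_ge0; first (apply: addr_ge0; first by rewrite addr_ge0 ?sqr_ge0).
    by rewrite addr_ge0 ?nrm_ge0.
  by apply: addr_ge0; apply: rint_ge0 => x _; apply: mulr_ge0 (nrm_ge0 _).
have t0 : 0 <= error_total d L.
  rewrite /error_total.
  have := tri_const_ge0 d1; set T := tri_const d => T0.
  have TL := mulr_ge0 T0 L0'.
  have : 0 <= (1 + L) * (T * L) by apply: mulr_ge0 => //; lra.
  by lra.
(* The factor 2 counts the two components, each of which has the same bound. *)
apply: (@le_trans _ _ (\sum_(n <- r) 2 * (error_const L `^ d * error_size (a n) (b n) al be `^ d))).
  rewrite big_seq [leRHS]big_seq; apply: ler_sum => n /rN Nn.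
  have [H1 H2] := ev_error H Nn.
  rewrite big_ord_recl big_ord1 -powRM// mulr_natl mulr2n.
  apply: lerD; apply: ge0_ler_powR; rewrite ?nnegrE ?nrm_ge0 ?mulr_ge0//.
    by move: H1; rewrite !mxE /=.
  by move: H2; rewrite !mxE /= (_ : lift ord0 ord0 = 1)//; exact: val_inj.
rewrite -[leLHS]mulr_sumr ler_pM2l// -[leLHS]mulr_sumr powRM// ler_wpM2l ?powR_ge0//.
by apply: error_sum => //; move: L0 alL beL; lra.
Qed.

End Core.

(** * The Dirac system *)

Section Potentials.
Context {R : realType}.
Notation C := R[i].
Notation Re := (@complex.Re R).
Notation Im := (@complex.Im R).
Notation nrm := (@Normc.normc R).
Notation leb := (@lebesgue_measure R).
Implicit Types (w v : R -> 'cV[C]_2).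

Lemma ae_of_open (P : R -> Prop) :
  {ae leb, forall x, x \in `]0, 1[ -> P x} ->
  {ae leb, forall x, x \in `[0, 1] -> (x \in `]0, 1[) /\ P x}.
Proof.
move=> H.
have H0 (c : R) : {ae leb, forall x, x != c}.
  exists [set c]; split; [exact: measurable_set1|exact: lebesgue_measure_set1|].
  by move=> x /= /negP; rewrite negbK => /eqP.
apply: (@filterS3 _ _ (ae_filter_ringOfSetsType leb) _ _ _ _ _ H (H0 0) (H0 1)) => x Hx x0 x1 xI.
have x01 : x \in `]0, 1[.
  by move: xI; rewrite !in_itv/= !le_eqVlt ![0 == _]eq_sym (negPf x0) (negPf x1).
by split=> //; exact: Hx.
Qed.

(** Measurability is known on the open interval only, so the values at the end points are set to 0;
    equations that hold almost everywhere do not notice. *)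
Definition trunc (j : 'I_2) w (x : R) : C := if x \in `]0, 1[ then w x j 0 else 0.

Lemma L2_trunc (f : R -> R) : L2 f ->
  rL2 (fun x => if x \in `]0, 1[ then f x else 0).
Proof.
move=> f2; have -> : (fun x => if x \in `]0, 1[ then f x else 0) = f \_ `]0, 1[.
  by apply/funext => x; rewrite patchE mem_setE.
split.
  by have /set_mem mf := sub_Lfun_mfun f2; apply: measurable_funS mf.
by apply: (integrableS measurableT _ _ (Lfun2_integrable_sqr f2)).
Qed.

Lemma trunc_L2 j w : inHC w -> cL2 (trunc j w).
Proof.
move=> /(_ j)[/L2_trunc[m1 i1] /L2_trunc[m2 i2]].
have E1 x : Re (trunc j w x) = if x \in `]0, 1[ then Re (w x j 0) else 0.
  by rewrite /trunc; case: ifP.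
have E2 x : Im (trunc j w x) = if x \in `]0, 1[ then Im (w x j 0) else 0.
  by rewrite /trunc; case: ifP.
split; first by split; [apply: rmeas_eq m1|apply: rmeas_eq m2] => x _; rewrite ?E1 ?E2.
by apply: rL1_eq (rL1D i1 i2) => x _; rewrite nrm_sqr E1 E2.
Qed.

(* The coupling coefficients of the system satisfied by [f_1 + i f_2] and
   [f_1 - i f_2]. *)
Definition coupling_up w x : C := - iC * (trunc 0 w x + iC * trunc 1 w x).
Definition coupling_dn w x : C := iC * (trunc 0 w x - iC * trunc 1 w x).

Lemma coupling_L2 w : inHC w -> cL2 (coupling_up w) /\ cL2 (coupling_dn w).
Proof.
move=> H; have [t0 t1] := (trunc_L2 0 H, trunc_L2 1 H).
split; apply: cL2Z; apply: cL2D => //; first exact: cL2Z.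
by apply: cL2_eq (cL2Z (- iC) t1) => x _; rewrite mulNr.
Qed.

Lemma inHC_complexify (u : R -> 'cV[R]_2) : inH u -> inHC (complexify u).
Proof.
move=> Hu i; split.
  by rewrite (_ : (fun x => _) = (fun x => u x i 0))//; apply/funext => x; rewrite mxE.
rewrite (_ : (fun x => _) = (fun x => 0)); last by apply/funext => x; rewrite mxE.
have p1 : (1 <= 2%:E :> \bar R)%E by rewrite lee_fin ler1n.
rewrite /L2 (_ : _ \_ _ = 0); first exact: (Lfun_addr_closed leb p1).1.
by apply/funext => x; rewrite patchE; case: ifP.
Qed.

Lemma couplingB w v x :
  coupling_up (fun y => w y - v y) x = coupling_up w x - coupling_up v x /\
  coupling_dn (fun y => w y - v y) x = coupling_dn w x - coupling_dn v x.
Proof.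
rewrite /coupling_up /coupling_dn /trunc !mxE.
by case: ifP => _; split; rewrite ?mulr0 ?subr0 ?addr0 ?mulr0 ?subr0//; ring.
Qed.

(** From |s +- i t|^2 <= 2 (|s|^2 + |t|^2); this 2 is the origin of the sqrt(2) in the smallness
    condition on the ball. *)
Lemma coupling_norm w : cL2 (trunc 0 w) -> cL2 (trunc 1 w) ->
  cL2 (coupling_up w) -> cL2 (coupling_dn w) ->
  rint 0 1 (fun x => nrm (coupling_up w x) ^+ 2) <= 2 * normHC w ^+ 2 /\
  rint 0 1 (fun x => nrm (coupling_dn w x) ^+ 2) <= 2 * normHC w ^+ 2.
Proof.
move=> [_ t0] [_ t1] [_ c1] [_ c2].
have l0 : (0 : R) <= 0 by []. have l1 : (1 : R) <= 1 by [].
have i2 := rL1D t0 t1.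
have -> : normHC w ^+ 2 =
    rint 0 1 (fun x => nrm (trunc 0 w x) ^+ 2 + nrm (trunc 1 w x) ^+ 2).
  rewrite sqr_sqrtr; last by apply: Rintegral_ge0 => x _; rewrite addr_ge0 ?sqr_ge0.
  rewrite -open_rint//; apply: eq_Rintegral => x; rewrite inE/= => xI.
  by rewrite /trunc xI.
rewrite -rintZ//; split; apply: rint_le => //; try exact: rL1Z.
  move=> x _; rewrite /coupling_up nrmM nrmN nrm_i mul1r !nrm_sqr !ReD !ImD !ReM !ImM/=.
  move: (Re (trunc 0 w x)) (Im (trunc 0 w x)) (Re (trunc 1 w x)) (Im (trunc 1 w x)) => p q r s.
  by rewrite !mul0r !mul1r; have := sqr_ge0 (p + s); have := sqr_ge0 (q - r); lra.
move=> x _; rewrite /coupling_dn nrmM nrm_i mul1r !nrm_sqr !ReB !ImB !ReM !ImM/=.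
move: (Re (trunc 0 w x)) (Im (trunc 0 w x)) (Re (trunc 1 w x)) (Im (trunc 1 w x)) => p q r s.
by rewrite !mul0r !mul1r; have := sqr_ge0 (p - s); have := sqr_ge0 (q + r); lra.
Qed.

End Potentials.

(** * An index beyond which the solutions are nearly constant, uniformly on the ball *)

Section UniformIndex.
Context {R : realType}.
Notation C := R[i].
Notation Re := (@complex.Re R).
Notation Im := (@complex.Im R).
Notation nrm := (@Normc.normc R).
Implicit Types (f g : R -> C) (u : R -> 'cV[R]_2) (v : R -> 'cV[C]_2).

Lemma wave_family (w : int -> R) f : separated w -> cL2 f ->
  bessel_family (fun n x => wave (w n) x * f x) (fun x => nrm (f x)).
Proof.
move=> sw f2; split; first exact: cL2_nrm.
- by move=> x; exact: nrm_ge0.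
- by move=> n; apply: cL2_mulAC f2 (AC_wave _).
- by move=> n x; rewrite nrmM nrm_wave mul1r.
- by move=> s t r s0 t1 ru; exact: bessel.
Qed.

Lemma ball_bound u (v : R -> 'cV[C]_2) : ballHC u (4 ^- 4 * expR (- 3 * normH u)) v ->
  normHC (fun x => v x - complexify u x) ^+ 2 <= 256^-1 ^+ 2.
Proof.
move=> [_ H].
have h0 : 0 <= normHC (fun x => v x - complexify u x) by exact: sqrtr_ge0.
have h : normHC (fun x => v x - complexify u x) <= 256^-1.
  apply: le_trans (ltW H) _.
  have e1 : expR (- 3 * normH u) <= 1.
    by rewrite -expR0 ler_expR mulNr oppr_le0 mulr_ge0// sqrtr_ge0.
  have -> : 4 ^- 4 = 256^-1 :> R by congr (_^-1); rewrite -natrX.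
  by apply: ler_piMr; [rewrite invr_ge0 ler0n|exact: e1].
have p256 : 0 <= 256^-1 :> R by rewrite invr_ge0 ler0n.
exact: (lerXn2r 2 h0 p256 h).
Qed.

Lemma close_bound f g : cL2 f -> cL2 g ->
  rint 0 1 (fun x => nrm (f x - g x) ^+ 2) <= 2 * 256^-1 ^+ 2 ->
  rint 0 1 (fun x => nrm (f x) ^+ 2) <= 2 * rint 0 1 (fun x => nrm (g x) ^+ 2) + 1.
Proof.
move=> f2 g2 H; have l0 : (0 : R) <= 0 by []. have l1 : (1 : R) <= 1 by [].
have h2 : cL2 (fun x => f x - g x).
  by apply: cL2_eq (cL2D f2 (cL2Z (-1) g2)) => x _; rewrite mulN1r.
apply: (@le_trans _ _ (rint 0 1 (fun x => 2 * nrm (g x) ^+ 2 + 2 * nrm (f x - g x) ^+ 2))).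
  apply: rint_le => //; [by case: f2|by apply: rL1D; apply: rL1Z; [case: g2|case: h2]|].
  move=> x _; have : nrm (f x) <= nrm (g x) + nrm (f x - g x).
    by apply: le_trans (nrmD _ _); rewrite addrC subrK.
  move: (nrm_ge0 (f x)) (nrm_ge0 (g x)) (nrm_ge0 (f x - g x)).
  move: (nrm (f x)) (nrm (g x)) (nrm (f x - g x)) => X Y Z X0 Y0 Z0 XYZ.
  apply: (@le_trans _ _ ((Y + Z) ^+ 2)); first by rewrite lerXn2r ?nnegrE ?addr_ge0.
  by have := sqr_ge0 (Y - Z); lra.
rewrite rintD ?rintZ//; [|by case: h2|by case: g2|by apply: rL1Z; case: g2|by apply: rL1Z; case: h2].
by move: H; lra.
Qed.

(** sqrt(2)/256 <= 1/180, and 9/180 is the 1/20 required by [akns_small]. *)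
Lemma close_L1 f g : cL2 f -> cL2 g ->
  rint 0 1 (fun x => nrm (f x - g x) ^+ 2) <= 2 * 256^-1 ^+ 2 ->
  9 * rint 0 1 (fun x => nrm (f x - g x)) <= 20^-1.
Proof.
move=> f2 g2 H; have l0 : (0 : R) <= 0 by []. have l1 : (1 : R) <= 1 by [].
have h2 : cL2 (fun x => f x - g x).
  by apply: cL2_eq (cL2D f2 (cL2Z (-1) g2)) => x _; rewrite mulN1r.
have := rint_L1_norm2 (cL2_nrm h2) l0 ler01 l1; rewrite subr0 sqrtr1 mul1r.
rewrite -norm2_sqr in H; set X := norm2 _ _ _ in H *.
have X0 : 0 <= X := norm2_ge0 _ _ _.
have X1 : X <= 180^-1.
  rewrite -ler_sqr ?nnegrE ?invr_ge0 ?ler0n//; apply: le_trans H _.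
  by rewrite expr2; lra.
by lra.
Qed.

(** [N] comes from the Riemann-Lebesgue lemma for the couplings [fu] and [gu] of the centre alone;
    for any other potential the differences f - fu and g - gu are the parts small in L^1. *)
Lemma uniform_index (o : int -> R) (fu gu : R -> C) L : 0 < L ->
  separated (fun n => - (2 * o n)) -> separated (fun n => 2 * o n) ->
  cL2 fu -> cL2 gu ->
  exists N : nat, forall f g, cL2 f -> cL2 g ->
    324 * rint 0 1 (fun x => nrm (f x) ^+ 2) <= L ->
    324 * rint 0 1 (fun x => nrm (g x) ^+ 2) <= L ->
    rint 0 1 (fun x => nrm (f x - fu x) ^+ 2) <= 2 * 256^-1 ^+ 2 ->
    rint 0 1 (fun x => nrm (g x - gu x) ^+ 2) <= 2 * 256^-1 ^+ 2 ->
    forall n : int, (N <= `|n|)%N -> forall z p q, region z ->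
    akns z (fun x => wave (- (2 * o n)) x * f x) (fun x => wave (2 * o n) x * g x) p q ->
    forall x, 0 <= x <= 1 -> nrm (p x - 1) <= 18^-1 /\ nrm (q x - 1) <= 18^-1.
Proof.
move=> L0 s1 s2 fu2 gu2.
(* In [K], 3 bounds |z| on the region and 1 + L the L^1 norms of the couplings; primitives of size
   1/(1000 G K) then meet the threshold 1/1000 of [akns_small]. *)
set G := 2 * expR (2 * L); set K := 9 + 18 * 3 + (1 + L).
have G0 : 0 < G by rewrite mulr_gt0 ?expR_gt0.
have K0 : 0 < K by rewrite /K; lra.
have c0 : 0 < 1000 :> R by rewrite ltr0n.
have e0 : 0 < (1000 * (G * K))^-1.
  by rewrite invr_gt0; exact: (mulr_gt0 c0 (mulr_gt0 G0 K0)).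
have [N1 H1] := riemann_lebesgue (wave_family s1 fu2) e0.
have [N2 H2] := riemann_lebesgue (wave_family s2 gu2) e0.
exists (maxn N1 N2) => f g f2 g2 fL gL fD gD n; rewrite geq_max => /andP[n1 n2] z p q.
move=> [z1 z2] Hpq.
have sub (h k : R -> C) : cL2 h -> cL2 k -> cL2 (fun x => h x - k x).
  by move=> h2 k2; apply: cL2_eq (cL2D h2 (cL2Z (-1) k2)) => x _; rewrite mulN1r.
have wL (w : R) (h : R -> C) : cL2 h -> cL2 (fun x => wave w x * h x).
  by move=> h2; apply: cL2_mulAC h2 (AC_wave _).
have wn (w : R) (h : R -> C) x : nrm (wave w x * h x) = nrm (h x).
  by rewrite nrmM nrm_wave mul1r.
have wle (w : R) (h : R -> C) x : nrm (wave w x * h x) <= nrm (h x) by rewrite wn.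
have l324 (X : R) : 324 * X <= L -> X <= L by move: L0; lra.
have bnd (w : R) (h : R -> C) : cL2 h -> 324 * rint 0 1 (fun x => nrm (h x) ^+ 2) <= L ->
    rint 0 1 (fun x => nrm (wave w x * h x)) <= 1 + L.
  move=> h2 /l324 hL; under eq_fun do rewrite wn.
  exact: rint_le_1D (cL2_nrm h2) hL.
have zz : nrm z <= 3 by apply: le_trans (nrm_le_ReIm z) _; move: z1 z2; lra.
have Hb := akns_bound (cL2_nrm f2) (cL2_nrm g2) (wle _ f) (wle _ g) L0 fL gL z2 Hpq.
apply: (akns_small (wL _ _ f2) (wL _ _ g2) (wL (- (2 * o n)) _ (sub _ _ f2 fu2))
  (wL (2 * o n) _ (sub _ _ g2 gu2))
  (rL2_L1 (cL2_nrm (sub _ _ f2 fu2))) (rL2_L1 (cL2_nrm (sub _ _ g2 gu2)))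
  (wle _ _) (wle _ _) z2 zz Hpq (w := (1000 * (G * K))^-1) (G := G) (nb := 1 + L)).
- by move=> x /Hb[].
- by move=> x /Hb[].
- move=> x xI; rewrite (_ : cint 0 x _ = cint 0 x (fun y => wave (- (2 * o n)) y * fu y)).
    exact: H1.
  by apply: eq_cint => y _; ring.
- move=> x xI; rewrite (_ : cint 0 x _ = cint 0 x (fun y => wave (2 * o n) y * gu y)).
    exact: H2.
  by apply: eq_cint => y _; ring.
- exact: bnd.
- exact: bnd.
- exact: close_L1.
- exact: close_L1.
- rewrite -/K -mulrA invfM -mulrA mulVf ?mulr1// mulf_neq0// gt_eqF//.
Qed.

End UniformIndex.

(** * Reduction of the Dirac equation to the ZS-AKNS system *)

Section Dirac.
Context {R : realType}.
Notation C := R[i].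
Notation Re := (@complex.Re R).
Notation Im := (@complex.Im R).
Notation nrm := (@Normc.normc R).
Notation leb := (@lebesgue_measure R).
Implicit Types (v : R -> 'cV[C]_2).

Lemma AC_ae_eq (F f g : R -> C) : AC F f -> cmeas g ->
  {ae leb, forall x, x \in `[0, 1] -> f x = g x} -> AC F g.
Proof.
move=> [fi Ff] mg fg; split; first exact: cL1_ae_eq fg.
move=> x xI; rewrite (Ff x xI); congr (_ + _).
by apply: cint_ae_eq => //; case/andP: xI.
Qed.

Lemma sum_I2 (f : 'I_2 -> C) : \sum_i f i = f 0 + f 1.
Proof. by rewrite big_ord_recl big_ord1; congr (_ + f _); exact: val_inj. Qed.

Lemma dirac_components v lam f : dirac_solution v lam f ->
  exists f1 f2, [/\ AC (fun x => f x 0 0) f1, AC (fun x => f x 1 0) f2 &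
    {ae leb, forall x, x \in `[0, 1] ->
      f2 x + (v x 0 0 * f x 0 0 + v x 1 0 * f x 1 0) = lam * f x 0 0 /\
      - f1 x + (v x 1 0 * f x 0 0 - v x 0 0 * f x 1 0) = lam * f x 1 0}].
Proof.
move=> [f' [f'i fE feq]].
exists (fun x => f' x 0 0), (fun x => f' x 1 0).
have H i : AC (fun x => f x i 0) (fun x => f' x i 0).
  split; first exact: f'i i.
  move=> x xI; rewrite fE; last by rewrite in_itv.
  by rewrite !mxE; rewrite cintE.
split=> //; apply: (@filterS _ _ (ae_filter_ringOfSetsType leb)) feq => x H' xI.
have := H' xI => /matrixP E; split.
  by have := E 0 0; rewrite !mxE !sum_I2 !mxE/= mul0r mul1r add0r.
by have := E 1 0; rewrite !mxE !sum_I2 !mxE/= mul0r mulN1r addr0 mulNr.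
Qed.

Lemma wave_ee (w : R) x : wave w x = ee (w%:C) x.
Proof. by []. Qed.

Lemma cmeas_coupling v : inHC v -> cmeas (coupling_up v) /\ cmeas (coupling_dn v).
Proof. by move=> /coupling_L2[[m1 _] [m2 _]]. Qed.

(** [g1] and [g2] stand for the derivatives of [f0] and [f1]. The combinations f0 +- i f1
    diagonalise J, and the terms in [lam] on the left come from the factors e^{-+i lam x}. *)
Lemma coupling_algebra (i lam f0 f1 g1 g2 v0 v1 : C) : i * i = -1 ->
  g2 + (v0 * f0 + v1 * f1) = lam * f0 -> - g1 + (v1 * f0 - v0 * f1) = lam * f1 ->
  i * - lam * (f0 + i * f1) + (g1 + i * g2) = - i * (v0 + i * v1) * (f0 - i * f1) /\
  i * lam * (f0 - i * f1) + (g1 - i * g2) = i * (v0 - i * v1) * (f0 + i * f1).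
Proof.
move=> ii E1 E2.
have -> : g2 = lam * f0 - (v0 * f0 + v1 * f1) by rewrite -E1; ring.
have -> : g1 = v1 * f0 - v0 * f1 - lam * f1 by rewrite -E2; ring.
by split; ring: ii.
Qed.

Lemma wave_shift_up (o : R) lam z x : lam = o%:C + z ->
  wave (- (2 * o)) x * E2 (- z) x * ee lam x = ee (- lam) x.
Proof.
move=> lamE; rewrite wave_ee E2_ee -!eeD.
have -> : (- (2 * o))%:C + (- z - z) + lam = - lam.
  by rewrite lamE; apply: complex_ext; rewrite !(ReD, ReN, ImD, ImN)/=; ring.
by [].
Qed.

Lemma wave_shift_dn (o : R) lam z x : lam = o%:C + z ->
  wave (2 * o) x * E2 z x * ee (- lam) x = ee lam x.
Proof.
move=> lamE; rewrite wave_ee E2_ee -!eeD.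
have -> : (2 * o)%:C + (z + z) - lam = lam.
  by rewrite lamE; apply: complex_ext; rewrite !(ReD, ReN, ImD, ImN)/=; ring.
by [].
Qed.

(** The equation holds only almost everywhere, so [AC_ae_eq] exchanges the derivative from the
    product rule for that of the system. The waves in the coefficients absorb [o], so that [p] and
    [q] depend on [lam] and not on its splitting as o + z. *)
Lemma dirac_akns v lam f (p0 sg : C) (o : R) z : inHC v -> dirac_solution v lam f ->
  p0 != 0 -> sg * sg = 1 -> f 0 0 0 + iC * f 0 1 0 = p0 ->
  f 0 0 0 - iC * f 0 1 0 = sg * p0 -> lam = o%:C + z ->
  akns z (fun x => wave (- (2 * o)) x * (sg * coupling_up v x))
    (fun x => wave (2 * o) x * (sg * coupling_dn v x))
    (fun x => p0^-1 * (ee (- lam) x * (f x 0 0 + iC * f x 1 0)))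
    (fun x => sg * p0^-1 * (ee lam x * (f x 0 0 - iC * f x 1 0))).
Proof.
move=> Hv Hf p00 sg2 fp fm lamE.
have [f1 [f2 [A1 A2 feq]]] := dirac_components Hf.
have [mu md] := cmeas_coupling Hv.
have Ap := AC_Z p0^-1 (AC_M (AC_ee (- lam)) (AC_D A1 (AC_Z iC A2))).
have Aq := AC_Z (sg * p0^-1) (AC_M (AC_ee lam) (AC_B A1 (AC_Z iC A2))).
have mw w := AC_meas (AC_wave (R := R) w).
have mE w := AC_meas (AC_E2 (R := R) w).
have ae1 : {ae leb, forall x, x \in `[0, 1] ->
    coupling_up v x = - iC * (v x 0 0 + iC * v x 1 0) /\
    coupling_dn v x = iC * (v x 0 0 - iC * v x 1 0)}.
  have := @ae_of_open R (fun=> True) (aeW leb (fun _ _ => I)).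
  apply: (@filterS _ _ (ae_filter_ringOfSetsType leb)) => x H xI.
  by have [xo _] := H xI; rewrite /coupling_up /coupling_dn /trunc xo.
have ee0 (w : C) : ee w 0 = 1 by rewrite /ee mulr0 cexp0.
split.
- apply: (AC_ae_eq Ap).
    apply: cmeasM (AC_meas Aq); apply: cmeasM (mE _); apply: cmeasM; first exact: mw.
    by apply: cmeasM mu; exact: cmeas_cst.
  apply: (@filterS2 _ _ (ae_filter_ringOfSetsType leb) _ _ _ _ ae1 feq) => x H1 H2 xI.
  have [-> _] := H1 xI; have [h1 h2] := H2 xI.
  have [E _] := coupling_algebra iC_sqr h1 h2.
  rewrite (_ : _ + _ = ee (- lam) x * (iC * - lam * (f x 0 0 + iC * f x 1 0) + (f1 x + iC * f2 x))).
    by rewrite E -(wave_shift_up x lamE); ring: sg2.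
  by ring.
- apply: (AC_ae_eq Aq).
    apply: cmeasM (AC_meas Ap); apply: cmeasM (mE _); apply: cmeasM; first exact: mw.
    by apply: cmeasM md; exact: cmeas_cst.
  apply: (@filterS2 _ _ (ae_filter_ringOfSetsType leb) _ _ _ _ ae1 feq) => x H1 H2 xI.
  have [_ ->] := H1 xI; have [h1 h2] := H2 xI.
  have [_ E] := coupling_algebra iC_sqr h1 h2.
  rewrite (_ : _ + _ = ee lam x * (iC * lam * (f x 0 0 - iC * f x 1 0) + (f1 x - iC * f2 x))).
    by rewrite E -(wave_shift_dn x lamE); ring.
  by ring.
- by rewrite ee0 mul1r fp mulVf.
- by rewrite ee0 mul1r fm mulrACA sg2 mulVf ?mulr1.
Qed.

End Dirac.

(** * Identification of the main terms *)

Section MainTerms.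
Context {R : realType}.
Notation C := R[i].
Notation Re := (@complex.Re R).
Notation Im := (@complex.Im R).
Notation nrm := (@Normc.normc R).
Notation leb := (@lebesgue_measure R).
Implicit Types (v : R -> 'cV[C]_2) (w : 'cV[C]_2).

Lemma expJ_mul (t : R) w :
  (expJ t *m w) 0 0 = (cos t)%:C * w 0 0 + (sin t)%:C * w 1 0 /\
  (expJ t *m w) 1 0 = - (sin t)%:C * w 0 0 + (cos t)%:C * w 1 0.
Proof.
split; rewrite mxE sum_I2 /expJ expmxJ !mxE/=; congr (_ * _ + _ * _);
  by apply: complex_ext; rewrite /= ?oppr0 ?mulr1 ?mulr0 ?addr0 ?add0r ?mulrN1.
Qed.

Lemma expJD (s t : R) w : expJ s *m (expJ t *m w) = expJ (s + t) *m w.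
Proof.
have D : (cos (s + t))%:C = (cos s)%:C * (cos t)%:C - (sin s)%:C * (sin t)%:C :> C.
  by rewrite cosD; apply: complex_ext; rewrite !(ReB, ReM, ImB, ImM)/=; ring.
have S : (sin (s + t))%:C = (sin s)%:C * (cos t)%:C + (cos s)%:C * (sin t)%:C :> C.
  by rewrite sinD; apply: complex_ext; rewrite !(ReD, ReM, ImD, ImM)/=; ring.
have [E0 E1] := expJ_mul t w; have [F0 F1] := expJ_mul s (expJ t *m w).
have [G0 G1] := expJ_mul (s + t) w; rewrite E0 E1 in F0 F1; rewrite D S in G0 G1.
apply/matrixP => i j; rewrite (ord1 j).
have [->|->] : i = 0 \/ i = 1.
  by case: i => [[|[|i]] hi] //; [left|right]; exact: val_inj.
  by rewrite F0 G0; ring.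
by rewrite F1 G1; ring.
Qed.

(** A Fourier coefficient at an arbitrary frequency. As [Fstar] rotates by -pi x, the coefficient of
    [Fstar v] has frequency 2 pi n - pi = 2 o_n, and all three main terms take one form. *)
Definition fourier_at (o : R) v : 'cV[C]_2 :=
  integral2 `]0, 1[ (fun x => expJ (2 * o * x) *m v x).

Lemma Fourier_at v n : Fourier v n = fourier_at (neumann0 n) v.
Proof.
rewrite /Fourier /fourier_at; congr integral2; apply/funext => x.
by have -> : 2 * pi * n%:~R * x = 2 * neumann0 n * x by rewrite /neumann0; ring.
Qed.

Lemma Fourier_Fstar v n : Fourier (Fstar v) n = fourier_at (mixed0 n) v.
Proof.
rewrite /Fourier /fourier_at; congr integral2; apply/funext => x.
rewrite /Fstar expJD.
by have -> : 2 * pi * n%:~R * x - pi * x = 2 * mixed0 n * x by rewrite /mixed0; field.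
Qed.

Lemma J1_mul w : (J1 *m w) 0 0 = w 0 0 /\ (J1 *m w) 1 0 = - w 1 0.
Proof.
by split; rewrite mxE sum_I2 !mxE/= ?mul0r ?mul1r ?addr0 ?add0r ?mulN1r.
Qed.

Lemma wave_cos_sin (o x : R) :
  wave (2 * o) x = (cos (2 * o * x))%:C + iC * (sin (2 * o * x))%:C /\
  wave (- (2 * o)) x = (cos (2 * o * x))%:C - iC * (sin (2 * o * x))%:C.
Proof.
have H (w : R) : wave w x = (cos (w * x))%:C + iC * (sin (w * x))%:C.
  rewrite /wave (_ : iC * w%:C * x%:C = 0 +i* (w * x)); last first.
    by apply: complex_ext; rewrite /=; ring.
  by rewrite cexp_i.
by rewrite !H mulNr cosN sinN; split=> //; apply: complex_ext; rewrite /=; ring.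
Qed.

Lemma open_cint (f : R -> C) : cL1 f ->
  (\int[leb]_(x in `]0, 1[) Re (f x)) +i* (\int[leb]_(x in `]0, 1[) Im (f x)) =
  cint 0 1 f.
Proof. by move=> [f1 f2]; rewrite !open_rint. Qed.

(** By Euler's formula, half the sum of e^{2iox} (v1 - i v2) and e^{-2iox} (v1 + i v2) is v1
    cos(2ox) + v2 sin(2ox), the first row of the rotation; their half difference gives the
    second. *)
Lemma coupling_mean (o : R) v : inHC v ->
  let A := cint 0 1 (fun x => wave (- (2 * o)) x * coupling_up v x) in
  let B := cint 0 1 (fun x => wave (2 * o) x * coupling_dn v x) in
  (B - A) / (2 * iC) = fourier_at o v 0 0 /\ (A + B) / 2 = fourier_at o v 1 0.
Proof.
move=> Hv A B; have [mu md] := coupling_L2 Hv.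
have l0 : (0 : R) <= 0 by []. have l1 : (1 : R) <= 1 by [].
have ai := cL2_L1 (cL2_mulAC mu (AC_wave (- (2 * o)))).
have bi := cL2_L1 (cL2_mulAC md (AC_wave (2 * o))).
have i2 : 2 * iC != 0 :> C by rewrite mulf_neq0 ?two_neq0 ?iC_neq0.
have iV : iC^-1 = - iC :> C.
  by apply: (mulfI iC_neq0); rewrite mulfV ?iC_neq0// mulrN iC_sqr opprK.
have val x : x \in `]0, 1[ ->
    (2 * iC)^-1 * (wave (2 * o) x * coupling_dn v x - wave (- (2 * o)) x * coupling_up v x) =
      (expJ (2 * o * x) *m v x) 0 0 /\
    2^-1 * (wave (- (2 * o)) x * coupling_up v x + wave (2 * o) x * coupling_dn v x) =
      (expJ (2 * o * x) *m v x) 1 0.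
  move=> xo; have [-> ->] := expJ_mul (2 * o * x) (v x).
  have [-> ->] := wave_cos_sin o x.
  rewrite /coupling_dn /coupling_up /trunc xo invfM iV.
  move: (cos _)%:C (sin _)%:C (v x 0 0) (v x 1 0) (@two_neq0 R) (@iC_sqr R) => c s p q t0 ii.
  by split; field: ii.
split.
  rewrite mulrC -cintB// -cintZ//; last by apply: cL1B.
  rewrite -open_cint; last exact/cL1Z/cL1B.
  rewrite mxE; apply: complex_ext; apply: eq_Rintegral => x; rewrite inE/= => /val[-> _] //.
rewrite mulrC -cintD// -cintZ//; last by apply: cL1D.
rewrite -open_cint; last exact/cL1Z/cL1D.
rewrite mxE; apply: complex_ext; apply: eq_Rintegral => x; rewrite inE/= => /val[_ ->] //.
Qed.

Lemma fourier_at_real (o : R) v : inHC v -> real_potential v ->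
  Im (fourier_at o v 1 0) = 0.
Proof.
move=> Hv vr; have [_ <-] := coupling_mean o Hv.
have [mu md] := coupling_L2 Hv.
have l0 : (0 : R) <= 0 by []. have l1 : (1 : R) <= 1 by [].
have ai := cL2_L1 (cL2_mulAC mu (AC_wave (- (2 * o)))).
have bi := cL2_L1 (cL2_mulAC md (AC_wave (2 * o))).
rewrite mulrC -cintD// -cintZ//; last by apply: cL1D.
rewrite Im_cint (@rint_ae_eq _ 0 1 _ (fun=> 0))//.
- by rewrite rint_cst// mul0r.
- by have [] := cL1Z 2^-1 (cL1D ai bi).
- exact: measurable_cst.
have := ae_of_open vr.
apply: (@filterS _ _ (ae_filter_ringOfSetsType leb)) => x H xI.
have [xo Hx] := H xI; have [h0 h1] := (Hx 0, Hx 1).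
have [E E'] := wave_cos_sin o x.
rewrite E E' /coupling_dn /coupling_up /trunc xo.
have -> : v x 0 0 = (Re (v x 0 0))%:C by apply: complex_ext => //=; rewrite h0.
have -> : v x 1 0 = (Re (v x 1 0))%:C by apply: complex_ext => //=; rewrite h1.
move: (cos _) (sin _) (Re _) (Re _) => c s p q.
have -> : 2^-1 = (2^-1)%:C :> C.
  by apply: complex_ext; rewrite /=; field.
by rewrite !(ImM, ImD, ReM, ReD, ImN, ReN)/=; ring.
Qed.

End MainTerms.

(** * The three boundary problems *)

Section Cases.
Context {R : realType}.
Notation C := R[i].
Notation Re := (@complex.Re R).
Notation Im := (@complex.Im R).
Notation nrm := (@Normc.normc R).
Notation leb := (@lebesgue_measure R).
Implicit Types (v : R -> 'cV[C]_2).

Lemma sign_sqr (n : int) : (-1) ^ n * (-1) ^ n = 1 :> C.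
Proof. by rewrite -expfzMl mulrNN mulr1 exp1rz. Qed.

Lemma nrm_sqr1 (c : C) : c * c = 1 -> nrm c = 1.
Proof.
move=> cc; have := nrmM c c; rewrite cc nrm1 => /esym/eqP.
by rewrite -expr2 sqrp_eq1 ?nrm_ge0// => /eqP.
Qed.

Lemma ee_int (c : C) (n : int) : ee (c * n%:~R) 1 = ee c 1 ^ n.
Proof.
have H (m : nat) : ee (c * m%:R) 1 = ee c 1 ^+ m.
  elim: m => [|m IH]; first by rewrite mulr0 expr0 /ee mulr0 mul0r cexp0.
  rewrite exprS -IH -eeD (_ : c * m.+1%:R = c + c * m%:R)//.
  by rewrite -natr1; ring.
by case: n => m; [exact: H|rewrite NegzE mulrNz mulrN eeN H].
Qed.

Lemma ee_pi : ee (pi%:C) 1 = -1 :> C.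
Proof.
rewrite /ee (_ : _ * _ = 0 +i* pi); last by apply: complex_ext; rewrite /=; ring.
by rewrite cexp_i cospi sinpi; apply: complex_ext; rewrite /=; ring.
Qed.

Lemma ee_pihalf : ee ((pi / 2)%:C) 1 = iC :> C.
Proof.
rewrite /ee (_ : _ * _ = 0 +i* (pi / 2)); last by apply: complex_ext; rewrite /=; ring.
by rewrite cexp_i cos_pihalf sin_pihalf; apply: complex_ext; rewrite /=; ring.
Qed.

Lemma ee_neumann n : ee ((neumann0 n)%:C) 1 = (-1) ^ n :> C.
Proof. by rewrite -ee_pi -ee_int /neumann0 rmorphM rmorph_int. Qed.

Lemma ee_mixed n : ee ((mixed0 n)%:C) 1 = - iC * (-1) ^ n :> C.
Proof.
rewrite (_ : (mixed0 n)%:C = (neumann0 n)%:C + - (pi / 2)%:C :> C); last first.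
  by apply: complex_ext; rewrite /mixed0 /neumann0 /=; field.
rewrite eeD eeN ee_pihalf ee_neumann mulrC; congr (_ * _).
by apply: (mulfI iC_neq0); rewrite mulfV ?iC_neq0// mulrN iC_sqr opprK.
Qed.

Lemma separated_pi (o : int -> R) (o0 : R) : (forall n, o n = pi * n%:~R + o0) ->
  separated (fun n => - (2 * o n)) /\ separated (fun n => 2 * o n).
Proof.
move=> oE; split=> n m.
  exists (m - n); split; first by rewrite !oE rmorphB/=; ring.
  by move/eqP; rewrite subr_eq0 => /eqP.
exists (n - m); split; first by rewrite !oE rmorphB/=; ring.
by move/eqP; rewrite subr_eq0 => /eqP.
Qed.

(** Depends on the centre only: by [close_bound], on the ball the squared norm of each coupling is
    at most twice that of the centre plus 1. *)
Definition potential_bound (u : R -> 'cV[R]_2) : R :=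
  324 * (2 * (rint 0 1 (fun x => nrm (coupling_up (complexify u) x) ^+ 2) +
              rint 0 1 (fun x => nrm (coupling_dn (complexify u) x) ^+ 2)) + 1) + 1.

Lemma potential_bound_gt0 u : 0 < potential_bound u.
Proof.
have pos (f : R -> C) : 0 <= rint 0 1 (fun x => nrm (f x) ^+ 2).
  by apply: rint_ge0 => x _; exact: sqr_ge0.
rewrite /potential_bound; have := pos (coupling_up (complexify u)).
have := pos (coupling_dn (complexify u)).
by move: (rint _ _ _) (rint _ _ _) => X Y; lra.
Qed.

Lemma ball_couplings u v : inH u -> ballHC u (4 ^- 4 * expR (- 3 * normH u)) v ->
  [/\ rint 0 1 (fun x => nrm (coupling_up v x - coupling_up (complexify u) x) ^+ 2) <=
        2 * 256^-1 ^+ 2,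
      rint 0 1 (fun x => nrm (coupling_dn v x - coupling_dn (complexify u) x) ^+ 2) <=
        2 * 256^-1 ^+ 2,
      324 * rint 0 1 (fun x => nrm (coupling_up v x) ^+ 2) <= potential_bound u &
      324 * rint 0 1 (fun x => nrm (coupling_dn v x) ^+ 2) <= potential_bound u].
Proof.
move=> Hu Hb; have Hv := Hb.1; have b := ball_bound Hb.
have Hc := inHC_complexify Hu.
have [vu vd] := coupling_L2 Hv; have [uu ud] := coupling_L2 Hc.
have sub (f g : R -> C) : cL2 f -> cL2 g -> cL2 (fun x => f x - g x).
  by move=> f2 g2; apply: cL2_eq (cL2D f2 (cL2Z (-1) g2)) => x _; rewrite mulN1r.
pose w x := v x - complexify u x.
have tw j : cL2 (trunc j w).
  apply: cL2_eq (sub _ _ (trunc_L2 j Hv) (trunc_L2 j Hc)) => x _.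
  by rewrite /trunc /w !mxE; case: ifP; rewrite ?subr0.
have wu : cL2 (coupling_up w).
  by apply: cL2_eq (sub _ _ vu uu) => x _; rewrite (couplingB v _ x).1.
have wd : cL2 (coupling_dn w).
  by apply: cL2_eq (sub _ _ vd ud) => x _; rewrite (couplingB v _ x).2.
have [n1 n2] := coupling_norm (tw 0) (tw 1) wu wd.
have h1 : rint 0 1 (fun x => nrm (coupling_up v x - coupling_up (complexify u) x) ^+ 2) <=
    2 * 256^-1 ^+ 2.
  rewrite (@eq_rint _ 0 1 _ (fun x => nrm (coupling_up w x) ^+ 2)); last first.
    by move=> x _; rewrite (couplingB v _ x).1.
  by apply: le_trans n1 _; rewrite ler_wpM2l.
have h2 : rint 0 1 (fun x => nrm (coupling_dn v x - coupling_dn (complexify u) x) ^+ 2) <=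
    2 * 256^-1 ^+ 2.
  rewrite (@eq_rint _ 0 1 _ (fun x => nrm (coupling_dn w x) ^+ 2)); last first.
    by move=> x _; rewrite (couplingB v _ x).2.
  by apply: le_trans n2 _; rewrite ler_wpM2l.
have pos (f : R -> C) : 0 <= rint 0 1 (fun x => nrm (f x) ^+ 2).
  by apply: rint_ge0 => x _; exact: sqr_ge0.
have k1 := close_bound vu uu h1; have k2 := close_bound vd ud h2.
have p1 := pos (coupling_up (complexify u)); have p2 := pos (coupling_dn (complexify u)).
split=> //; rewrite /potential_bound; clear -k1 k2 p1 p2.
  by move: k1 k2 p1 p2; do 4 move: (rint _ _ _) => ?; lra.
by move: k1 k2 p1 p2; do 4 move: (rint _ _ _) => ?; lra.
Qed.

(* Normalising [f_1 + i f_2] and [f_1 - i f_2] by their initial values [p0] and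
   [sg * p0] multiplies both couplings by the sign [sg], which is -1 for [phi]. *)
Lemma asymptotics_case (d : R) (u : R -> 'cV[R]_2) (o : int -> R) (o0 : R) (sg : C) :
  1 < d -> inH u -> (forall n, o n = pi * n%:~R + o0) -> sg * sg = 1 -> Im sg = 0 ->
  exists N : nat, forall v : R -> 'cV[C]_2,
    ballHC u (4 ^- 4 * expR (- 3 * normH u)) v ->
  forall (sol : C -> R -> 'cV[C]_2) (p0 : C), p0 != 0 ->
    (forall lam, [/\ dirac_solution v lam (sol lam),
       sol lam 0 0 0 + iC * sol lam 0 1 0 = p0 &
       sol lam 0 0 0 - iC * sol lam 0 1 0 = sg * p0]) ->
  forall (N' : nat) (F G : C -> C) (sgn kap : int -> C) (main : int -> 'cV[C]_2),
    (N <= N')%N -> (forall n, kap n * kap n = 1) -> (forall n, sgn n * sgn n = 1) ->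
    (forall n lam, let f := sol lam 1 in
       kap n * F lam = (ee (- (o n)%:C) 1 * (p0^-1 * (f 0 0 + iC * f 1 0)) -
         ee (o n)%:C 1 * (sg * p0^-1 * (f 0 0 - iC * f 1 0))) / (2 * iC) /\
       sgn n * G lam = (ee (- (o n)%:C) 1 * (p0^-1 * (f 0 0 + iC * f 1 0)) +
         ee (o n)%:C 1 * (sg * p0^-1 * (f 0 0 - iC * f 1 0))) / 2) ->
    (forall n, main n = sg *: (J1 *m fourier_at (o n) v)) ->
  asymptotics d N' (2 * (error_const (potential_bound u) *
    error_total d (potential_bound u)) `^ d) v F G o sgn main.
Proof.
move=> d1 Hu oE sg2 sgr; set L := potential_bound u.
have L0 : 0 < L := potential_bound_gt0 u.
have [s1 s2] := separated_pi oE.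
have [uu ud] := coupling_L2 (inHC_complexify Hu).
have sg1 := nrm_sqr1 sg2.
have sgn1 (f : R -> C) : (fun x => nrm (sg * f x) ^+ 2) = (fun x => nrm (f x) ^+ 2).
  by apply/funext => x; rewrite nrmM sg1 mul1r.
have sgnB (f g : R -> C) : (fun x => nrm (sg * f x - sg * g x) ^+ 2) =
    (fun x => nrm (f x - g x) ^+ 2).
  by apply/funext => x; rewrite -mulrBr nrmM sg1 mul1r.
have [N HN] := uniform_index L0 s1 s2 (cL2Z sg uu) (cL2Z sg ud).
exists N => v Hb sol p0 p00 Hsol N' F G sgn kap main NN' kap2 sgn2 FG mainE.
have Hv := Hb.1; have [vu vd] := coupling_L2 Hv.
have [b1 b2 b3 b4] := ball_couplings Hu Hb.
have [u2 d2] := (cL2Z sg vu, cL2Z sg vd).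
pose P lam x := p0^-1 * (ee (- lam) x * (sol lam x 0 0 + iC * sol lam x 1 0)).
pose Q lam x := sg * p0^-1 * (ee lam x * (sol lam x 0 0 - iC * sol lam x 1 0)).
have Hak n z : akns z (fun x => wave (- (2 * o n)) x * (sg * coupling_up v x))
    (fun x => wave (2 * o n) x * (sg * coupling_dn v x))
    (P ((o n)%:C + z)) (Q ((o n)%:C + z)).
  by have [D E1 E2] := Hsol ((o n)%:C + z); exact: dirac_akns.
have mul_sg (w : R) (f : R -> C) : cL2 f ->
    cint 0 1 (fun x => wave w x * (sg * f x)) = sg * cint 0 1 (fun x => wave w x * f x).
  move=> f2; rewrite -cintZ//; last exact: cL2_L1 (cL2_mulAC f2 (AC_wave _)).
  by apply: eq_cint => x _; ring.
have ee_val n z : ee z 1 * P ((o n)%:C + z) 1 =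
      ee (- (o n)%:C) 1 * (p0^-1 * (sol ((o n)%:C + z) 1 0 0 + iC * sol ((o n)%:C + z) 1 1 0)) /\
    ee (- z) 1 * Q ((o n)%:C + z) 1 =
      ee (o n)%:C 1 * (sg * p0^-1 * (sol ((o n)%:C + z) 1 0 0 - iC * sol ((o n)%:C + z) 1 1 0)).
  rewrite /P /Q; set f := sol _ _; split.
    have -> : ee (- (o n)%:C) 1 = ee z 1 * ee (- ((o n)%:C + z)) 1.
      by rewrite -eeD opprD addrCA addrN addr0.
    by ring.
  have -> : ee (o n)%:C 1 = ee (- z) 1 * ee ((o n)%:C + z) 1.
    by rewrite -eeD addrCA addNr addr0.
  by ring.
apply: (@asymptotics_core R v
  (fun n x => wave (- (2 * o n)) x * (sg * coupling_up v x))
  (fun n x => wave (2 * o n) x * (sg * coupling_dn v x))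
  (fun x => nrm (sg * coupling_up v x)) (fun x => nrm (sg * coupling_dn v x))
  L d N' o sgn kap F G P Q main d1 (wave_family s1 u2) (wave_family s2 d2) L0).
- by rewrite sgn1.
- by rewrite sgn1.
- by move=> n; rewrite !oE rmorphD/=; ring.
- exact: Hak.
- move=> n Nn z rz; apply: (HN _ _ u2 d2 _ _ _ _ n (leq_trans NN' Nn) z _ _ rz (Hak n z)).
  + by rewrite sgn1.
  + by rewrite sgn1.
  + by rewrite sgnB.
  + by rewrite sgnB.
- by move=> n z; have [-> _] := FG n ((o n)%:C + z); rewrite /char_fun; have [-> ->] := ee_val n z.
- by move=> n z; have [_ ->] := FG n ((o n)%:C + z); rewrite /norm_fun; have [-> ->] := ee_val n z.
- by move=> n; exact: nrm_sqr1.
- by move=> n; exact: nrm_sqr1.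
- move=> n; rewrite mainE mxE (J1_mul _).1 !mul_sg//.
  by have [<- _] := coupling_mean (o n) Hv; ring.
- move=> n; rewrite mainE mxE (J1_mul _).2 !mul_sg//.
  by have [_ <-] := coupling_mean (o n) Hv; ring.
- move=> vr n; rewrite mainE mxE (J1_mul _).2 mulrN ImN ImM sgr.
  by rewrite (fourier_at_real (o n) Hv vr); ring.
Qed.

End Cases.

Theorem theorem4p9 (R : realType) (d : R) (hd : 1 < d < 2)
    (u : R -> 'cV[R]_2) (hu : inH u) :
  exists (N : nat) (M : R),
  forall v : R -> 'cV[R[i]]_2,
    ballHC u (4 ^- 4 * expR (- 3 * normH u)) v ->
  forall theta phi : R[i] -> R -> 'cV[R[i]]_2,
    fundamental_solutions v theta phi ->
  [/\ asymptotics d N M v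
        (fun z => theta z 1 1 0) (fun z => theta z 1 0 0)
        neumann0 (fun n => (-1) ^ n)
        (fun n => J1 *m Fourier v n),
      asymptotics d N M v
        (fun z => phi z 1 1 0) (fun z => phi z 1 0 0)
        mixed0 (fun n => (-1) ^ n)
        (fun n => - (J1 *m Fourier (Fstar v) n)) &
      asymptotics d N M v
        (fun z => theta z 1 0 0) (fun z => theta z 1 1 0)
        mixed0 (fun n => (-1) ^ (n + 1))
        (fun n => J1 *m Fourier (Fstar v) n)].
Proof.
have /andP[d1 _] := hd.
have neumannE n : neumann0 n = pi * n%:~R + 0 :> R by rewrite addr0.
have mixedE n : mixed0 n = pi * n%:~R + - (pi / 2) :> R by rewrite /mixed0; field.
have one_sqr : (1 : R[i]) * 1 = 1 by rewrite mulr1.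
have opp_sqr : (-1 : R[i]) * -1 = 1 by rewrite mulrNN mulr1.
have opp_real : complex.Im (-1 : R[i]) = 0 by rewrite /= oppr0.
(* For [theta] both combinations f1 +- i f2 start at 1, so sg = 1; for [phi] they start at i and -i,
   so sg = -1, which is the minus sign of the second asymptotics. *)
have [N1 H1] := asymptotics_case d1 hu neumannE one_sqr (erefl _).
have [N2 H2] := asymptotics_case d1 hu mixedE opp_sqr opp_real.
have [N3 H3] := asymptotics_case d1 hu mixedE one_sqr (erefl _).
exists (maxn N1 (maxn N2 N3)).
exists (2 * (error_const (potential_bound u) * error_total d (potential_bound u)) `^ d).
move=> v Hv theta phi Hs.
have i0 := @iC_neq0 R; have ii := @iC_sqr R.
have iV : iC^-1 = - iC :> R[i].
  by apply: (mulfI i0); rewrite mulfV// mulrN ii opprK.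
have eN n : ee (- (neumann0 n)%:C) 1 = (-1) ^ n :> R[i].
  by rewrite eeN ee_neumann; apply: (mulfI (ee_neq0 (neumann0 n)%:C 1));
    rewrite ee_neumann sign_sqr mulfV// -ee_neumann ee_neq0.
have eM n : ee (- (mixed0 n)%:C) 1 = iC * (-1) ^ n :> R[i].
  rewrite eeN; apply: (mulfI (ee_neq0 (mixed0 n)%:C 1)); rewrite mulfV ?ee_neq0//.
  by rewrite ee_mixed mulrACA mulNr ii opprK sign_sqr mulr1.
have theta_init lam : [/\ dirac_solution v lam (theta lam),
    theta lam 0 0 0 + iC * theta lam 0 1 0 = 1 &
    theta lam 0 0 0 - iC * theta lam 0 1 0 = 1 * 1].
  by have [D -> _ _] := Hs lam; split=> //; rewrite !mxE/=; ring.
have phi_init lam : [/\ dirac_solution v lam (phi lam),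
    phi lam 0 0 0 + iC * phi lam 0 1 0 = iC &
    phi lam 0 0 0 - iC * phi lam 0 1 0 = -1 * iC].
  by have [_ _ D ->] := Hs lam; split=> //; rewrite !mxE/=; ring.
have sgS n : (-1) ^ (n + 1) = - (-1) ^ n :> R[i].
  by rewrite expfzDr ?oppr_eq0 ?oner_eq0// expr1z mulrN1.
split.
(* Both e^{i o_n} and e^{-i o_n} equal (-1)^n here, so the difference and the sum of f1 + i f2 and
   f1 - i f2 isolate f2 and f1. *)
- apply: (H1 v Hv theta 1 (oner_neq0 _) theta_init _ _ _ _ (fun n => (-1) ^ n)).
  + by rewrite leq_maxl.
  + exact: sign_sqr.
  + exact: sign_sqr.
  + move=> n lam f; rewrite eN ee_neumann invr1 invfM iV -/f.
    by move: ((-1) ^ n) (f 0 0) (f 1 0) => s f0 f1; split; field: ii.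
  + by move=> n; rewrite scale1r Fourier_at.
- apply: (H2 v Hv phi iC i0 phi_init _ _ _ _ (fun n => (-1) ^ n)).
  + by rewrite !leq_max leqnn orbT.
  + exact: sign_sqr.
  + exact: sign_sqr.
  + move=> n lam f; rewrite eM ee_mixed invfM iV -/f.
    by move: ((-1) ^ n) (f 0 0) (f 1 0) => s f0 f1; split; field: ii.
  + by move=> n; rewrite scaleN1r Fourier_Fstar.
(* Now e^{-+i o_n} = +-i (-1)^n turns the difference into a sum: f1 becomes the characteristic
   function, and f2 appears in [G] with i^2 = -1, whence the sign (-1)^(n+1). *)
- apply: (H3 v Hv theta 1 (oner_neq0 _) theta_init _ _ _ _ (fun n => (-1) ^ n)).
  + by rewrite !leq_max leqnn !orbT.
  + exact: sign_sqr.
  + by move=> n; rewrite sgS mulrNN sign_sqr.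
  + move=> n lam f; rewrite sgS eM ee_mixed invr1 invfM iV -/f.
    by move: ((-1) ^ n) (f 0 0) (f 1 0) => s f0 f1; split; field: ii.
  + by move=> n; rewrite scale1r Fourier_Fstar.
Qed.
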